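(* Let $F,G\in\mathcal S$ be such that there is a constant $C>0$ with $|F(s)|\le C|G(s)|$ for all $s$ with $\Re s>1/2$. Then $F(s)=G(s)$ identically.
   Context: The Selberg class $\mathcal S$ consists of the Dirichlet series $F(s)=\sum_{n\ge1}a(n)n^{-s}$ such that: (i) the series converges absolutely for $\Re s>1$; (ii) for some integer $m\ge0$, $(s-1)^mF(s)$ extends to an entire function of finite order; (iii) $F$ satisfies a functional equation $\Phi(s)=\omega\overline{\Phi(1-\overline{s})}$, where $\Phi(s)=Q^s\prod_{j=1}^r\Gamma(\lambda_js+\mu_j)F(s)$ with $r\ge0$, $Q>0$, $\lambda_j>0$, $\mu_j\in\mathbb C$ with $\Re\mu_j\ge0$, and $|\omega|=1$; (iv) $a(n)\ll_\varepsilon n^{\varepsilon}$ for every $\varepsilon>0$; (v) $\log F(s)=\sum_{n\ge1}b(n)n^{-s}$ for $\Re s>1$, where $b(n)=0$ unless $n$ is a prime power, and $b(n)\ll n^{\theta}$ for some $\theta<1/2$. *)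

(* Defs.v *)
(* Stdlib world: concrete reals, with Coquelicot for C, series and derivatives. *)
From Stdlib Require Import Reals ZArith Znumtheory.
From Coquelicot Require Import Coquelicot.

Open Scope C_scope.

Definition Cexp (z : C) : C :=
  (exp (Re z) * cos (Im z), exp (Re z) * sin (Im z))%R.

(* [x ^ s] for a real base [x > 0], with the real logarithm. *)
Definition Rcpow (x : R) (s : C) : C := Cexp (s * ln x).

Fixpoint Cprod (f : nat -> C) (n : nat) : C :=
  match n with
  | O => 1
  | S k => Cprod f k * f k
  end.

(* Limit taken componentwise; a junk value if the sequence diverges. *)
Definition Clim (u : nat -> C) : C :=
  (real (Lim_seq (fun n => Re (u n))), real (Lim_seq (fun n => Im (u n)))).

(* Gauss's form of Euler's definition,
     Gamma(s) = lim n! n^s / (s (s+1) ... (s+n)),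
   valid at every complex [s] outside the poles 0, -1, -2, ... *)
Definition CGamma (s : C) : C :=
  Clim (fun n => INR (fact n) * Rcpow (INR n) s
                 / Cprod (fun k => s + INR k) (S n)).

Definition Gamma_pole (z : C) : Prop := exists k : nat, z = - INR k.

(* The sequences below are indexed by [n >= 1]: the value at 0 is ignored. *)
Definition dirichlet_term (a : nat -> C) (s : C) (n : nat) : C :=
  a (S n) * Rcpow (INR (S n)) (- s).

Definition is_dirichlet (a : nat -> C) (s l : C) : Prop :=
  is_series (K := C_AbsRing) (V := C_NormedModule) (dirichlet_term a s) l.

Definition dirichlet_abs_cv (a : nat -> C) (s : C) : Prop :=
  ex_series (fun n => Cmod (dirichlet_term a s n)).

Definition entire (H : C -> C) : Prop :=
  forall z : C, ex_derive (K := C_AbsRing) (V := C_NormedModule) H z.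

Definition finite_order (H : C -> C) : Prop :=
  exists rho r0 : R, (0 < r0)%R /\
    forall z : C, (r0 <= Cmod z)%R ->
      (Cmod (H z) <= exp (Rpower (Cmod z) rho))%R.

Definition prime_power (n : nat) : Prop :=
  exists p k : nat,
    prime (Z.of_nat p) /\ (1 <= k)%nat /\ n = Nat.pow p k.

Definition completed (F : C -> C) (Q : R) (r : nat)
    (lambda : nat -> R) (mu : nat -> C) (s : C) : C :=
  Rcpow Q s * Cprod (fun j => CGamma (lambda j * s + mu j)) r * F s.

Definition completed_defined (r : nat) (lambda : nat -> R) (mu : nat -> C)
    (s : C) : Prop :=
  s <> 1 /\ forall j : nat, (j < r)%nat -> ~ Gamma_pole (lambda j * s + mu j).

(* An identity between meromorphic functions: it is required at the points
   where both sides are given by finite values of [F] and of the Gamma factors. *)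
Definition functional_equation (F : C -> C) : Prop :=
  exists (r : nat) (Q : R) (lambda : nat -> R) (mu : nat -> C) (omega : C),
    (0 < Q)%R /\
    (forall j : nat, (j < r)%nat -> (0 < lambda j)%R /\ (0 <= Re (mu j))%R) /\
    Cmod omega = 1%R /\
    forall s : C,
      completed_defined r lambda mu s ->
      completed_defined r lambda mu (1 - Cconj s) ->
      completed F Q r lambda mu s
      = omega * Cconj (completed F Q r lambda mu (1 - Cconj s)).

(* [F] is the continuation to C \ {1} of the Dirichlet series with
   coefficients [a]; the value [F 1] is irrelevant.  In the last clause
   "log F(s) = sum b(n) n^-s" means that the series converges and is a
   logarithm of [F s]; since [b 1 = 0], it is the branch of log F that tends
   to 0 as Re s tends to infinity. *)
Record selberg_series (a : nat -> C) (F : C -> C) : Prop := {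
  selberg_dirichlet : forall s : C, (1 < Re s)%R ->
    dirichlet_abs_cv a s /\ is_dirichlet a s (F s);
  selberg_continuation : exists (m : nat) (H : C -> C),
    entire H /\ finite_order H /\
    forall s : C, s <> 1 -> H s = Cpow (s - 1) m * F s;
  selberg_functional_equation : functional_equation F;
  selberg_ramanujan : forall eps : R, (0 < eps)%R ->
    exists K : R, forall n : nat, (1 <= n)%nat ->
      (Cmod (a n) <= K * Rpower (INR n) eps)%R;
  selberg_euler_product : exists (b : nat -> C) (theta K : R),
    (theta < 1 / 2)%R /\
    (forall n : nat, (1 <= n)%nat -> ~ prime_power n -> b n = 0) /\
    (forall n : nat, (1 <= n)%nat ->
      (Cmod (b n) <= K * Rpower (INR n) theta)%R) /\
    forall s : C, (1 < Re s)%R ->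
      exists L : C, is_dirichlet b s L /\ Cexp L = F s
}.

Definition selberg_class (F : C -> C) : Prop :=
  exists a : nat -> C, selberg_series a F.

(* Main.v *)
(* Write h = F/G = exp(sum beta(n) n^-s).  Since |h| <= c on Re s > 1/2, every
   product of m vertical translates of h is bounded by c^m there.  Kronecker's
   theorem lets such translates imitate arbitrary characters; choosing k-th and
   2k-th roots of unity as values at the primes isolates the terms n = p^k, and a
   downward induction on k gives sum |beta(n)| n^(-1/2) < oo (it starts because
   beta(n) << n^theta with theta < 1/2).  Hence h = exp(L) with L absolutely
   convergent on Re s >= 1/2.  On the critical line the functional equations say
   that the argument of h is, up to a constant, that of a quotient of Gamma
   factors, whose second differences in t tend to 0.  So the second differences of
   Im L(1/2+it), which are almost periodic, tend to 0, all beta(n) vanish and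
   F = G.  Possible zeros of G are handled by multiplying out: |N| <= B |D| makes
   N^(M+2) / D^M holomorphic, and M -> oo gives a two-constants theorem for N / D. *)
Require Import Defs.
From Stdlib Require Import Reals Lra Lia Classical ClassicalEpsilon List FinFun ZArith Znumtheory.
From Coquelicot Require Import Coquelicot.
Local Open Scope C_scope.

(** * The complex exponential *)

(** Bounded products of translates only bound the real part of the twisted sums from above, so
    characters have to be chosen that make the surviving terms nonnegative. The comparison of such a
    product with an exponential is available only far to the right, where the Dirichlet series is
    dominated by [1/n^2]; carrying it to [Re s > 1/2] requires a propagation estimate whose
    constants depend neither on the translates nor on the truncation length. This is why the
    two-constants theorem is uniform in [N], [D] and the centre, and why identities are kept as
    inequalities [|N| <= eps |D|] between entire functions. It rests on the maximum principle,
    itself derived from Goursat's theorem on rectangles. Second differences are the right order on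
    the critical line: the argument of a Gamma factor grows like [t log t], whose slope is unbounded
    but whose second derivative decays like [1/t]. They are only seen through a sine, that is modulo
    [PI], and continuity in the increment removes this ambiguity. *)

Lemma Cexp_plus (z w : C) : Cexp (z + w) = Cexp z * Cexp w.
Proof.
  unfold Cexp, Re, Im; destruct z as [a b], w as [c d]; simpl.
  rewrite exp_plus, cos_plus, sin_plus.
  apply injective_projections; simpl; ring.
Qed.

Lemma Cexp_0 : Cexp 0 = 1.
Proof.
  unfold Cexp, Re, Im; simpl. rewrite exp_0, cos_0, sin_0.
  apply injective_projections; simpl; ring.
Qed.

Lemma Cmod_Cexp (z : C) : Cmod (Cexp z) = exp (Re z).
Proof.
  unfold Cmod, Cexp; simpl.
  replace (_ + _)%R with ((exp (Re z))^2 * ((sin (Im z))² + (cos (Im z))²))%R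
    by (unfold Rsqr; ring).
  rewrite sin2_cos2, Rmult_1_r.
  apply sqrt_pow2, Rlt_le, exp_pos.
Qed.

Lemma Cexp_neq_0 (z : C) : Cexp z <> 0.
Proof. apply Cmod_gt_0. rewrite Cmod_Cexp. apply exp_pos. Qed.

Lemma Cexp_opp (z : C) : Cexp (- z) = / Cexp z.
Proof.
  assert (H := Cexp_neq_0 z).
  rewrite <- (Cmult_1_r (Cexp (- z))), <- (Cinv_r (Cexp z)) by assumption.
  rewrite Cmult_assoc, <- Cexp_plus.
  replace (- z + z) with (RtoC 0) by ring. rewrite Cexp_0. ring.
Qed.

Lemma Cexp_minus (z w : C) : Cexp (z - w) = Cexp z / Cexp w.
Proof. unfold Cminus. now rewrite Cexp_plus, Cexp_opp. Qed.

Lemma Cexp_conj (z : C) : Cexp (Cconj z) = Cconj (Cexp z).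
Proof.
  unfold Cexp, Cconj, Re, Im; simpl. rewrite cos_neg, sin_neg.
  apply injective_projections; simpl; ring.
Qed.

Lemma Cexp_INR_mult (n : nat) (z : C) : Cexp (INR n * z) = Cpow (Cexp z) n.
Proof.
  induction n as [|n IH].
  - simpl. rewrite Cmult_0_l. apply Cexp_0.
  - rewrite S_INR, RtoC_plus, Cpow_S, <- IH, <- Cexp_plus.
    f_equal. ring.
Qed.

Lemma Cexp_RtoC (x : R) : Cexp x = exp x.
Proof.
  unfold Cexp, Re, Im; simpl. rewrite cos_0, sin_0.
  apply injective_projections; simpl; ring.
Qed.

Lemma exp_le_mono (x y : R) : (x <= y)%R -> (exp x <= exp y)%R.
Proof. intros [H|H]; [left; now apply exp_increasing|rewrite H; lra]. Qed.

Lemma Cmod_Cexp_le (z : C) (W : R) : (Cmod z <= W)%R -> (Cmod (Cexp z) <= exp W)%R.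
Proof.
  intros H. rewrite Cmod_Cexp. apply exp_le_mono.
  assert (H1 := re_le_Cmod z). apply Rabs_le_between in H1. lra.
Qed.

Lemma im_le_Cmod (z : C) : (Rabs (Im z) <= Cmod z)%R.
Proof.
  apply Rle_trans with (2 := Rmax_Cmod z). apply Rmax_r.
Qed.

Lemma re_sub_abs_le (z w : C) : (Rabs (Re z - Re w) <= Cmod (z - w))%R.
Proof. exact (re_le_Cmod (z - w)). Qed.

Lemma im_sub_abs_le (z w : C) : (Rabs (Im z - Im w) <= Cmod (z - w))%R.
Proof. exact (im_le_Cmod (z - w)). Qed.

Lemma Re_ge_of_disc (w : C) (a r : R) : (Cmod (w - RtoC a) <= r)%R -> (a - r <= Re w)%R.
Proof.
  intros H. assert (R1 := re_sub_abs_le w (RtoC a)).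
  apply Rle_trans with (2 := H) in R1. apply Rabs_le_between in R1. simpl in R1. lra.
Qed.

Lemma Cmod_le_re_im (z : C) : (Cmod z <= Rabs (Re z) + Rabs (Im z))%R.
Proof.
  destruct z as [x y]. simpl.
  replace (x, y) with (RtoC x + Ci * y)
    by (apply injective_projections; simpl; ring).
  eapply Rle_trans; [apply Cmod_triangle|].
  rewrite Cmod_mult, Cmod_Ci, !Cmod_R. lra.
Qed.

Lemma Cmod_sub_sym (z w : C) : Cmod (z - w) = Cmod (w - z).
Proof. rewrite <- Cmod_opp. f_equal. ring. Qed.

Lemma Cmod_triangle_sub (z w : C) : (Cmod z - Cmod w <= Cmod (z - w))%R.
Proof.
  assert (H := Cmod_triangle (z - w) w).
  replace (z - w + w) with z in H by ring. lra.
Qed.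

Lemma sin_abs_le (x : R) : (Rabs (sin x) <= Rabs x)%R.
Proof.
  destruct (Req_dec x 0) as [->|Hx].
  { rewrite sin_0, !Rabs_R0. lra. }
  destruct (MVT_gen sin 0 x cos) as [c [_ Hc]].
  - intros y _. apply is_derive_sin.
  - intros y _. apply continuity_sin.
  - rewrite sin_0, !Rminus_0_r in Hc. rewrite Hc, Rabs_mult.
    assert (H := COS_bound c).
    assert (Rabs (cos c) <= 1)%R by (apply Rabs_le; lra).
    assert (0 <= Rabs x)%R by apply Rabs_pos. nra.
Qed.

Lemma one_minus_cos_le (x : R) : (0 <= 1 - cos x <= x ^ 2 / 2)%R.
Proof.
  assert (H : (1 - cos x = 2 * (sin (x/2))^2)%R).
  { replace x with (2 * (x/2))%R at 1 by field. rewrite cos_2a_sin. ring. }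
  assert (H1 := sin_abs_le (x/2)).
  assert (H2 : ((sin (x/2))^2 <= (x/2)^2)%R).
  { rewrite <- (pow2_abs (sin (x/2))), <- (pow2_abs (x/2)).
    apply pow_incr. split; [apply Rabs_pos|exact H1]. }
  assert (H3 := pow2_ge_0 (sin (x/2))). nra.
Qed.


Lemma exp_taylor1_le (x : R) : (Rabs x <= 1/2)%R -> (0 <= exp x - 1 - x <= 2 * x ^ 2)%R.
Proof.
  intros Hx. apply Rabs_le_between in Hx.
  assert (H1 := exp_ineq1_le x). assert (H2 := exp_ineq1_le (- x)).
  split; [lra|].
  assert (H3 : (exp x * exp (- x) = 1)%R) by (rewrite <- exp_plus, Rplus_opp_r; apply exp_0).
  assert (H4 := exp_pos x).
  (* The upper bound comes from [exp (- x) >= 1 - x]: multiplying by [exp x] bounds [(1 - x) exp x]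
     by 1, and [1 - x >= 1/2] allows division. *)
  assert (H5 : (exp x * (1 - x) <= 1)%R) by nra.
  assert (H6 : ((1 - x) * (exp x - 1 - x) <= x ^ 2)%R) by nra.
  nra.
Qed.

Lemma sin_sub_abs_le (y : R) : (Rabs y <= 1)%R -> (Rabs (sin y - y) <= y ^ 2)%R.
Proof.
  intros Hy.
  destruct (MVT_gen (fun x => sin x - x)%R 0 y (fun x => cos x - 1)%R) as [c [Hc E]].
  - intros x _. auto_derive; [trivial|ring].
  - intros x _. apply continuity_minus; [apply continuity_sin|].
    apply derivable_continuous, derivable_id.
  - rewrite sin_0, !Rminus_0_r in E. rewrite E, Rabs_mult.
    assert (H := one_minus_cos_le c).
    assert (Hc2 : (Rabs c <= Rabs y)%R).
    { unfold Rmin, Rmax in Hc. destruct (Rle_dec 0 y).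
      - rewrite !Rabs_pos_eq; lra.
      - rewrite (Rabs_left y) by lra. apply Rabs_le. lra. }
    rewrite Rabs_minus_sym, (Rabs_pos_eq (1 - cos c)) by lra.
    rewrite <- (pow2_abs y). rewrite <- (pow2_abs c) in H.
    assert (0 <= Rabs c)%R by apply Rabs_pos.
    assert (Rabs c ^ 2 <= Rabs y)%R by nra. nra.
Qed.

Lemma Cexp_taylor1 (z : C) :
  (Cmod z <= 1/2)%R -> (Cmod (Cexp z - 1 - z) <= 4 * Cmod z ^ 2)%R.
Proof.
  intros Hz. rewrite Cmod2_alt.
  assert (Hx := re_le_Cmod z). assert (Hy := im_le_Cmod z).
  destruct z as [x y]; unfold Re, Im in *; simpl fst in *; simpl snd in *.
  eapply Rle_trans; [apply Cmod_le_re_im|]. unfold Re, Im; simpl fst; simpl snd.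
  assert (Ex := exp_taylor1_le x ltac:(lra)).
  assert (Cy := one_minus_cos_le y).
  assert (Sy := sin_sub_abs_le y ltac:(lra)).
  assert (Sy' := sin_abs_le y).
  assert (Hex : (0 < exp x <= 2)%R).
  { split; [apply exp_pos|]. assert (H := Rabs_le_between x (1/2)).
    destruct H as [H _]. specialize (H ltac:(lra)). nra. }
  replace (exp x * cos y + - (1) + - x)%R with ((exp x - 1 - x) - exp x * (1 - cos y))%R by ring.
  replace (exp x * sin y + - 0 + - y)%R with ((exp x - 1) * sin y + (sin y - y))%R by ring.
  assert (A1 : (Rabs (exp x - 1 - x - exp x * (1 - cos y)) <= 2 * x ^ 2 + y ^ 2)%R)
    by (apply Rabs_le; nra).
  assert (A2 : (Rabs (exp x - 1) <= 2 * Rabs x)%R).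
  { replace (exp x - 1)%R with ((exp x - 1 - x) + x)%R by ring.
    eapply Rle_trans; [apply Rabs_triang|]. rewrite (Rabs_pos_eq (exp x - 1 - x)) by lra.
    rewrite <- (pow2_abs x) in Ex. assert (0 <= Rabs x)%R by apply Rabs_pos. nra. }
  assert (A3 : (Rabs ((exp x - 1) * sin y + (sin y - y)) <= 2 * Rabs x * Rabs y + y ^ 2)%R).
  { eapply Rle_trans; [apply Rabs_triang|]. rewrite Rabs_mult.
    assert (0 <= Rabs (sin y))%R by apply Rabs_pos.
    assert (0 <= Rabs x)%R by apply Rabs_pos.
    assert (0 <= Rabs (exp x - 1))%R by apply Rabs_pos. nra. }
  rewrite <- (pow2_abs x), <- (pow2_abs y) in *.
  nra.
Qed.

Lemma Cexp_sub_1_le (z : C) :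
  (Cmod z <= 1/2)%R -> (Cmod (Cexp z - 1) <= 3 * Cmod z)%R.
Proof.
  intros Hz. assert (H := Cexp_taylor1 z Hz).
  replace (Cexp z - 1) with ((Cexp z - 1 - z) + z) by ring.
  eapply Rle_trans; [apply Cmod_triangle|].
  assert (0 <= Cmod z)%R by apply Cmod_ge_0. nra.
Qed.

Lemma Cmod_Cexp_sub_le (a b : C) (W d : R) :
  (Cmod b <= W)%R -> (Cmod (a - b) <= d)%R -> (d <= 1 / 2)%R ->
  (Cmod (Cexp a - Cexp b) <= exp W * (3 * d))%R.
Proof.
  intros Hb Hab Hd.
  replace (Cexp a - Cexp b) with (Cexp b * (Cexp (a - b) - 1)).
  2:{ replace a with (b + (a - b)) at 2 by ring. rewrite Cexp_plus. ring. }
  rewrite Cmod_mult. apply Rmult_le_compat; try apply Cmod_ge_0.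
  - now apply Cmod_Cexp_le.
  - eapply Rle_trans; [apply Cexp_sub_1_le; lra|lra].
Qed.

(** * Complex differentiability *)

(** The uniform structure on [C] is that of a product, so its balls are squares; the factor [sqrt 2]
    compares them with the discs of [Cmod]. *)
Lemma continuous_C_iff {U : UniformSpace} (f : U -> C) (x : U) :
  continuous (U := C_UniformSpace) f x <->
  forall eps : R, (0 < eps)%R -> locally x (fun y => Cmod (f y - f x) < eps)%R.
Proof.
  split.
  - intros H eps He.
    assert (H2 : (0 < eps / sqrt 2)%R)
      by (apply Rdiv_lt_0_compat; [exact He|apply Rlt_sqrt2_0]).
    assert (H1 := proj1 (filterlim_locally (U := C_UniformSpace) _ _) H (mkposreal _ H2)).
    revert H1. apply filter_imp. intros y Hy.
    apply C_NormedModule_mixin_compat2 in Hy. simpl in Hy.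
    replace (sqrt 2 * (eps / sqrt 2))%R with eps in Hy
      by (field; assert (H3 := Rlt_sqrt2_0); lra).
    exact Hy.
  - intros H. apply filterlim_locally. intros eps.
    generalize (H eps (cond_pos eps)). apply filter_imp. intros y Hy.
    apply C_NormedModule_mixin_compat1. exact Hy.
Qed.

Lemma locally_C_iff (z : C) (P : C -> Prop) :
  locally (T := C_UniformSpace) z P <->
  exists d : R, (0 < d)%R /\ forall w : C, (Cmod (w - z) < d)%R -> P w.
Proof.
  split.
  - intros [d Hd]. exists d. split; [apply cond_pos|]. intros w Hw.
    apply Hd, C_NormedModule_mixin_compat1. exact Hw.
  - intros [d [Hd H]].
    assert (H2 : (0 < d / sqrt 2)%R)
      by (apply Rdiv_lt_0_compat; [exact Hd|apply Rlt_sqrt2_0]).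
    exists (mkposreal _ H2). intros w Hw. apply H.
    apply C_NormedModule_mixin_compat2 in Hw. simpl in Hw.
    replace (sqrt 2 * (d / sqrt 2))%R with d in Hw
      by (field; assert (H3 := Rlt_sqrt2_0); lra).
    exact Hw.
Qed.

Notation contC f z := (continuous (T := C_UniformSpace) (U := C_UniformSpace) f z).

Lemma contC_iff (f : C -> C) (z : C) :
  contC f z <->
  forall eps : R, (0 < eps)%R ->
    exists d : R, (0 < d)%R /\
      forall w : C, (Cmod (w - z) < d -> Cmod (f w - f z) < eps)%R.
Proof.
  rewrite continuous_C_iff. split; intros H eps He; apply locally_C_iff; auto.
Qed.

Lemma contC_plus {U : UniformSpace} (f g : U -> C) (z : U) :
  continuous (U := C_UniformSpace) f z -> continuous (U := C_UniformSpace) g z ->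
  continuous (U := C_UniformSpace) (fun w => f w + g w) z.
Proof. exact (continuous_plus (V := C_NormedModule) f g z). Qed.

Lemma contC_mult {U : UniformSpace} (f g : U -> C) (z : U) :
  continuous (U := C_UniformSpace) f z -> continuous (U := C_UniformSpace) g z ->
  continuous (U := C_UniformSpace) (fun w => f w * g w) z.
Proof.
  rewrite !continuous_C_iff. intros Hf Hg eps He.
  set (M := (Cmod (f z) + Cmod (g z) + 1)%R).
  assert (HM : (1 <= M)%R)
    by (assert (H1 := Cmod_ge_0 (f z)); assert (H2 := Cmod_ge_0 (g z)); unfold M; lra).
  assert (Hd : (0 < Rmin 1 (eps / (2 * M)))%R)
    by (apply Rmin_pos; [lra|apply Rdiv_lt_0_compat; lra]).
  generalize (filter_and _ _ (Hf _ Hd) (Hg _ Hd)). apply filter_imp. intros y [Hy1 Hy2].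
  assert (A1 := Rlt_le_trans _ _ _ Hy1 (Rmin_l _ _)).
  assert (A2 := Rlt_le_trans _ _ _ Hy1 (Rmin_r _ _)).
  assert (A3 := Rlt_le_trans _ _ _ Hy2 (Rmin_r _ _)).
  replace (f y * g y - f z * g z) with ((f y - f z) * (g y - g z) + (f y - f z) * g z + f z * (g y - g z)) by ring.
  assert (Hs : (M * (eps / (2 * M)) = eps / 2)%R) by (field; lra).
  eapply Rle_lt_trans; [apply Cmod_triangle|].
  eapply Rle_lt_trans; [apply Rplus_le_compat_r, Cmod_triangle|].
  rewrite !Cmod_mult.
  assert (B1 := Cmod_ge_0 (f y - f z)). assert (B2 := Cmod_ge_0 (g y - g z)).
  assert (B3 := Cmod_ge_0 (f z)). assert (B4 := Cmod_ge_0 (g z)).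
  unfold M in *. nra.
Qed.

Lemma contC_const {U : UniformSpace} (c : C) (z : U) :
  continuous (U := C_UniformSpace) (fun _ => c) z.
Proof. apply continuous_const. Qed.

Lemma contC_inv (z : C) : z <> 0 -> contC Cinv z.
Proof.
  intros Hz. apply contC_iff. intros eps He.
  assert (H0 : (0 < Cmod z)%R) by now apply Cmod_gt_0.
  exists (Rmin (Cmod z / 2) (eps * (Cmod z ^ 2 / 2)))%R.
  assert (Hp : (0 < Cmod z ^ 2 / 2)%R) by nra.
  split; [apply Rmin_pos; [lra|now apply Rmult_lt_0_compat]|].
  intros w Hw.
  assert (H1 := Rlt_le_trans _ _ _ Hw (Rmin_l _ _)).
  assert (H2 := Rlt_le_trans _ _ _ Hw (Rmin_r _ _)).
  assert (H3 := Cmod_triangle_sub z w). rewrite Cmod_sub_sym in H3.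
  assert (Hw0 : w <> 0) by (apply Cmod_gt_0; lra).
  replace (/ w - / z) with ((z - w) / (w * z)) by (field; auto).
  rewrite Cmod_div by now apply Cmult_neq_0.
  rewrite Cmod_mult, Cmod_sub_sym.
  apply Rmult_lt_reg_r with (Cmod w * Cmod z)%R; [nra|].
  unfold Rdiv. rewrite Rmult_assoc, Rinv_l by nra.
  eapply Rlt_le_trans; [rewrite Rmult_1_r; exact H2|].
  apply Rmult_le_compat_l; [lra|nra].
Qed.

Lemma contC_RtoC_comp (f : R -> C) (g : C -> C) (x : R) :
  continuous (U := C_UniformSpace) f x -> contC g (f x) ->
  continuous (U := C_UniformSpace) (fun t => g (f t)) x.
Proof. apply (continuous_comp (V := C_UniformSpace) (W := C_UniformSpace) f g x). Qed.

Lemma continuous_Cmod (z : C) : continuous (T := C_UniformSpace) Cmod z.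
Proof. exact (filterlim_norm (V := C_NormedModule) z). Qed.

Lemma continuous_pairC {U : UniformSpace} (f g : U -> R) (x : U) :
  continuous f x -> continuous g x ->
  continuous (U := C_UniformSpace) (fun t => (f t, g t)) x.
Proof.
  intros Hf Hg. apply filterlim_locally. intros eps.
  apply filter_and.
  - exact (proj1 (filterlim_locally _ _) Hf eps).
  - exact (proj1 (filterlim_locally _ _) Hg eps).
Qed.

Lemma continuous_Im (z : C) : continuous (T := C_UniformSpace) Im z.
Proof. apply continuous_snd. Qed.

(* Caratheodory's form of complex differentiability, in which the closure
   properties become algebraic identities. *)
Definition holo (f : C -> C) (z : C) : Prop :=
  exists phi : C -> C, contC phi z /\ forall w, f w = f z + phi w * (w - z).

Lemma holo_cont (f : C -> C) (z : C) : holo f z -> contC f z.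
Proof.
  intros [phi [Hp E]].
  apply (continuous_ext (T := C_UniformSpace) (U := C_UniformSpace)
    (fun w => f z + phi w * (w + - z))); [intros w; symmetry; apply E|].
  apply contC_plus; [apply contC_const|].
  apply contC_mult; [exact Hp|].
  apply contC_plus; [apply continuous_id|apply contC_const].
Qed.

Lemma holo_ext (f g : C -> C) (z : C) :
  (forall w, f w = g w) -> holo f z -> holo g z.
Proof.
  intros H [phi [Hp E]]. exists phi. split; [exact Hp|].
  intros w. rewrite <- !H. apply E.
Qed.

Lemma holo_const (c : C) (z : C) : holo (fun _ => c) z.
Proof. exists (fun _ => 0). split; [apply contC_const|]. intros w. ring. Qed.

Lemma holo_id (z : C) : holo (fun w => w) z.
Proof. exists (fun _ => 1). split; [apply contC_const|]. intros w. ring. Qed.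

Lemma holo_plus (f g : C -> C) (z : C) :
  holo f z -> holo g z -> holo (fun w => f w + g w) z.
Proof.
  intros [p [Hp Ef]] [q [Hq Eg]]. exists (fun w => p w + q w).
  split; [now apply contC_plus|]. intros w. rewrite (Ef w), (Eg w). ring.
Qed.

Lemma holo_mult (f g : C -> C) (z : C) :
  holo f z -> holo g z -> holo (fun w => f w * g w) z.
Proof.
  intros Hf Hg. assert (Hgc := holo_cont g z Hg).
  destruct Hf as [p [Hp Ef]], Hg as [q [Hq Eg]].
  exists (fun w => p w * g w + f z * q w). split.
  - apply contC_plus; apply contC_mult; auto; apply contC_const.
  - intros w. rewrite (Ef w). rewrite (Eg w) at 1 2. ring.
Qed.

Lemma holo_comp (f g : C -> C) (z : C) :
  holo g z -> holo f (g z) -> holo (fun w => f (g w)) z.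
Proof.
  intros Hg [p [Hp Ef]]. assert (Hgc := holo_cont g z Hg).
  destruct Hg as [q [Hq Eg]].
  exists (fun w => p (g w) * q w). split.
  - apply contC_mult; [|exact Hq].
    apply (continuous_comp (U := C_UniformSpace) (V := C_UniformSpace) (W := C_UniformSpace) g p);
      assumption.
  - intros w. rewrite (Ef (g w)). rewrite (Eg w) at 2. ring.
Qed.

Lemma holo_opp (f : C -> C) (z : C) : holo f z -> holo (fun w => - f w) z.
Proof.
  intros H. apply holo_ext with (fun w => - (1) * f w); [intros w; ring|].
  apply holo_mult; [apply holo_const|exact H].
Qed.

Lemma holo_minus (f g : C -> C) (z : C) :
  holo f z -> holo g z -> holo (fun w => f w - g w) z.
Proof. intros Hf Hg. apply holo_plus; [exact Hf|now apply holo_opp]. Qed.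

Lemma holo_pow (f : C -> C) (n : nat) (z : C) :
  holo f z -> holo (fun w => Cpow (f w) n) z.
Proof.
  intros H. induction n as [|n IH].
  - apply (holo_const 1).
  - apply holo_ext with (fun w => f w * Cpow (f w) n); [reflexivity|].
    now apply holo_mult.
Qed.

Lemma holo_shift (f : C -> C) (c z : C) : holo f (z + c) -> holo (fun w => f (w + c)) z.
Proof.
  intros H. apply (holo_comp f (fun w => w + c)); [|exact H].
  apply holo_plus; [apply holo_id|apply holo_const].
Qed.

(** [holo] demands a slope function for which the identity holds at every [w], so local agreement
    needs an argument: the difference quotient of [g] satisfies the identity everywhere, and near
    [z] it coincides with the slope of [f]. *)
Lemma holo_local (f g : C -> C) (z : C) (r : R) :
  (0 < r)%R -> (forall w, (Cmod (w - z) < r)%R -> f w = g w) -> holo f z -> holo g z.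
Proof.
  intros Hr H [p [Hp Ef]].
  exists (fun w => if excluded_middle_informative (w = z) then p z else (g w - g z) / (w - z)).
  split.
  - apply contC_iff. intros eps He.
    destruct (proj1 (contC_iff _ _) Hp eps He) as [d [Hd Hd']].
    exists (Rmin d r). split; [now apply Rmin_pos|]. intros w Hw.
    assert (H1 := Rlt_le_trans _ _ _ Hw (Rmin_l _ _)).
    assert (H2 := Rlt_le_trans _ _ _ Hw (Rmin_r _ _)).
    destruct (excluded_middle_informative (z = z)) as [_|n]; [|now elim n].
    destruct (excluded_middle_informative (w = z)) as [->|Hwz].
    + replace (p z - p z) with (RtoC 0) by ring. rewrite Cmod_0. exact He.
    + assert (Hne : w - z <> 0) by (intros E0; apply Hwz; rewrite <- (Cplus_0_r z), <- E0; ring).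
      rewrite <- (H w H2), <- (H z).
      2:{ replace (z - z) with (RtoC 0) by ring. now rewrite Cmod_0. }
      rewrite (Ef w).
      replace ((f z + p w * (w - z) - f z) / (w - z)) with (p w) by (field; exact Hne).
      now apply Hd'.
  - intros w. destruct (excluded_middle_informative (w = z)) as [->|Hwz]; [ring|].
    assert (Hne : w - z <> 0) by (intros E0; apply Hwz; rewrite <- (Cplus_0_r z), <- E0; ring).
    field. exact Hne.
Qed.

Lemma holo_inv (f : C -> C) (z : C) : holo f z -> f z <> 0 -> holo (fun w => / f w) z.
Proof.
  intros Hf Hz. assert (Hc := holo_cont f z Hf).
  assert (H0 : (0 < Cmod (f z))%R) by now apply Cmod_gt_0.
  destruct (proj1 (contC_iff _ _) Hc _ H0) as [d [Hd Hd']].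
  assert (Hnz : forall w, (Cmod (w - z) < d)%R -> f w <> 0).
  { intros w Hw E. specialize (Hd' w Hw). rewrite E in Hd'.
    replace (0 - f z) with (- f z) in Hd' by ring. rewrite Cmod_opp in Hd'. lra. }
  destruct Hf as [p [Hp Ef]].
  (* Inversion is total, and the slope identity for [/ f] fails at the zeros of [f]; it is used on a
     disc free of zeros and transported from there. *)
  apply (holo_local (fun w => / f z + (- p w / (f z) * / f w) * (w - z)) _ z d Hd).
  - intros w Hw. assert (Hn := Hnz w Hw).
    assert (E' : p w * (w - z) = f w - f z) by (rewrite (Ef w); ring).
    replace (/ f z + - p w / f z * / f w * (w - z))
      with (/ f z - (p w * (w - z)) * (/ f z * / f w)) by (field; auto).
    rewrite E'. field. auto.
  - exists (fun w => - p w / f z * / f w). split.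
    + apply contC_mult.
      * apply contC_mult; [|apply contC_const].
        apply (continuous_ext (T := C_UniformSpace) (U := C_UniformSpace)
          (fun w => - (1) * p w)); [intros w; change (- (1) * p w = - p w); ring|].
        apply contC_mult; [apply contC_const|exact Hp].
      * apply (continuous_comp (U := C_UniformSpace) (V := C_UniformSpace)
          (W := C_UniformSpace) f Cinv); [exact Hc|now apply contC_inv].
    + intros w. ring.
Qed.

Lemma holo_iff (f : C -> C) (z : C) :
  holo f z <->
  exists l : C, forall eps : R, (0 < eps)%R ->
    exists d : R, (0 < d)%R /\ forall w : C, (Cmod (w - z) < d)%R ->
      (Cmod (f w - f z - l * (w - z)) <= eps * Cmod (w - z))%R.
Proof.
  split.
  - intros [p [Hp E]]. exists (p z). intros eps He.
    destruct (proj1 (contC_iff _ _) Hp eps He) as [d [Hd Hd']].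
    exists d. split; [exact Hd|]. intros w Hw. rewrite (E w).
    replace (f z + p w * (w - z) - f z - p z * (w - z)) with ((p w - p z) * (w - z)) by ring.
    rewrite Cmod_mult. apply Rmult_le_compat_r; [apply Cmod_ge_0|].
    apply Rlt_le. now apply Hd'.
  - intros [l H].
    exists (fun w => if excluded_middle_informative (w = z) then l else (f w - f z) / (w - z)).
    split.
    + apply contC_iff. intros eps He.
      destruct (H (eps / 2)%R ltac:(lra)) as [d [Hd Hd']].
      exists d. split; [exact Hd|]. intros w Hw.
      destruct (excluded_middle_informative (z = z)) as [_|n]; [|now elim n].
      destruct (excluded_middle_informative (w = z)) as [->|Hwz].
      * replace (l - l) with (RtoC 0) by ring. now rewrite Cmod_0.
      * assert (Hne : w - z <> 0) by (intros E0; apply Hwz; rewrite <- (Cplus_0_r z), <- E0; ring).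
        replace ((f w - f z) / (w - z) - l) with ((f w - f z - l * (w - z)) / (w - z))
          by (field; exact Hne).
        rewrite Cmod_div by exact Hne.
        apply Cmod_gt_0 in Hne.
        apply Rle_lt_trans with (eps / 2)%R; [|lra].
        apply Rmult_le_reg_r with (Cmod (w - z)); [exact Hne|].
        unfold Rdiv at 1. rewrite Rmult_assoc, Rinv_l, Rmult_1_r by lra. now apply Hd'.
    + intros w. destruct (excluded_middle_informative (w = z)) as [->|Hwz]; [ring|].
      assert (Hne : w - z <> 0) by (intros E0; apply Hwz; rewrite <- (Cplus_0_r z), <- E0; ring).
      field. exact Hne.
Qed.

Lemma ex_derive_holo (f : C -> C) (z : C) :
  ex_derive (K := C_AbsRing) (V := C_NormedModule) f z -> holo f z.
Proof.
  intros [l [_ H]]. apply holo_iff. exists l. intros eps He.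
  specialize (H z (fun P HP => HP) (mkposreal eps He)).
  destruct H as [d H]. exists d. split; [apply cond_pos|].
  intros w Hw. specialize (H w Hw).
  replace (f w - f z - l * (w - z)) with (f w - f z - (w - z) * l) by ring.
  exact H.
Qed.

Lemma holo_Cexp (z : C) : holo Cexp z.
Proof.
  apply holo_iff. exists (Cexp z). intros eps He.
  assert (Hm : (0 < Cmod (Cexp z))%R) by (apply Cmod_gt_0, Cexp_neq_0).
  exists (Rmin (1/2) (eps / (4 * Cmod (Cexp z))))%R.
  split; [apply Rmin_pos; [lra|apply Rdiv_lt_0_compat; lra]|].
  intros w Hw.
  assert (H1 := Rlt_le_trans _ _ _ Hw (Rmin_l _ _)).
  assert (H2 := Rlt_le_trans _ _ _ Hw (Rmin_r _ _)).
  replace (Cexp w) with (Cexp z * Cexp (w - z)) by (rewrite <- Cexp_plus; f_equal; ring).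
  replace (Cexp z * Cexp (w - z) - Cexp z - Cexp z * (w - z))
    with (Cexp z * (Cexp (w - z) - 1 - (w - z))) by ring.
  rewrite Cmod_mult.
  assert (H3 := Cexp_taylor1 (w - z) ltac:(lra)).
  assert (H4 : (0 <= Cmod (w - z))%R) by apply Cmod_ge_0.
  assert (H5 : (4 * Cmod (Cexp z) * Cmod (w - z) <= eps)%R).
  { apply Rlt_le in H2.
    apply Rmult_le_compat_l with (r := (4 * Cmod (Cexp z))%R) in H2; [|lra].
    replace (4 * Cmod (Cexp z) * (eps / (4 * Cmod (Cexp z))))%R with eps in H2
      by (field; lra). exact H2. }
  nra.
Qed.

(** * Goursat's theorem *)

Definition CRInt (f : R -> C) (a b : R) : C :=
  RInt (V := C_R_CompleteNormedModule) f a b.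

Notation contRC f x := (continuous (T := R_UniformSpace) (U := C_UniformSpace) f x).

Lemma CRInt_correct (f : R -> C) (a b : R) :
  (a <= b)%R -> (forall x, (a <= x <= b)%R -> contRC f x) ->
  is_RInt (V := C_R_CompleteNormedModule) f a b (CRInt f a b).
Proof.
  intros Hab H. apply (RInt_correct (V := C_R_CompleteNormedModule)).
  apply (ex_RInt_continuous (V := C_R_CompleteNormedModule)).
  intros x Hx. rewrite Rmin_left, Rmax_right in Hx by exact Hab. now apply H.
Qed.

Lemma CRInt_unique (f : R -> C) (a b : R) (l : C) :
  is_RInt (V := C_R_CompleteNormedModule) f a b l -> CRInt f a b = l.
Proof. apply (is_RInt_unique (V := C_R_CompleteNormedModule)). Qed.

Lemma CRInt_plus (f g : R -> C) (a b : R) :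
  (a <= b)%R -> (forall x, (a <= x <= b)%R -> contRC f x) ->
  (forall x, (a <= x <= b)%R -> contRC g x) ->
  CRInt (fun x => f x + g x) a b = CRInt f a b + CRInt g a b.
Proof.
  intros Hab Hf Hg. apply CRInt_unique.
  apply (is_RInt_plus (V := C_R_CompleteNormedModule)); now apply CRInt_correct.
Qed.

Lemma CRInt_ext (f g : R -> C) (a b : R) :
  (a <= b)%R -> (forall x, (a <= x <= b)%R -> f x = g x) -> CRInt f a b = CRInt g a b.
Proof.
  intros Hab H. apply (RInt_ext (V := C_R_CompleteNormedModule)).
  intros x Hx. rewrite Rmin_left, Rmax_right in Hx by exact Hab. apply H. lra.
Qed.

Lemma CRInt_Chasles (f : R -> C) (a m b : R) :
  (a <= m <= b)%R -> (forall x, (a <= x <= b)%R -> contRC f x) ->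
  CRInt f a b = CRInt f a m + CRInt f m b.
Proof.
  intros Hm Hf. apply CRInt_unique.
  apply (is_RInt_Chasles (V := C_R_CompleteNormedModule)) with m;
    apply CRInt_correct; try lra; intros x Hx; apply Hf; lra.
Qed.

Lemma CRInt_const (l : C) (a b : R) : CRInt (fun _ => l) a b = RtoC (b - a) * l.
Proof.
  apply CRInt_unique.
  replace (RtoC (b - a) * l) with (scal (V := C_R_ModuleSpace) (b - a)%R l).
  - apply (is_RInt_const (V := C_R_CompleteNormedModule)).
  - destruct l. unfold scal; simpl. unfold prod_scal, scal; simpl. unfold mult; simpl.
    apply injective_projections; simpl; ring.
Qed.

Lemma norm_C_R (z : C) : norm (V := C_R_NormedModule) z = Cmod z.
Proof.
  unfold norm; simpl. unfold prod_norm, norm, Cmod; simpl. unfold abs; simpl.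
  f_equal. rewrite !Rmult_1_r.
  destruct z as [x y]; simpl. rewrite <- !Rabs_mult.
  rewrite !Rabs_pos_eq; try apply Rle_0_sqr. reflexivity.
Qed.

Lemma CRInt_bound (f : R -> C) (a b M : R) :
  (a <= b)%R -> (forall x, (a <= x <= b)%R -> contRC f x) ->
  (forall x, (a <= x <= b)%R -> (Cmod (f x) <= M)%R) ->
  (Cmod (CRInt f a b) <= (b - a) * M)%R.
Proof.
  intros Hab Hf HM.
  rewrite <- norm_C_R.
  apply (norm_RInt_le_const (V := C_R_NormedModule) f a b); auto.
  - intros x Hx. rewrite norm_C_R. auto.
  - apply (CRInt_correct f a b Hab Hf).
Qed.

Lemma CRInt_bound_sub_const (f : R -> C) (l : C) (a b M : R) :
  (a <= b)%R -> (forall x, (a <= x <= b)%R -> contRC f x) ->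
  (forall x, (a <= x <= b)%R -> (Cmod (f x - l) <= M)%R) ->
  (Cmod (CRInt f a b - RtoC (b - a) * l) <= (b - a) * M)%R.
Proof.
  intros Hab Hf HM.
  replace (CRInt f a b - RtoC (b - a) * l) with (CRInt (fun x => f x + - l) a b).
  - apply CRInt_bound; auto. intros x Hx. apply contC_plus; [auto|apply contC_const].
  - rewrite CRInt_plus; auto; [|intros; apply contC_const].
    rewrite CRInt_const. ring.
Qed.

(* The integral of [f] over the boundary of [[a,b] x [c,d]], counterclockwise. *)
Definition rect_int (f : C -> C) (a b c d : R) : C :=
  CRInt (fun x => f (x, c) - f (x, d)) a b
  + Ci * CRInt (fun y => f (b, y) - f (a, y)) c d.

Lemma contRC_horizontal (f : C -> C) (x y : R) :
  contC f (x, y) -> contRC (fun t => f (t, y)) x.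
Proof.
  intros H. apply (contC_RtoC_comp (fun t => (t, y)) f x); [|exact H].
  apply continuous_pairC; [apply continuous_id|apply continuous_const].
Qed.

Lemma contRC_vertical (f : C -> C) (x y : R) :
  contC f (x, y) -> contRC (fun t => f (x, t)) y.
Proof.
  intros H. apply (contC_RtoC_comp (fun t => (x, t)) f y); [|exact H].
  apply continuous_pairC; [apply continuous_const|apply continuous_id].
Qed.

Lemma contRC_minus (f g : R -> C) (x : R) :
  contRC f x -> contRC g x -> contRC (fun t => f t - g t) x.
Proof.
  intros Hf Hg.
  apply (continuous_ext (T := R_UniformSpace) (U := C_UniformSpace)
    (fun t => f t + (- (1)) * g t)).
  - intros t. change (f t + - (1) * g t = f t - g t). ring.
  - apply contC_plus; [exact Hf|]. apply contC_mult; [apply contC_const|exact Hg].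
Qed.

Lemma rect_int_split_x (f : C -> C) (a m b c d : R) :
  (a <= m <= b)%R -> (c <= d)%R ->
  (forall x y, (a <= x <= b)%R -> (c <= y <= d)%R -> contC f (x, y)) ->
  rect_int f a b c d = rect_int f a m c d + rect_int f m b c d.
Proof.
  intros Hm Hcd Hf. unfold rect_int.
  rewrite (CRInt_Chasles _ a m b Hm).
  2:{ intros x Hx. apply contRC_minus; apply contRC_horizontal, Hf; lra. }
  rewrite (CRInt_ext (fun y => f (b, y) - f (a, y))
    (fun y => (f (m, y) - f (a, y)) + (f (b, y) - f (m, y))) c d Hcd)
    by (intros; ring).
  rewrite CRInt_plus; [ring|exact Hcd| |];
    intros y Hy; apply contRC_minus; apply contRC_vertical, Hf; lra.
Qed.

Lemma rect_int_split_y (f : C -> C) (a b c m d : R) :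
  (a <= b)%R -> (c <= m <= d)%R ->
  (forall x y, (a <= x <= b)%R -> (c <= y <= d)%R -> contC f (x, y)) ->
  rect_int f a b c d = rect_int f a b c m + rect_int f a b m d.
Proof.
  intros Hab Hm Hf. unfold rect_int.
  rewrite (CRInt_Chasles _ c m d Hm).
  2:{ intros y Hy. apply contRC_minus; apply contRC_vertical, Hf; lra. }
  rewrite (CRInt_ext (fun x => f (x, c) - f (x, d))
    (fun x => (f (x, c) - f (x, m)) + (f (x, m) - f (x, d))) a b Hab)
    by (intros; ring).
  rewrite CRInt_plus; [ring|exact Hab| |];
    intros x Hx; apply contRC_minus; apply contRC_horizontal, Hf; lra.
Qed.

(** An affine function has integral 0 around a rectangle: the constants subtracted from the two
    integrands contribute [(b-a) l i (c-d)] and [i (d-c) l (b-a)], which cancel. What remains is the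
    error of the tangent approximation, at most [2 eps] times the half-perimeter, over a length
    equal to the half-perimeter. *)
Lemma rect_int_local (f : C -> C) (z l : C) (a b c d eps : R) :
  (0 <= eps)%R -> (a <= b)%R -> (c <= d)%R ->
  (a <= Re z <= b)%R -> (c <= Im z <= d)%R ->
  (forall x y, (a <= x <= b)%R -> (c <= y <= d)%R -> contC f (x, y)) ->
  (forall x y, (a <= x <= b)%R -> (c <= y <= d)%R ->
     (Cmod (f (x, y) - f z - l * ((x, y) - z)) <= eps * Cmod ((x, y) - z))%R) ->
  (Cmod (rect_int f a b c d) <= 2 * eps * ((b - a) + (d - c)) ^ 2)%R.
Proof.
  intros He Hab Hcd Hzx Hzy Hc Hf.
  assert (Hd : forall x y, (a <= x <= b)%R -> (c <= y <= d)%R ->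
     (Cmod (f (x, y) - f z - l * ((x, y) - z)) <= eps * ((b - a) + (d - c)))%R).
  { intros x y Hx Hy. eapply Rle_trans; [now apply Hf|].
    apply Rmult_le_compat_l; [exact He|].
    eapply Rle_trans; [apply Cmod_le_re_im|].
    destruct z as [zx zy]; unfold Re, Im in *; simpl in *.
    apply Rplus_le_compat; apply Rabs_le; lra. }
  assert (H2 : forall x1 y1 x2 y2, (a <= x1 <= b)%R -> (c <= y1 <= d)%R ->
     (a <= x2 <= b)%R -> (c <= y2 <= d)%R ->
     (Cmod (f (x1, y1) - f (x2, y2) - l * ((x1, y1) - (x2, y2)))
       <= 2 * (eps * ((b - a) + (d - c))))%R).
  { intros x1 y1 x2 y2 A1 A2 A3 A4.
    replace (f (x1, y1) - f (x2, y2) - l * ((x1, y1) - (x2, y2))) with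
      ((f (x1, y1) - f z - l * ((x1, y1) - z)) - (f (x2, y2) - f z - l * ((x2, y2) - z))) by ring.
    eapply Rle_trans; [apply Cmod_triangle|]. rewrite Cmod_opp.
    assert (B1 := Hd x1 y1 A1 A2). assert (B2 := Hd x2 y2 A3 A4). lra. }
  set (E := (2 * (eps * ((b - a) + (d - c))))%R) in *.
  assert (I1 := CRInt_bound_sub_const (fun x => f (x, c) - f (x, d)) (l * (Ci * RtoC (c - d))) a b E Hab).
  assert (I2 := CRInt_bound_sub_const (fun y => f (b, y) - f (a, y)) (l * RtoC (b - a)) c d E Hcd).
  unfold rect_int.
  match goal with |- (Cmod (?X + Ci * ?Y) <= _)%R =>
    replace (X + Ci * Y) with
     ((X - RtoC (b - a) * (l * (Ci * RtoC (c - d)))) + Ci * (Y - RtoC (d - c) * (l * RtoC (b - a))))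
     by (rewrite !RtoC_minus; ring) end.
  eapply Rle_trans; [apply Cmod_triangle|]. rewrite Cmod_mult, Cmod_Ci, Rmult_1_l.
  replace (2 * eps * (b - a + (d - c)) ^ 2)%R with ((b - a) * E + (d - c) * E)%R
    by (unfold E; ring).
  apply Rplus_le_compat.
  - apply I1.
    + intros x Hx. apply contRC_minus; apply contRC_horizontal, Hc; lra.
    + intros x Hx.
      replace (Ci * RtoC (c - d)) with ((x, c) - (x, d))
        by (apply injective_projections; simpl; ring).
      apply H2; lra.
  - apply I2.
    + intros y Hy. apply contRC_minus; apply contRC_vertical, Hc; lra.
    + intros y Hy.
      replace (RtoC (b - a)) with ((b, y) - (a, y))
        by (apply injective_projections; simpl; ring).
      apply H2; lra.
Qed.

(* Nested bisection: a property of rectangles which passes from the four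
   quarters to the whole and holds for all small rectangles around each point. *)
Lemma rect_bisection (P : R -> R -> R -> R -> Prop) (a0 b0 c0 d0 : R) :
  (a0 <= b0)%R -> (c0 <= d0)%R ->
  (forall a b c d, (a0 <= a <= b)%R -> (b <= b0)%R -> (c0 <= c <= d)%R -> (d <= d0)%R ->
     let m := ((a + b) / 2)%R in let n := ((c + d) / 2)%R in
     P a m c n -> P m b c n -> P a m n d -> P m b n d -> P a b c d) ->
  (forall x y, (a0 <= x <= b0)%R -> (c0 <= y <= d0)%R ->
     exists r, (0 < r)%R /\
       forall a b c d, (a0 <= a <= x)%R -> (x <= b <= b0)%R ->
         (c0 <= c <= y)%R -> (y <= d <= d0)%R ->
         (b - a < r)%R -> (d - c < r)%R -> P a b c d) ->
  P a0 b0 c0 d0.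
Proof.
  intros Hab Hcd Hsplit Hloc. apply NNPP. intros HN.
  pose (Q := (R * R * R * R)%type).
  pose (bad := fun q : Q => let '(a, b, c, d) := q in
     (a0 <= a <= b)%R /\ (b <= b0)%R /\ (c0 <= c <= d)%R /\ (d <= d0)%R /\ ~ P a b c d).
  pose (sub := fun q q' : Q => let '(a, b, c, d) := q in let '(a', b', c', d') := q' in
     ((a <= a')%R /\ (b' <= b)%R /\ (c <= c')%R /\ (d' <= d)%R /\
      (b' - a' = (b - a) / 2)%R /\ (d' - c' = (d - c) / 2)%R)).
  assert (Hnext : forall q : {q | bad q}, exists q' : {q | bad q}, sub (proj1_sig q) (proj1_sig q')).
  { intros [[[[a b] c] d] Hq]. simpl in Hq. destruct Hq as (H1 & H2 & H3 & H4 & H5).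
    destruct (classic (exists q' : Q, bad q' /\ sub (a, b, c, d) q')) as [[q' [B S]]|Hno].
    - exists (exist _ q' B). exact S.
    - exfalso. apply H5. apply Hsplit; auto; apply NNPP; intros HP; apply Hno;
        [exists (a, (a + b) / 2, c, (c + d) / 2)%R
        |exists ((a + b) / 2, b, c, (c + d) / 2)%R
        |exists (a, (a + b) / 2, (c + d) / 2, d)%R
        |exists ((a + b) / 2, b, (c + d) / 2, d)%R];
        simpl; repeat split; try lra; exact HP. }
  pose (next := fun q => proj1_sig (constructive_indefinite_description _ (Hnext q))).
  assert (Hn : forall q, sub (proj1_sig q) (proj1_sig (next q)))
    by (intros q; unfold next; destruct constructive_indefinite_description; assumption).
  assert (B0 : bad (a0, b0, c0, d0)) by (simpl; repeat split; try lra; exact HN).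
  pose (s := fun n => Nat.iter n next (exist _ _ B0)).
  pose (A := fun n => fst (fst (fst (proj1_sig (s n))))).
  pose (B := fun n => snd (fst (fst (proj1_sig (s n))))).
  pose (Cc := fun n => snd (fst (proj1_sig (s n)))).
  pose (D := fun n => snd (proj1_sig (s n))).
  assert (Hb : forall n, (a0 <= A n <= B n)%R /\ (B n <= b0)%R /\ (c0 <= Cc n <= D n)%R /\
     (D n <= d0)%R /\ ~ P (A n) (B n) (Cc n) (D n)).
  { intros n. unfold A, B, Cc, D. destruct (s n) as [[[[a b] c] d] Hq]. exact Hq. }
  assert (Hs : forall n, (A n <= A (S n))%R /\ (B (S n) <= B n)%R /\ (Cc n <= Cc (S n))%R /\
     (D (S n) <= D n)%R /\ (B (S n) - A (S n) = (B n - A n) / 2)%R /\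
     (D (S n) - Cc (S n) = (D n - Cc n) / 2)%R).
  { intros n. assert (H := Hn (s n)). unfold A, B, Cc, D.
    change (s (S n)) with (next (s n)).
    destruct (s n) as [[[[a b] c] d] Hq]. destruct (next _) as [[[[a' b'] c'] d'] Hq'].
    exact H. }
  assert (Hw : forall n, (B n - A n = (b0 - a0) / 2 ^ n)%R /\ (D n - Cc n = (d0 - c0) / 2 ^ n)%R).
  { induction n as [|n [I1 I2]].
    - unfold A, B, Cc, D, s; simpl. lra.
    - destruct (Hs n) as (_ & _ & _ & _ & E1 & E2). rewrite E1, E2, I1, I2. simpl.
      assert (2 ^ n <> 0)%R by (apply pow_nonzero; lra). split; field; assumption. }
  assert (gA : Un_growing A) by (intros n; apply Hs).
  assert (gC : Un_growing Cc) by (intros n; apply Hs).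
  assert (dB : Un_decreasing B) by (intros n; apply Hs).
  assert (dD : Un_decreasing D) by (intros n; apply Hs).
  assert (AB : forall n m, (A n <= B m)%R).
  { intros n m. apply Rle_trans with (A (max n m)).
    - apply Rge_le, growing_prop; [exact gA|lia].
    - apply Rle_trans with (B (max n m)); [apply Hb|].
      apply decreasing_prop; [exact dB|lia]. }
  assert (CD : forall n m, (Cc n <= D m)%R).
  { intros n m. apply Rle_trans with (Cc (max n m)).
    - apply Rge_le, growing_prop; [exact gC|lia].
    - apply Rle_trans with (D (max n m)); [apply Hb|].
      apply decreasing_prop; [exact dD|lia]. }
  destruct (growing_cv A gA) as [x Hx]; [exists b0; intros y [n ->]; apply (AB n 0%nat)|].
  destruct (growing_cv Cc gC) as [y Hy]; [exists d0; intros z [n ->]; apply (CD n 0%nat)|].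
  assert (Ax : forall n, (A n <= x)%R) by (intros n; apply growing_ineq; assumption).
  assert (Cy : forall n, (Cc n <= y)%R) by (intros n; apply growing_ineq; assumption).
  assert (xB : forall n, (x <= B n)%R).
  { intros n. apply Rnot_lt_le. intros Hlt. destruct (Hx (x - B n)%R ltac:(lra)) as [N HN'].
    specialize (HN' N (Nat.le_refl _)). assert (H := AB N n). assert (H' := Ax N).
    unfold Rdist in HN'. rewrite Rabs_left1 in HN'; lra. }
  assert (yD : forall n, (y <= D n)%R).
  { intros n. apply Rnot_lt_le. intros Hlt. destruct (Hy (y - D n)%R ltac:(lra)) as [N HN'].
    specialize (HN' N (Nat.le_refl _)). assert (H := CD N n). assert (H' := Cy N).
    unfold Rdist in HN'. rewrite Rabs_left1 in HN'; lra. }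
  destruct (Hloc x y) as [r [Hr HP]].
  { assert (H1 := Hb 0%nat). assert (H2 := Ax 0%nat). assert (H3 := xB 0%nat). lra. }
  { assert (H1 := Hb 0%nat). assert (H2 := Cy 0%nat). assert (H3 := yD 0%nat). lra. }
  assert (Hsm : forall w, (0 <= w)%R -> exists N, forall n, (N <= n)%nat -> (w / 2 ^ n < r)%R).
  { intros w Hw0.
    destruct (Pow_x_infinity 2 ltac:(rewrite Rabs_pos_eq; lra) (w / r + 1)%R) as [N HN'].
    exists N. intros n Hn'. specialize (HN' n Hn').
    assert (H2 : (0 < 2 ^ n)%R) by (apply pow_lt; lra).
    rewrite Rabs_pos_eq in HN' by lra.
    apply Rmult_lt_reg_r with (2 ^ n)%R; [exact H2|].
    unfold Rdiv. rewrite Rmult_assoc, Rinv_l, Rmult_1_r by lra.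
    assert (Hwr : (w / r < 2 ^ n)%R) by lra.
    apply Rmult_lt_compat_r with (r := r) in Hwr; [|exact Hr].
    unfold Rdiv in Hwr. rewrite Rmult_assoc, Rinv_l, Rmult_1_r in Hwr by lra. lra. }
  destruct (Hsm (b0 - a0)%R ltac:(lra)) as [N1 H1].
  destruct (Hsm (d0 - c0)%R ltac:(lra)) as [N2 H2].
  set (n := max N1 N2). destruct (Hb n) as (K1 & K2 & K3 & K4 & K5). apply K5.
  destruct (Hw n) as [W1 W2]. assert (X1 := Ax n). assert (X2 := xB n).
  assert (X3 := Cy n). assert (X4 := yD n).
  apply HP; try lra.
  - rewrite W1. apply H1. unfold n; lia.
  - rewrite W2. apply H2. unfold n; lia.
Qed.

(** The bound [eps] times the squared half-perimeter is stable under bisection, since each quarter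
    contributes a quarter of it, and it holds for small rectangles by the tangent estimate. As [eps]
    is arbitrary, the integral is 0. *)
Theorem goursat (f : C -> C) (a b c d : R) :
  (a <= b)%R -> (c <= d)%R ->
  (forall x y, (a <= x <= b)%R -> (c <= y <= d)%R -> holo f (x, y)) ->
  rect_int f a b c d = 0.
Proof.
  intros Hab Hcd Hf.
  assert (Hc : forall x y, (a <= x <= b)%R -> (c <= y <= d)%R -> contC f (x, y))
    by (intros; apply holo_cont; auto).
  apply Cmod_eq_0. apply Rle_antisym; [|apply Cmod_ge_0].
  assert (H : forall eps, (0 < eps)%R ->
    (Cmod (rect_int f a b c d) <= eps * ((b - a) + (d - c)) ^ 2)%R).
  { intros eps He.
    apply (rect_bisection (fun a b c d =>
      (Cmod (rect_int f a b c d) <= eps * ((b - a) + (d - c)) ^ 2)%R) a b c d Hab Hcd).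
    - intros a' b' c' d' H1 H2 H3 H4 m n P1 P2 P3 P4.
      rewrite (rect_int_split_x f a' m b' c' d');
        [|unfold m; lra|lra|intros; apply Hc; lra].
      rewrite (rect_int_split_y f a' m c' n d'), (rect_int_split_y f m b' c' n d');
        try (unfold m, n; lra);
        try (intros; apply Hc; unfold m, n in *; lra).
      eapply Rle_trans; [apply Cmod_triangle|].
      eapply Rle_trans; [apply Rplus_le_compat; apply Cmod_triangle|].
      unfold m, n in *. nra.
    - intros x y Hx Hy. destruct (proj1 (holo_iff f (x, y)) (Hf x y Hx Hy)) as [l Hl].
      destruct (Hl (eps / 2)%R ltac:(lra)) as [r [Hr Hr']].
      exists (r / 2)%R. split; [lra|].
      intros a' b' c' d' H1 H2 H3 H4 H5 H6.
      assert (Hloc := rect_int_local f (x, y) l a' b' c' d' (eps / 2)).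
      replace (eps * (b' - a' + (d' - c')) ^ 2)%R with
        (2 * (eps / 2) * (b' - a' + (d' - c')) ^ 2)%R by field.
      apply Hloc; unfold Re, Im; simpl; try lra.
      + intros; apply Hc; lra.
      + intros x' y' Hx' Hy'. apply Hr'.
        eapply Rle_lt_trans; [apply Cmod_le_re_im|]. unfold Re, Im; simpl.
        assert (Rabs (x' + - x) <= b' - a')%R by (apply Rabs_le; lra).
        assert (Rabs (y' + - y) <= d' - c')%R by (apply Rabs_le; lra). lra. }
  apply Rnot_lt_le. intros Hlt.
  set (I := Cmod (rect_int f a b c d)) in *.
  set (S := (((b - a) + (d - c)) ^ 2)%R) in *.
  assert (HS : (0 <= S)%R) by apply pow2_ge_0.
  specialize (H (I / (2 * (S + 1)))%R ltac:(apply Rdiv_lt_0_compat; lra)).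
  assert (E : (I / (2 * (S + 1)) * (S + 1) = I / 2)%R) by (field; lra).
  assert (0 < I / (2 * (S + 1)))%R by (apply Rdiv_lt_0_compat; lra).
  nra.
Qed.

(** * The maximum principle *)

Lemma Cexp_2PI (x : R) : Cexp (x, (2 * PI)%R) = Cexp (x, 0%R).
Proof. unfold Cexp, Re, Im; simpl. now rewrite cos_2PI, sin_2PI, cos_0, sin_0. Qed.

Lemma Cmod_Cexp_pair (x y : R) : Cmod (Cexp (x, y)) = exp x.
Proof. apply Cmod_Cexp. Qed.

(* The average of [f] over circles is radius-independent: Goursat's theorem for
   [f (z + exp w)] on a rectangle of height [2 PI] in the [w]-plane. *)
Lemma mean_value (f : C -> C) (z : C) (x : R) :
  (forall w, (Cmod (w - z) <= exp x)%R -> holo f w) ->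
  CRInt (fun t => f (z + Cexp (x, t))) 0 (2 * PI) = RtoC (2 * PI) * f z.
Proof.
  intros Hf. assert (Hpi := PI_RGT_0).
  assert (Hh : forall a b, (a <= x)%R -> holo (fun w => f (z + Cexp w)) (a, b)).
  { intros a b Ha. apply (holo_comp f (fun w => z + Cexp w)).
    - apply holo_plus; [apply holo_const|apply holo_Cexp].
    - apply Hf. replace (z + Cexp (a, b) - z) with (Cexp (a, b)) by ring.
      rewrite Cmod_Cexp_pair. now apply exp_le_mono. }
  assert (Hc : forall a b, (a <= x)%R -> contRC (fun t => f (z + Cexp (a, t))) b).
  { intros a b Ha. apply (contRC_vertical (fun w => f (z + Cexp w))).
    now apply holo_cont, Hh. }
  assert (Hconst : forall a, (a <= x)%R ->
    CRInt (fun t => f (z + Cexp (x, t))) 0 (2 * PI) = CRInt (fun t => f (z + Cexp (a, t))) 0 (2 * PI)).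
  { intros a Ha.
    assert (G := goursat (fun w => f (z + Cexp w)) a x 0 (2 * PI) Ha ltac:(lra)
      ltac:(intros; apply Hh; lra)).
    unfold rect_int in G.
    (* The two horizontal sides cancel because [Cexp] has period [2 PI i]; the vertical sides are
       the circle averages for the radii [exp x] and [exp a]. *)
    rewrite (CRInt_ext _ (fun _ => RtoC 0) a x Ha) in G.
    2:{ intros t _. rewrite Cexp_2PI. ring. }
    rewrite CRInt_const in G.
    assert (G' : CRInt (fun y => f (z + Cexp (x, y)) - f (z + Cexp (a, y))) 0 (2 * PI) = 0).
    { replace (RtoC 0) with (- Ci * (RtoC (x - a) * 0 + Ci * CRInt (fun y => f (z + Cexp (x, y)) - f (z + Cexp (a, y))) 0 (2 * PI))).
      - replace (- Ci * (RtoC (x - a) * 0 + Ci * CRInt (fun y => f (z + Cexp (x, y)) - f (z + Cexp (a, y))) 0 (2 * PI)))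
         with (- (Ci * Ci) * CRInt (fun y => f (z + Cexp (x, y)) - f (z + Cexp (a, y))) 0 (2 * PI)) by ring.
        replace (Ci * Ci) with (- (1)) by (apply injective_projections; simpl; ring). ring.
      - rewrite G. ring. }
    rewrite (CRInt_ext (fun t => f (z + Cexp (x, t)))
      (fun t => f (z + Cexp (a, t)) + (f (z + Cexp (x, t)) - f (z + Cexp (a, t)))) 0 (2 * PI));
      [|lra|intros; ring].
    rewrite CRInt_plus; [rewrite G'; ring|lra| |];
      intros; [|apply contRC_minus]; apply Hc; lra. }
  assert (Hz : contC f z).
  { apply holo_cont, Hf. replace (z - z) with (RtoC 0) by ring.
    rewrite Cmod_0. left. apply exp_pos. }
  assert (Hlim : forall eps, (0 < eps)%R ->
    (Cmod (CRInt (fun t => f (z + Cexp (x, t))%C) 0 (2 * PI) - RtoC (2 * PI) * f z) <= 2 * PI * eps)%R).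
  { intros eps He. destruct (proj1 (contC_iff f z) Hz eps He) as [d [Hd Hd']].
    (* The radius [exp a] is at most [d / 2], so the whole circle lies where [f] is within [eps] of
       [f z]. *)
    set (a := Rmin x (ln (d / 2))).
    assert (Ha : (a <= x)%R) by apply Rmin_l.
    rewrite (Hconst a Ha).
    assert (Hb := CRInt_bound_sub_const (fun t => f (z + Cexp (a, t))) (f z) 0 (2 * PI) eps).
    rewrite !Rminus_0_r in Hb. apply Hb; [lra|intros; apply Hc; lra|].
    intros t _. left. apply Hd'. replace (z + Cexp (a, t) - z) with (Cexp (a, t)) by ring.
    rewrite Cmod_Cexp_pair. apply Rle_lt_trans with (exp (ln (d / 2))).
    - apply exp_le_mono, Rmin_r.
    - rewrite exp_ln; lra. }
  set (I := CRInt (fun t => f (z + Cexp (x, t))) 0 (2 * PI)) in *.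
  set (J := RtoC (2 * PI) * f z) in *.
  assert (E : I - J = 0).
  { apply Cmod_eq_0. apply Rle_antisym; [|apply Cmod_ge_0].
    apply Rnot_lt_le. intros H.
    specialize (Hlim (Cmod (I - J) / (4 * PI))%R ltac:(apply Rdiv_lt_0_compat; lra)).
    replace (2 * PI * (Cmod (I - J) / (4 * PI)))%R with (Cmod (I - J) / 2)%R in Hlim by (field; lra).
    lra. }
  replace I with (I - J + J) by ring. rewrite E. ring.
Qed.

(** If no maximum is attained, every point of [K] has a neighbourhood on which [v] stays below its
    value at some selected point of [K]. Finitely many such neighbourhoods cover [K], and the
    largest of the finitely many selected values would itself be exceeded. *)
Lemma compact_attains_max (K : C -> Prop) (v : C -> R) (B : R) (z0 : C) :
  K z0 -> (forall z, K z -> (Cmod z <= B)%R) ->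
  (forall z, ~ K z -> exists d, (0 < d)%R /\ forall w, (Cmod (w - z) < d)%R -> ~ K w) ->
  (forall z, K z -> continuous (T := C_UniformSpace) v z) ->
  exists z, K z /\ forall w, K w -> (v w <= v z)%R.
Proof.
  intros Hz0 HB Hcl Hv. apply NNPP. intros Hno.
  (* The radius is doubled because the covering lemma controls each coordinate separately, and the
     two coordinate bounds add up. *)
  assert (Hex : forall p : C, exists q : posreal * C,
     (K p -> K (snd q) /\ forall w, K w -> (Cmod (w - p) < 2 * fst q)%R -> (v w < v (snd q))%R) /\
     (~ K p -> forall w, (Cmod (w - p) < 2 * fst q)%R -> ~ K w)).
  { intros p. destruct (classic (K p)) as [Hp|Hp].
    - assert (H1 : exists w, K w /\ (v p < v w)%R).
      { apply NNPP. intros H. apply Hno. exists p. split; [exact Hp|]. intros w Hw.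
        apply Rnot_lt_le. intros Hlt. apply H. now exists w. }
      destruct H1 as [w [Hw Hlt]].
      assert (Hl := proj1 (filterlim_locally (F := locally (T := C_UniformSpace) p) v (v p)) (Hv p Hp)).
      specialize (Hl (mkposreal (v w - v p) ltac:(lra))).
      apply locally_C_iff in Hl. destruct Hl as [d [Hd Hd']].
      exists (mkposreal (d / 2) ltac:(lra), w). simpl. split; [|tauto].
      intros _. split; [exact Hw|]. intros w' _ Hw'.
      specialize (Hd' w' ltac:(lra)). unfold ball in Hd'; simpl in Hd'.
      unfold AbsRing_ball, abs, minus, plus, opp in Hd'; simpl in Hd'.
      apply Rabs_lt_between in Hd'. lra.
    - destruct (Hcl p Hp) as [d [Hd Hd']].
      exists (mkposreal (d / 2) ltac:(lra), p). simpl. split; [tauto|].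
      intros _ w Hw. apply Hd'. lra. }
  pose (sel := fun p => proj1_sig (constructive_indefinite_description _ (Hex p))).
  assert (Hsel : forall p, (K p -> K (snd (sel p)) /\ forall w, K w -> (Cmod (w - p) < 2 * fst (sel p))%R -> (v w < v (snd (sel p)))%R) /\
     (~ K p -> forall w, (Cmod (w - p) < 2 * fst (sel p))%R -> ~ K w)).
  { intros p. unfold sel. destruct constructive_indefinite_description; assumption. }
  apply (compactness_list 2 (Ropp B, (Ropp B, tt)) (B, (B, tt))
    (fun p => let '(x, (y, _)) := p in fst (sel (x, y)))).
  intros [l Hl].
  pose (pt := fun p : R * (R * unit) => ((fst p, fst (snd p)) : C)).
  assert (Hcov : forall z, K z -> exists t, In t l /\ K (pt t) /\ (v z < v (snd (sel (pt t))))%R).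
  { intros [x y] Hz. assert (HBz := HB _ Hz).
    assert (H1 := re_le_Cmod (x, y)). assert (H2 := im_le_Cmod (x, y)).
    unfold Re, Im in H1, H2; simpl in H1, H2.
    destruct (Hl (x, (y, tt))) as [[a [b []]] [Hin [_ [Ha [Hb _]]]]].
    { simpl. apply Rle_trans with (2 := HBz) in H1. apply Rle_trans with (2 := HBz) in H2.
      apply Rabs_le_between in H1. apply Rabs_le_between in H2. tauto. }
    assert (Hd : (Cmod ((x, y) - (a, b)) < 2 * fst (sel (a, b)))%R).
    { eapply Rle_lt_trans; [apply Cmod_le_re_im|]. unfold Re, Im; simpl.
      unfold Rminus in Ha, Hb. lra. }
    exists (a, (b, tt)). unfold pt; simpl. split; [exact Hin|].
    destruct (Hsel (a, b)) as [S1 S2].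
    destruct (classic (K (a, b))) as [Hk|Hk].
    - split; [exact Hk|]. apply (S1 Hk); assumption.
    - exfalso. exact (S2 Hk _ Hd Hz). }
  assert (Hmax : forall l', (exists t, In t l' /\ K (pt t)) ->
     exists t, In t l' /\ K (pt t) /\ forall s, In s l' -> K (pt s) -> (v (snd (sel (pt s))) <= v (snd (sel (pt t))))%R).
  { induction l' as [|p l' IH]; intros [t [Ht Kt]]; [destruct Ht|].
    destruct (classic (exists t, In t l' /\ K (pt t))) as [H|H].
    - destruct (IH H) as [s [Hs [Ks Hs']]].
      destruct (classic (K (pt p) /\ (v (snd (sel (pt s))) < v (snd (sel (pt p))))%R)) as [[H1 H2]|H1].
      + exists p. split; [now left|]. split; [exact H1|]. intros q [<-|Hq] Kq; [lra|].
        specialize (Hs' q Hq Kq). lra.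
      + exists s. split; [now right|]. split; [exact Ks|]. intros q [<-|Hq] Kq; [|auto].
        apply Rnot_lt_le. tauto.
    - destruct Ht as [<-|Ht]; [|exfalso; apply H; now exists t].
      exists p. split; [now left|]. split; [exact Kt|]. intros q [<-|Hq] Kq; [lra|].
      exfalso. apply H. now exists q. }
  destruct (Hmax l) as [t [Ht [Kt Hm]]].
  { destruct (Hcov z0 Hz0) as [t Ht]. exists t. tauto. }
  destruct (Hcov (snd (sel (pt t)))) as [s [Hs [Ks Hlt]]].
  { apply Hsel. exact Kt. }
  specialize (Hm s Hs Ks). lra.
Qed.

(** The mean of [|w|^2] over a circle is [|centre|^2 + r^2]; the gain [r^2] over the value at the
    centre is what makes the perturbed maximum principle strict. *)
Lemma RInt_circle_sq (a b r k eta : R) :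
  is_RInt (fun t => k - eta * ((a + r * cos t) ^ 2 + (b + r * sin t) ^ 2))%R 0 (2 * PI)
    (2 * PI * (k - eta * (a ^ 2 + b ^ 2 + r ^ 2)))%R.
Proof.
  pose (G := fun t => ((k - eta * (a ^ 2 + b ^ 2 + r ^ 2)) * t
     - 2 * eta * r * (a * sin t - b * cos t))%R).
  replace (2 * PI * (k - eta * (a ^ 2 + b ^ 2 + r ^ 2)))%R
    with (minus (G (2 * PI)%R) (G 0%R)).
  2:{ unfold G, minus, plus, opp; simpl. rewrite sin_2PI, cos_2PI, sin_0, cos_0. ring. }
  apply (is_RInt_derive G).
  - intros t _. unfold G. auto_derive; [trivial|].
    assert (H := sin2_cos2 t). unfold Rsqr in H.
    replace ((a + r * cos t) ^ 2 + (b + r * sin t) ^ 2)%R with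
      (a ^ 2 + b ^ 2 + r ^ 2 * (sin t * sin t + cos t * cos t) + 2 * r * (a * cos t + b * sin t))%R by ring.
    rewrite H. ring.
  - intros t _. apply (ex_derive_continuous (V := R_NormedModule)). auto_derive. trivial.
Qed.

(** Adding [eta |z|^2] makes the modulus strictly subharmonic: its mean over a circle exceeds the
    value at the centre by at least [eta r^2], which excludes an interior maximum outright. *)
Lemma sup_norm_lt (K : C -> Prop) (g : C -> C) (B eta : R) (z : C) (r : R) :
  (0 < eta)%R -> (0 < r)%R -> (forall w, (Cmod (w - z) <= r)%R -> K w) ->
  (forall w, K w -> holo g w) ->
  exists w, K w /\ (Cmod (g z) + eta * Cmod z ^ 2 < Cmod (g w) + eta * Cmod w ^ 2)%R.
Proof.
  intros He Hr HK Hg. apply NNPP. intros Hno.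
  assert (Hle : forall w, K w -> (Cmod (g w) <= Cmod (g z) + eta * Cmod z ^ 2 - eta * Cmod w ^ 2)%R).
  { intros w Hw. apply Rnot_lt_le. intros H. apply Hno. exists w. split; [exact Hw|]. lra. }
  assert (Hpi := PI_RGT_0).
  set (x := ln r). assert (Ex : exp x = r) by (apply exp_ln, Hr).
  assert (HKc : forall t, K (z + Cexp (x, t))).
  { intros t. apply HK. replace (z + Cexp (x, t) - z) with (Cexp (x, t)) by ring.
    rewrite Cmod_Cexp_pair, Ex. lra. }
  assert (Hmv : CRInt (fun t => g (z + Cexp (x, t))) 0 (2 * PI) = RtoC (2 * PI) * g z).
  { apply mean_value. intros w Hw. apply Hg, HK. rewrite <- Ex. exact Hw. }
  assert (Hc : forall t, contRC (fun t => g (z + Cexp (x, t))) t).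
  { intros t. apply (contRC_vertical (fun w => g (z + Cexp w))). apply holo_cont.
    apply (holo_comp g (fun w => z + Cexp w)); [|apply Hg, HKc].
    apply holo_plus; [apply holo_const|apply holo_Cexp]. }
  assert (HI := CRInt_correct (fun t => g (z + Cexp (x, t))) 0 (2 * PI) ltac:(lra) ltac:(intros; apply Hc)).
  rewrite Hmv in HI.
  destruct z as [a b] eqn:Ez. rewrite <- Ez in *.
  assert (Hineq : (norm (V := C_R_NormedModule) (RtoC (2 * PI) * g z)%C <=
    2 * PI * (Cmod (g z) + eta * Cmod z ^ 2 - eta * (a ^ 2 + b ^ 2 + r ^ 2)))%R).
  { refine (norm_RInt_le (V := C_R_NormedModule) _ _ 0 (2 * PI) _ _ _ _ HI
      (RInt_circle_sq a b r (Cmod (g z) + eta * Cmod z ^ 2) eta)); [lra|].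
    intros t _. rewrite norm_C_R. eapply Rle_trans; [apply Hle, HKc|].
    rewrite (Cmod2_alt (z + Cexp (x, t))), Ez. unfold Cexp, Re, Im; simpl. rewrite Ex. lra. }
  rewrite norm_C_R, Cmod_mult, Cmod_R, Rabs_pos_eq in Hineq by lra.
  rewrite (Cmod2_alt z), Ez in Hineq. unfold Re, Im in Hineq; simpl in Hineq.
  apply Rmult_le_reg_l in Hineq; [|lra].
  assert (0 < eta * r ^ 2)%R by (apply Rmult_lt_0_compat; [lra|apply pow_lt, Hr]).
  simpl in *. lra.
Qed.

(** The last hypothesis encodes the boundary: each point of the compact set either satisfies the
    bound already or is interior. A maximum of the perturbed modulus is excluded at interior points,
    so it sits where the bound is known. *)
Theorem max_principle (K : C -> Prop) (g : C -> C) (B m : R) :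
  (forall z, K z -> (Cmod z <= B)%R) ->
  (forall z, ~ K z -> exists d, (0 < d)%R /\ forall w, (Cmod (w - z) < d)%R -> ~ K w) ->
  (forall z, K z -> holo g z) ->
  (forall z, K z -> (Cmod (g z) <= m)%R \/
     exists r, (0 < r)%R /\ forall w, (Cmod (w - z) <= r)%R -> K w) ->
  forall z, K z -> (Cmod (g z) <= m)%R.
Proof.
  intros HB Hcl Hg Hbd z1 Hz1. apply Rnot_lt_le. intros Hlt.
  (* Small enough that the perturbation, at most [eta B^2] on [K], cannot make up for the excess of
     [|g z1|] over [m]. *)
  set (eta := ((Cmod (g z1) - m) / (2 * (B ^ 2 + 1)))%R).
  assert (HB2 : (0 < B ^ 2 + 1)%R) by (assert (H := pow2_ge_0 B); lra).
  assert (He : (0 < eta)%R) by (apply Rdiv_lt_0_compat; lra).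
  assert (HeB : (eta * B ^ 2 < Cmod (g z1) - m)%R).
  { assert (E : (eta * (B ^ 2 + 1) = (Cmod (g z1) - m) / 2)%R) by (unfold eta; field; lra). lra. }
  destruct (compact_attains_max K (fun z => Cmod (g z) + eta * Cmod z ^ 2)%R B z1 Hz1 HB Hcl)
    as [z [Hz Hmax]].
  { intros z Hz.
    apply (continuous_plus (V := R_NormedModule) (fun z => Cmod (g z)) (fun z => eta * Cmod z ^ 2)%R).
    - apply (continuous_comp (U := C_UniformSpace) (V := C_UniformSpace) g Cmod);
        [now apply holo_cont, Hg|apply continuous_Cmod].
    - apply (continuous_comp (U := C_UniformSpace) Cmod (fun x => eta * x ^ 2)%R);
        [apply continuous_Cmod|].
      apply (ex_derive_continuous (V := R_NormedModule)). auto_derive. trivial. }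
  assert (Hz0 : (0 <= Cmod z)%R) by apply Cmod_ge_0.
  assert (HzB : (Cmod z ^ 2 <= B ^ 2)%R) by (apply pow_incr; split; [exact Hz0|now apply HB]).
  assert (H1 := Hmax z1 Hz1). simpl in H1.
  assert (Hz1s := pow2_ge_0 (Cmod z1)).
  destruct (Hbd z Hz) as [Hm|[r [Hr HK]]].
  - simpl in *. nra.
  - destruct (sup_norm_lt K g B eta z r He Hr HK Hg) as [w [Hw Hlt']].
    specialize (Hmax w Hw). simpl in *. lra.
Qed.

(** * The two-constants theorem *)

Lemma closed_disc_compl_open (z0 : C) (r : R) (z : C) :
  ~ (Cmod (z - z0) <= r)%R ->
  exists d, (0 < d)%R /\ forall w, (Cmod (w - z) < d)%R -> ~ (Cmod (w - z0) <= r)%R.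
Proof.
  intros H. exists (Cmod (z - z0) - r)%R. split; [lra|]. intros w Hw.
  assert (H1 := Cmod_triangle (w - z0) (z - w)).
  replace (w - z0 + (z - w)) with (z - z0) in H1 by ring.
  rewrite (Cmod_sub_sym z w) in H1. lra.
Qed.

Lemma bounded_on_disc (f : C -> C) (z0 : C) (r : R) :
  (0 <= r)%R -> (forall w, (Cmod (w - z0) <= r)%R -> contC f w) ->
  exists W, (0 <= W)%R /\ forall w, (Cmod (w - z0) <= r)%R -> (Cmod (f w) <= W)%R.
Proof.
  intros Hr Hf.
  destruct (compact_attains_max (fun w => (Cmod (w - z0) <= r)%R) (fun w => Cmod (f w))
    (r + Cmod z0) z0) as [z [Hz Hmax]].
  - replace (z0 - z0) with (RtoC 0) by ring. now rewrite Cmod_0.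
  - intros w Hw. assert (H := Cmod_triangle (w - z0) z0).
    replace (w - z0 + z0) with w in H by ring. lra.
  - apply closed_disc_compl_open.
  - intros w Hw. apply (continuous_comp (U := C_UniformSpace) (V := C_UniformSpace) f Cmod);
      [now apply Hf|apply continuous_Cmod].
  - exists (Cmod (f z)). split; [apply Cmod_ge_0|exact Hmax].
Qed.

(** Constants independent of [M] disappear under [M]-th roots. This removes the factor [N^2] left
    over by the exponent [M + 2]. *)
Lemma pow_ratio_bounded (x m A W : R) :
  (0 < A)%R -> (0 < m)%R -> (0 <= x)%R -> (forall M : nat, (A * x ^ M <= W * m ^ M)%R) -> (x <= m)%R.
Proof.
  intros HA Hm Hx H. apply Rnot_lt_le. intros Hlt.
  assert (Hr : (1 < x / m)%R).
  { apply Rmult_lt_reg_r with m; [exact Hm|]. unfold Rdiv.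
    rewrite Rmult_assoc, Rinv_l; lra. }
  destruct (Pow_x_infinity (x / m)%R ltac:(rewrite Rabs_pos_eq; lra) (W / A + 1)%R) as [M HM].
  specialize (HM M (Nat.le_refl M)). specialize (H M).
  assert (Hp : (0 < m ^ M)%R) by now apply pow_lt.
  assert (E : ((x / m) ^ M = x ^ M / m ^ M)%R).
  { unfold Rdiv. rewrite Rpow_mult_distr, pow_inv. reflexivity. }
  rewrite E, Rabs_pos_eq in HM.
  2:{ apply Rdiv_le_0_compat; [now apply pow_le|exact Hp]. }
  assert (H1 : (A * (x ^ M / m ^ M) <= W)%R).
  { apply Rmult_le_reg_r with (m ^ M)%R; [exact Hp|].
    replace (A * (x ^ M / m ^ M) * m ^ M)%R with (A * x ^ M)%R by (field; lra). exact H. }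
  apply Rge_le in HM. apply Rmult_le_compat_l with (r := A) in HM; [|lra].
  replace (A * (W / A + 1))%R with (W + A)%R in HM by (field; lra). lra.
Qed.

(* The exponent [M + 2] makes the quotient differentiable, with derivative 0,
   at the zeros of [D], without any information on their order. *)
Lemma holo_pow_quotient (N D : C -> C) (z : C) (r B : R) (M : nat) :
  (0 < r)%R -> (0 <= B)%R ->
  (forall w, (Cmod (w - z) < r)%R -> (Cmod (N w) <= B * Cmod (D w))%R) ->
  holo N z -> holo D z ->
  holo (fun w => Cpow (N w) (M + 2) * Cpow (/ D w) M) z.
Proof.
  intros Hr HB HND HN HD.
  destruct (classic (D z = 0)) as [Hz|Hz].
  2:{ apply holo_mult; [now apply holo_pow|]. apply holo_pow, holo_inv; assumption. }
  assert (HNz : N z = 0).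
  { apply Cmod_eq_0, Rle_antisym; [|apply Cmod_ge_0].
    specialize (HND z). rewrite Hz in HND.
    replace (z - z) with (RtoC 0) in HND by ring. rewrite Cmod_0 in HND.
    rewrite Rmult_0_r in HND. now apply HND. }
  assert (Hb : forall w, (Cmod (w - z) < r)%R ->
    (Cmod (Cpow (N w) (M + 2) * Cpow (/ D w) M) <= Cmod (N w) ^ 2 * B ^ M)%R).
  { intros w Hw. specialize (HND w Hw).
    rewrite Cmod_mult, !Cmod_pow, pow_add.
    destruct (classic (D w = 0)) as [Hd|Hd].
    - rewrite Hd, Cmod_0, Rmult_0_r in HND.
      assert (E : Cmod (N w) = 0%R) by (apply Rle_antisym; [exact HND|apply Cmod_ge_0]).
      rewrite E. assert (H1 := pow_le B M HB). simpl. nra.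
    - rewrite Cmod_inv by exact Hd. assert (Hd' := proj1 (Cmod_gt_0 _) Hd).
      replace (Cmod (N w) ^ M * Cmod (N w) ^ 2 * (/ Cmod (D w)) ^ M)%R with
        (Cmod (N w) ^ 2 * (Cmod (N w) * / Cmod (D w)) ^ M)%R by (rewrite Rpow_mult_distr; ring).
      apply Rmult_le_compat_l; [apply pow2_ge_0|]. apply pow_incr. split.
      + apply Rmult_le_pos; [apply Cmod_ge_0|]. left. now apply Rinv_0_lt_compat.
      + apply Rmult_le_reg_r with (Cmod (D w)); [exact Hd'|].
        rewrite Rmult_assoc, Rinv_l by lra. lra. }
  destruct HN as [p [Hp EN]].
  destruct (proj1 (contC_iff p z) Hp 1%R ltac:(lra)) as [d1 [Hd1 Hp1]].
  set (L := (Cmod (p z) + 1)%R).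
  assert (HL : (1 <= L)%R) by (assert (H := Cmod_ge_0 (p z)); unfold L; lra).
  apply holo_iff. exists 0. intros eps He.
  assert (HBM : (0 <= B ^ M)%R) by now apply pow_le.
  assert (Hq : (0 < L ^ 2 * (B ^ M + 1))%R) by nra.
  exists (Rmin (Rmin r d1) (eps / (L ^ 2 * (B ^ M + 1)))%R).
  split; [repeat apply Rmin_pos; auto; now apply Rdiv_lt_0_compat|].
  intros w Hw.
  assert (H1 : (Cmod (w - z) < r)%R)
    by (eapply Rlt_le_trans; [exact Hw|]; eapply Rle_trans; [apply Rmin_l|apply Rmin_l]).
  assert (H2 : (Cmod (w - z) < d1)%R)
    by (eapply Rlt_le_trans; [exact Hw|]; eapply Rle_trans; [apply Rmin_l|apply Rmin_r]).
  assert (H3 := Rlt_le_trans _ _ _ Hw (Rmin_r _ _)).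
  replace (N z ^ (M + 2)) with (RtoC 0)
    by (rewrite HNz, Cpow_add_r; simpl; ring).
  replace (Cpow (N w) (M + 2) * Cpow (/ D w) M - 0 * Cpow (/ D z) M - 0 * (w - z))
    with (Cpow (N w) (M + 2) * Cpow (/ D w) M) by ring.
  eapply Rle_trans; [now apply Hb|].
  assert (HNw : (Cmod (N w) <= L * Cmod (w - z))%R).
  { rewrite (EN w), HNz, Cplus_0_l, Cmod_mult.
    apply Rmult_le_compat_r; [apply Cmod_ge_0|].
    assert (H := Cmod_triangle (p w - p z) (p z)).
    replace (p w - p z + p z) with (p w) in H by ring.
    specialize (Hp1 w H2). unfold L. lra. }
  assert (Hw0 := Cmod_ge_0 (w - z)). assert (HN0 := Cmod_ge_0 (N w)).
  assert (HN2 : (Cmod (N w) ^ 2 <= (L * Cmod (w - z)) ^ 2)%R) by (apply pow_incr; lra).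
  apply Rlt_le in H3. apply Rmult_le_compat_l with (r := (L ^ 2 * (B ^ M + 1))%R) in H3; [|lra].
  replace (L ^ 2 * (B ^ M + 1) * (eps / (L ^ 2 * (B ^ M + 1))))%R with eps in H3 by (field; lra).
  apply Rle_trans with ((L * Cmod (w - z)) ^ 2 * (B ^ M + 1))%R; [nra|].
  replace ((L * Cmod (w - z)) ^ 2 * (B ^ M + 1))%R with
    ((L ^ 2 * (B ^ M + 1) * Cmod (w - z)) * Cmod (w - z))%R by ring.
  apply Rmult_le_compat_r; assumption.
Qed.

(** Three circles with an integer exponent: [|w - z0|^k] interpolates between the circles, so that
    dividing by [(w - z0)^(k M)] keeps a single-valued holomorphic function. The maximum principle
    for [N^(M+2) / (D^M (w - z0)^(k M))] on the annulus gives the bound as [M] grows. *)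
Lemma two_constants_annulus (N D : C -> C) (z0 : C) (r0 r1 r2 B m : R) (k : nat) :
  (0 < r0)%R -> (r0 < r1)%R -> (r1 < r2)%R -> (0 <= B)%R -> (0 < m)%R ->
  (forall w, (Cmod (w - z0) < r2)%R -> holo N w /\ holo D w) ->
  (forall w, (Cmod (w - z0) < r2)%R -> (Cmod (N w) <= B * Cmod (D w))%R) ->
  (B <= m * r1 ^ k)%R ->
  (forall w, (Cmod (w - z0) <= r0)%R -> (Cmod (N w) <= m * r0 ^ k * Cmod (D w))%R) ->
  forall z, (r0 <= Cmod (z - z0) <= r1)%R ->
    (Cmod (N z) <= m * Cmod (z - z0) ^ k * Cmod (D z))%R.
Proof.
  intros Hr0 Hr1 Hr2 HB Hm Hh HND H1 H0 z Hz.
  destruct (bounded_on_disc N z0 r1) as [W [HW0 HW]]; [lra| |].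
  { intros w Hw. apply holo_cont, Hh. lra. }
  assert (HDz0 : D z = 0 -> N z = 0).
  { intros E. apply Cmod_eq_0, Rle_antisym; [|apply Cmod_ge_0].
    specialize (HND z ltac:(lra)). rewrite E, Cmod_0, Rmult_0_r in HND. exact HND. }
  set (K := fun w => (r0 <= Cmod (w - z0) <= r1)%R).
  destruct (classic (N z = 0)) as [HNz|HNz].
  { rewrite HNz, Cmod_0. apply Rmult_le_pos; [|apply Cmod_ge_0].
    apply Rmult_le_pos; [lra|]. apply pow_le, Cmod_ge_0. }
  assert (HDz : D z <> 0) by tauto. clear HDz0.
  assert (Hval : forall w M, K w -> D w <> 0 ->
    Cmod (Cpow (N w) (M + 2) * Cpow (/ D w) M * Cpow (/ (w - z0)) (k * M))
     = (Cmod (N w) ^ 2 * (Cmod (N w) / Cmod (D w) / Cmod (w - z0) ^ k) ^ M)%R).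
  { intros w M Hw Hd. assert (Hwz : w - z0 <> 0) by (apply Cmod_gt_0; unfold K in Hw; lra).
    rewrite !Cmod_mult, !Cmod_pow, !Cmod_inv by assumption.
    unfold Rdiv. rewrite !Rpow_mult_distr, pow_add, pow_mult, !pow_inv. ring. }
  assert (Hmax : forall M, (Cmod (N z) ^ 2 * (Cmod (N z) / Cmod (D z) / Cmod (z - z0) ^ k) ^ M <= W ^ 2 * m ^ M)%R).
  { intros M. rewrite <- Hval by assumption.
    apply (max_principle K (fun w => Cpow (N w) (M + 2) * Cpow (/ D w) M * Cpow (/ (w - z0)) (k * M))
       (r1 + Cmod z0)%R); [| | | |exact Hz].
    - intros w [_ Hw]. assert (H := Cmod_triangle (w - z0) z0).
      replace (w - z0 + z0) with w in H by ring. lra.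
    - intros w Hw. destruct (Rle_dec (Cmod (w - z0)) r1) as [Hle|Hnle].
      + exists (r0 - Cmod (w - z0))%R. unfold K in Hw.
        split; [lra|].
        intros w' Hw' [Hk _]. assert (H := Cmod_triangle (w - z0) (w' - w)).
        replace (w - z0 + (w' - w)) with (w' - z0) in H by ring. lra.
      + destruct (closed_disc_compl_open z0 r1 w Hnle) as [d [Hd Hd']].
        exists d. split; [exact Hd|]. intros w' Hw' [_ Hk]. exact (Hd' w' Hw' Hk).
    - intros w Hw. unfold K in Hw.
      destruct (Hh w ltac:(lra)) as [hN hD].
      apply holo_mult.
      + apply (holo_pow_quotient N D w (r2 - Cmod (w - z0)) B); auto; [lra|].
        intros w' Hw'. apply HND. assert (H := Cmod_triangle (w' - w) (w - z0)).
        replace (w' - w + (w - z0)) with (w' - z0) in H by ring. lra.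
      + apply holo_pow, holo_inv; [apply holo_minus; [apply holo_id|apply holo_const]|].
        apply Cmod_gt_0. lra.
    - intros w Hw.
      (* Where [D] vanishes on a bounding circle, so does [N], and the function is 0 there;
         elsewhere the known bound on the ratio applies. *)
      assert (Hbd : forall r, (0 < r)%R -> Cmod (w - z0) = r -> (Cmod (N w) <= m * r ^ k * Cmod (D w))%R ->
        (Cmod (Cpow (N w) (M + 2) * Cpow (/ D w) M * Cpow (/ (w - z0)) (k * M)) <= W ^ 2 * m ^ M)%R).
      { intros r Hr Er Hle. destruct (classic (D w = 0)) as [Hd|Hd].
        - rewrite Hd, Cmod_0, Rmult_0_r in Hle.
          assert (E : N w = 0) by (apply Cmod_eq_0, Rle_antisym; [exact Hle|apply Cmod_ge_0]).
          rewrite !Cmod_mult, Cmod_pow, E, Cmod_0, pow_add.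
          assert (0 <= W ^ 2)%R by apply pow2_ge_0.
          assert (0 <= m ^ M)%R by (apply pow_le; lra). simpl in *. nra.
        - rewrite Hval by assumption. apply Rmult_le_compat.
          + apply pow2_ge_0.
          + apply pow_le. repeat apply Rdiv_le_0_compat; [apply Cmod_ge_0|now apply Cmod_gt_0|].
            rewrite Er. now apply pow_lt.
          + apply pow_incr. split; [apply Cmod_ge_0|]. apply HW, Hw.
          + apply pow_incr. split.
            * repeat apply Rdiv_le_0_compat; [apply Cmod_ge_0|now apply Cmod_gt_0|].
              rewrite Er. now apply pow_lt.
            * rewrite Er. assert (Hrk : (0 < r ^ k)%R) by now apply pow_lt.
              apply Cmod_gt_0 in Hd.
              apply Rmult_le_reg_r with (Cmod (D w) * r ^ k)%R; [nra|].
              replace (Cmod (N w) / Cmod (D w) / r ^ k * (Cmod (D w) * r ^ k))%R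
                with (Cmod (N w)) by (field; lra). lra. }
      destruct (Req_dec (Cmod (w - z0)) r0) as [E0|E0].
      { left. apply (Hbd r0); auto. apply H0. lra. }
      destruct (Req_dec (Cmod (w - z0)) r1) as [E1|E1].
      { left. apply (Hbd r1); auto; [lra|]. destruct Hw as [_ Hw].
        eapply Rle_trans; [apply HND; lra|]. apply Rmult_le_compat_r; [apply Cmod_ge_0|exact H1]. }
      right. unfold K in Hw.
      exists (Rmin (Cmod (w - z0) - r0) (r1 - Cmod (w - z0)))%R.
      split; [apply Rmin_pos; lra|]. intros w' Hw'. unfold K.
      assert (A1 := Rle_trans _ _ _ Hw' (Rmin_l _ _)).
      assert (A2 := Rle_trans _ _ _ Hw' (Rmin_r _ _)).
      assert (T1 := Cmod_triangle (w' - w) (w - z0)).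
      replace (w' - w + (w - z0)) with (w' - z0) in T1 by ring.
      assert (T2 := Cmod_triangle (w - w') (w' - z0)).
      replace (w - w' + (w' - z0)) with (w - z0) in T2 by ring.
      rewrite (Cmod_sub_sym w w') in T2. lra. }
  assert (Hzk : (0 < Cmod (z - z0) ^ k)%R) by (apply pow_lt; lra).
  apply Cmod_gt_0 in HDz. apply Cmod_gt_0 in HNz.
  assert (Hfin : (Cmod (N z) / Cmod (D z) / Cmod (z - z0) ^ k <= m)%R).
  { apply (pow_ratio_bounded _ m (Cmod (N z) ^ 2) (W ^ 2)); auto.
    - now apply pow_lt.
    - repeat apply Rdiv_le_0_compat; lra. }
  apply Rmult_le_compat_r with (r := (Cmod (D z) * Cmod (z - z0) ^ k)%R) in Hfin; [|nra].
  replace (Cmod (N z) / Cmod (D z) / Cmod (z - z0) ^ k * (Cmod (D z) * Cmod (z - z0) ^ k))%R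
    with (Cmod (N z)) in Hfin by (field; lra). lra.
Qed.

(** The constant [eps] depends only on the radii, [B] and [eta]: a single one serves all translates
    and all truncations of a Dirichlet series. *)
Theorem two_constants (r0 rho r2 B eta : R) :
  (0 < r0)%R -> (r0 <= rho)%R -> (rho < r2)%R -> (0 <= B)%R -> (0 < eta)%R ->
  exists eps, (0 < eps)%R /\ forall (N D : C -> C) (z0 : C),
    (forall w, (Cmod (w - z0) < r2)%R -> holo N w /\ holo D w) ->
    (forall w, (Cmod (w - z0) < r2)%R -> (Cmod (N w) <= B * Cmod (D w))%R) ->
    (forall w, (Cmod (w - z0) <= r0)%R -> (Cmod (N w) <= eps * Cmod (D w))%R) ->
    forall z, (Cmod (z - z0) <= rho)%R -> (Cmod (N z) <= eta * Cmod (D z))%R.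
Proof.
  intros Hr0 Hrho Hr2 HB He.
  set (r1 := ((rho + r2) / 2)%R).
  assert (Hr1 : (rho < r1 < r2)%R) by (unfold r1; lra).
  assert (Hq : (0 < rho / r1 < 1)%R).
  { split; [apply Rdiv_lt_0_compat; lra|]. apply Rmult_lt_reg_r with r1; [lra|].
    unfold Rdiv. rewrite Rmult_assoc, Rinv_l; lra. }
  (* With [m = eta / rho^k], this choice of [k] makes [m r1^k] exceed [B], so the crude bound
     suffices on the outer circle; the price is the tiny constant [m r0^k] required on the inner
     disc. *)
  destruct (pow_lt_1_zero (rho / r1)%R ltac:(rewrite Rabs_pos_eq; lra) (eta / (B + 1))%R
    ltac:(apply Rdiv_lt_0_compat; lra)) as [k Hk].
  specialize (Hk k (Nat.le_refl k)). rewrite Rabs_pos_eq in Hk by (apply pow_le; lra).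
  assert (Hrk : (0 < rho ^ k)%R) by (apply pow_lt; lra).
  assert (Hr0k : (0 < r0 ^ k)%R) by (apply pow_lt; lra).
  assert (Hr1k : (0 < r1 ^ k)%R) by (apply pow_lt; lra).
  set (m := (eta / rho ^ k)%R). assert (Hm : (0 < m)%R) by now apply Rdiv_lt_0_compat.
  exists (m * r0 ^ k)%R. split; [now apply Rmult_lt_0_compat|].
  intros N D z0 Hh HND H0 z Hz.
  assert (Hmk : forall x, (0 <= x <= rho)%R -> (m * x ^ k <= eta)%R).
  { intros x Hx. assert (Hp := pow_incr x rho k Hx).
    apply Rmult_le_compat_l with (r := m) in Hp; [|lra].
    unfold m in *. replace (eta / rho ^ k * rho ^ k)%R with eta in Hp by (field; lra). exact Hp. }
  destruct (Rle_dec (Cmod (z - z0)) r0) as [Hle|Hnle].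
  - eapply Rle_trans; [now apply H0|]. apply Rmult_le_compat_r; [apply Cmod_ge_0|].
    apply Hmk. lra.
  - eapply Rle_trans.
    + apply (two_constants_annulus N D z0 r0 r1 r2 B m k); auto; try lra.
      assert (E : ((rho / r1) ^ k = rho ^ k / r1 ^ k)%R)
        by (unfold Rdiv; rewrite Rpow_mult_distr, pow_inv; reflexivity).
      rewrite E in Hk. unfold m.
      apply Rmult_le_reg_r with (rho ^ k / r1 ^ k)%R; [now apply Rdiv_lt_0_compat|].
      replace (eta / rho ^ k * r1 ^ k * (rho ^ k / r1 ^ k))%R with eta by (field; lra).
      apply Rlt_le in Hk. apply Rmult_le_compat_l with (r := (B + 1)%R) in Hk; [|lra].
      replace ((B + 1) * (eta / (B + 1)))%R with eta in Hk by (field; lra).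
      assert (0 < rho ^ k / r1 ^ k)%R by now apply Rdiv_lt_0_compat. nra.
    + apply Rmult_le_compat_r; [apply Cmod_ge_0|]. apply Hmk.
      split; [apply Cmod_ge_0|exact Hz].
Qed.

(** With [D = 1], a function vanishing on a small disc is below every [eps] there, so its modulus at
    [z] is at most half of itself. *)
Theorem identity_principle (f : C -> C) (z0 : C) (r : R) :
  (forall z, holo f z) -> (0 < r)%R -> (forall w, (Cmod (w - z0) <= r)%R -> f w = 0) ->
  forall z, f z = 0.
Proof.
  intros Hf Hr H0 z.
  set (rho := Rmax r (Cmod (z - z0))).
  assert (Hrho : (r <= rho)%R) by apply Rmax_l.
  destruct (bounded_on_disc f z0 (rho + 1)) as [W [HW0 HW]]; [lra|intros; apply holo_cont, Hf|].
  apply Cmod_eq_0, Rle_antisym; [|apply Cmod_ge_0].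
  apply Rnot_lt_le. intros Hlt.
  destruct (two_constants r rho (rho + 1) W (Cmod (f z) / 2)) as [eps [He H]]; try lra.
  specialize (H f (fun _ => 1) z0).
  assert (Hz : (Cmod (f z) <= Cmod (f z) / 2 * Cmod 1)%R).
  { apply H.
    - intros w _. split; [apply Hf|apply holo_const].
    - intros w Hw. rewrite Cmod_1, Rmult_1_r. apply HW. lra.
    - intros w Hw. rewrite (H0 w Hw), Cmod_0, Cmod_1. lra.
    - apply Rmax_r. }
  rewrite Cmod_1 in Hz. lra.
Qed.

(* On a square having one side in the segment, the product of the four rotations
   of [f] vanishes on the whole boundary, hence [f] vanishes at the centre. *)
Theorem zero_on_segment (f : C -> C) (x t1 t2 : R) :
  (forall z, holo f z) -> (t1 < t2)%R ->
  (forall t, (t1 < t < t2)%R -> f (x, t) = 0) -> forall z, f z = 0.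
Proof.
  intros Hf Ht H0.
  assert (Hc : forall a t : R, (0 < a)%R -> (t1 < t - a)%R -> (t + a < t2)%R -> f ((x - a)%R, t) = 0).
  { intros a t Ha Ha1 Ha2. set (c := ((x - a)%R, t) : C).
    pose (g := fun w => f (c + w) * f (c + Ci * w) * (f (c + - w) * f (c + (- Ci) * w))).
    assert (Hg : forall w, holo g w).
    { intros w. unfold g.
      repeat apply holo_mult; apply (holo_comp f); auto;
        (apply holo_plus; [apply holo_const|]).
      - apply holo_id.
      - apply holo_mult; [apply holo_const|apply holo_id].
      - apply holo_opp, holo_id.
      - apply holo_mult; [apply holo_const|apply holo_id]. }
    pose (K := fun w : C => (Rabs (Re w) <= a)%R /\ (Rabs (Im w) <= a)%R).
    assert (Hside : forall w : C, Re w = a -> (Rabs (Im w) <= a)%R -> f (c + w) = 0).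
    { intros [u v] Hu Hv. unfold Re, Im in *; simpl in Hu, Hv. subst u.
      replace (c + (a, v)) with ((x, (t + v)%R) : C)
        by (unfold c; apply injective_projections; simpl; ring).
      apply Rabs_le_between in Hv.
      destruct (Req_dec (Rabs v) a) as [E|E]; apply H0; split; try lra. }
    assert (Hmax : (Cmod (g 0) <= 0)%R).
    { apply (max_principle K g (a + a)%R).
      - intros w [H1 H2]. eapply Rle_trans; [apply Cmod_le_re_im|]. lra.
      - intros w Hw. assert (H : (a < Rmax (Rabs (Re w)) (Rabs (Im w)))%R).
        { apply Rnot_le_lt. intros H. apply Hw.
          split; (eapply Rle_trans; [|exact H]); [apply Rmax_l|apply Rmax_r]. }
        exists (Rmax (Rabs (Re w)) (Rabs (Im w)) - a)%R. split; [lra|].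
        intros w' Hw' [H1 H2].
        assert (R1 := re_sub_abs_le w' w). assert (R2 := im_sub_abs_le w' w).
        assert (T1 := Rabs_triang_inv (Re w) (Re w')). rewrite Rabs_minus_sym in T1.
        assert (T2 := Rabs_triang_inv (Im w) (Im w')). rewrite (Rabs_minus_sym (Im w)) in T2.
        unfold Rmax in *. destruct (Rle_dec (Rabs (Re w)) (Rabs (Im w))); lra.
      - intros; apply Hg.
      - intros w [H1 H2].
        destruct (Req_dec (Rabs (Re w)) a) as [E1|E1]; [|destruct (Req_dec (Rabs (Im w)) a) as [E2|E2]].
        + left. right. unfold g. rewrite <- Cmod_0. f_equal.
          destruct w as [u v]; unfold Re, Im in *; simpl in *.
          unfold Rabs in E1 at 1. destruct (Rcase_abs u).
          * rewrite (Hside (- (u, v))); [ring|simpl; lra|simpl; now rewrite Rabs_Ropp].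
          * rewrite (Hside (u, v)); [ring|simpl; lra|simpl; lra].
        + left. right. unfold g. rewrite <- Cmod_0. f_equal.
          destruct w as [u v]; unfold Re, Im in *; simpl in *.
          unfold Rabs in E2 at 1. destruct (Rcase_abs v).
          * rewrite (Hside (Ci * (u, v))); [ring|simpl; lra|simpl].
            replace (0 * v + 1 * u)%R with u by ring. lra.
          * rewrite (Hside (- Ci * (u, v))); [ring|simpl; lra|simpl].
            replace (- 0 * v + - (1) * u)%R with (- u)%R by ring. rewrite Rabs_Ropp. lra.
        + right. exists (Rmin (a - Rabs (Re w)) (a - Rabs (Im w)))%R.
          split; [apply Rmin_pos; lra|]. intros w' Hw'.
          assert (A1 := Rle_trans _ _ _ Hw' (Rmin_l _ _)).
          assert (A2 := Rle_trans _ _ _ Hw' (Rmin_r _ _)).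
          assert (R1 := re_sub_abs_le w' w). assert (R2 := im_sub_abs_le w' w).
          assert (T1 := Rabs_triang_inv (Re w') (Re w)).
          assert (T2 := Rabs_triang_inv (Im w') (Im w)). split; lra.
      - unfold K; simpl. rewrite Rabs_R0. lra. }
    assert (Hg0 : g 0 = 0) by (apply Cmod_eq_0, Rle_antisym; [exact Hmax|apply Cmod_ge_0]).
    unfold g in Hg0.
    replace (c + Ci * 0) with (c + 0) in Hg0 by ring. replace (c + - (0)) with (c + 0) in Hg0 by ring.
    replace (c + - Ci * 0) with (c + 0) in Hg0 by ring. rewrite Cplus_0_r in Hg0.
    apply NNPP. intros Hn. revert Hg0. repeat apply Cmult_neq_0; exact Hn. }
  (* For centres within [h / 4] of the chosen point, the half side lies between [3 h / 4] and
     [5 h / 4], so the right side of the square stays inside the segment. Vanishing on this disc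
     gives vanishing everywhere. *)
  set (h := ((t2 - t1) / 4)%R).
  apply (identity_principle f ((x - h)%R, ((t1 + t2) / 2)%R) (h / 4)); [exact Hf|unfold h; lra|].
  intros [u v] Hw.
  assert (R1 := re_le_Cmod ((u, v) - ((x - h)%R, ((t1 + t2) / 2)%R))).
  assert (R2 := im_le_Cmod ((u, v) - ((x - h)%R, ((t1 + t2) / 2)%R))).
  unfold Re, Im in R1, R2; simpl in R1, R2.
  apply Rle_trans with (2 := Hw) in R1. apply Rle_trans with (2 := Hw) in R2.
  apply Rabs_le_between in R1. apply Rabs_le_between in R2.
  replace u with (x - (x - u))%R by ring. apply Hc; unfold h in *; lra.
Qed.

(** * Finite sums *)

Fixpoint Csum (f : nat -> C) (n : nat) : C :=
  match n with O => 0 | S k => Csum f k + f k end.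

Fixpoint Rsum (f : nat -> R) (n : nat) : R :=
  match n with O => 0%R | S k => (Rsum f k + f k)%R end.

Lemma Rsum_S (f : nat -> R) (n : nat) : Rsum f (S n) = (Rsum f n + f n)%R.
Proof. reflexivity. Qed.

Lemma Csum_S (f : nat -> C) (n : nat) : Csum f (S n) = Csum f n + f n.
Proof. reflexivity. Qed.

Lemma Csum_ext (f g : nat -> C) (n : nat) :
  (forall k, (k < n)%nat -> f k = g k) -> Csum f n = Csum g n.
Proof. induction n as [|n IH]; intros H; simpl; [easy|]. rewrite IH, H; auto. Qed.

Lemma Csum_plus (f g : nat -> C) (n : nat) :
  Csum (fun k => f k + g k) n = Csum f n + Csum g n.
Proof. induction n as [|n IH]; simpl; [ring|]. rewrite IH. ring. Qed.

Lemma Csum_minus (f g : nat -> C) (n : nat) :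
  Csum (fun k => f k - g k) n = Csum f n - Csum g n.
Proof. induction n as [|n IH]; simpl; [ring|]. rewrite IH. ring. Qed.

Lemma Csum_mult_l (c : C) (f : nat -> C) (n : nat) :
  Csum (fun k => c * f k) n = c * Csum f n.
Proof. induction n as [|n IH]; simpl; [ring|]. rewrite IH. ring. Qed.

Lemma Csum_const (c : C) (n : nat) : Csum (fun _ => c) n = INR n * c.
Proof.
  induction n as [|n IH]; [simpl; ring|].
  simpl Csum. rewrite IH, S_INR, RtoC_plus. ring.
Qed.

Lemma Csum_conj (f : nat -> C) (n : nat) :
  Cconj (Csum f n) = Csum (fun k => Cconj (f k)) n.
Proof.
  induction n as [|n IH]; simpl; [apply injective_projections; simpl; ring|].
  now rewrite Cplus_conj, IH.
Qed.

Lemma Cmod_Csum (f : nat -> C) (n : nat) :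
  (Cmod (Csum f n) <= Rsum (fun k => Cmod (f k)) n)%R.
Proof.
  induction n as [|n IH]; simpl; [rewrite Cmod_0; lra|].
  eapply Rle_trans; [apply Cmod_triangle|]. lra.
Qed.

Lemma Csum_swap (f : nat -> nat -> C) (n m : nat) :
  Csum (fun i => Csum (fun j => f i j) m) n = Csum (fun j => Csum (fun i => f i j) n) m.
Proof.
  induction n as [|n IH]; simpl.
  - induction m as [|m IH]; simpl; [easy|]. rewrite <- IH. ring.
  - now rewrite IH, Csum_plus.
Qed.

Lemma Rsum_ext (f g : nat -> R) (n : nat) :
  (forall k, (k < n)%nat -> f k = g k) -> Rsum f n = Rsum g n.
Proof. induction n as [|n IH]; intros H; simpl; [easy|]. rewrite IH, H; auto. Qed.

Lemma Rsum_le (f g : nat -> R) (n : nat) :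
  (forall k, (k < n)%nat -> (f k <= g k)%R) -> (Rsum f n <= Rsum g n)%R.
Proof.
  induction n as [|n IH]; intros H; simpl; [lra|].
  apply Rplus_le_compat; auto.
Qed.

Lemma Rsum_plus (f g : nat -> R) (n : nat) :
  Rsum (fun k => f k + g k)%R n = (Rsum f n + Rsum g n)%R.
Proof. induction n as [|n IH]; simpl; [ring|]. rewrite IH. ring. Qed.

Lemma Rsum_mult_l (c : R) (f : nat -> R) (n : nat) :
  Rsum (fun k => c * f k)%R n = (c * Rsum f n)%R.
Proof. induction n as [|n IH]; simpl; [ring|]. rewrite IH. ring. Qed.

Lemma Rsum_const (c : R) (n : nat) : Rsum (fun _ => c) n = (INR n * c)%R.
Proof.
  induction n as [|n IH]; [simpl; ring|].
  simpl Rsum. rewrite IH, S_INR. ring.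
Qed.

Lemma Rsum_nonneg (f : nat -> R) (n : nat) :
  (forall k, (k < n)%nat -> (0 <= f k)%R) -> (0 <= Rsum f n)%R.
Proof.
  intros H. apply Rle_trans with (Rsum (fun _ => 0%R) n).
  - rewrite Rsum_const. lra.
  - now apply Rsum_le.
Qed.

Lemma Rsum_incr (f : nat -> R) (n m : nat) :
  (n <= m)%nat -> (forall k, (0 <= f k)%R) -> (Rsum f n <= Rsum f m)%R.
Proof. intros H Hf. induction H; [lra|]. simpl. specialize (Hf m). lra. Qed.

Lemma Rsum_swap (f : nat -> nat -> R) (n m : nat) :
  Rsum (fun i => Rsum (fun j => f i j) m) n = Rsum (fun j => Rsum (fun i => f i j) n) m.
Proof.
  induction n as [|n IH]; simpl.
  - induction m as [|m IH]; simpl; [easy|]. rewrite <- IH. ring.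
  - now rewrite IH, Rsum_plus.
Qed.

Lemma Re_Csum (f : nat -> C) (n : nat) : Re (Csum f n) = Rsum (fun k => Re (f k)) n.
Proof. induction n as [|n IH]; simpl; [easy|]. now rewrite <- IH. Qed.

(** * Means along arithmetic progressions *)

(* The sampling step [tau] is small, so that no nonzero frequency of a given
   trigonometric polynomial is aliased to 0. *)
Definition has_mean (f : R -> C) (mu : C) : Prop :=
  exists tau0 : R, (0 < tau0)%R /\ forall tau : R, (0 < tau < tau0)%R ->
    forall T eps : R, (0 < eps)%R -> exists J0 : nat, forall J : nat, (J0 <= J)%nat ->
      (Cmod (Csum (fun j => f (T + INR j * tau)%R) J - INR J * mu) <= eps * INR J)%R.

Lemma has_mean_ext (f g : R -> C) (mu : C) :
  (forall t, f t = g t) -> has_mean f mu -> has_mean g mu.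
Proof.
  intros E [tau0 [H0 H]]. exists tau0. split; [exact H0|].
  intros tau Ht T eps He. destruct (H tau Ht T eps He) as [J0 HJ].
  exists J0. intros J HJ'. rewrite <- (Csum_ext (fun j => f (T + INR j * tau)%R)); auto.
Qed.

Lemma has_mean_const (c : C) : has_mean (fun _ => c) c.
Proof.
  exists 1%R. split; [lra|]. intros tau _ T eps He. exists O. intros J _.
  rewrite Csum_const. replace (INR J * c - INR J * c) with (RtoC 0) by ring.
  rewrite Cmod_0. apply Rmult_le_pos; [lra|apply pos_INR].
Qed.

Lemma has_mean_plus (f g : R -> C) (mu nu : C) :
  has_mean f mu -> has_mean g nu -> has_mean (fun t => f t + g t) (mu + nu).
Proof.
  intros [t1 [H1 Hf]] [t2 [H2 Hg]]. exists (Rmin t1 t2). split; [now apply Rmin_pos|].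
  intros tau Ht T eps He.
  destruct (Hf tau ltac:(split; [easy|eapply Rlt_le_trans; [apply Ht|apply Rmin_l]]) T (eps / 2)%R ltac:(lra)) as [J1 HJ1].
  destruct (Hg tau ltac:(split; [easy|eapply Rlt_le_trans; [apply Ht|apply Rmin_r]]) T (eps / 2)%R ltac:(lra)) as [J2 HJ2].
  exists (max J1 J2). intros J HJ. specialize (HJ1 J ltac:(lia)). specialize (HJ2 J ltac:(lia)).
  rewrite Csum_plus.
  match goal with |- (Cmod (?a + ?b - _) <= _)%R =>
    replace (a + b - INR J * (mu + nu)) with ((a - INR J * mu) + (b - INR J * nu)) by ring end.
  eapply Rle_trans; [apply Cmod_triangle|]. lra.
Qed.

Lemma has_mean_scal (c : C) (f : R -> C) (mu : C) :
  has_mean f mu -> has_mean (fun t => c * f t) (c * mu).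
Proof.
  intros [t1 [H1 Hf]]. exists t1. split; [exact H1|]. intros tau Ht T eps He.
  assert (Hc := Cmod_ge_0 c).
  destruct (Hf tau Ht T (eps / (Cmod c + 1))%R ltac:(apply Rdiv_lt_0_compat; lra)) as [J1 HJ1].
  exists J1. intros J HJ. specialize (HJ1 J HJ). rewrite Csum_mult_l.
  match goal with |- (Cmod (c * ?b - _) <= _)%R =>
    replace (c * b - INR J * (c * mu)) with (c * (b - INR J * mu)) by ring end.
  rewrite Cmod_mult.
  apply Rmult_le_compat_l with (r := Cmod c) in HJ1; [|exact Hc].
  eapply Rle_trans; [exact HJ1|].
  replace (Cmod c * (eps / (Cmod c + 1) * INR J))%R with (Cmod c / (Cmod c + 1) * (eps * INR J))%R
    by (field; lra).
  assert (Hr : (Cmod c / (Cmod c + 1) <= 1)%R).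
  { apply Rmult_le_reg_r with (Cmod c + 1)%R; [lra|].
    unfold Rdiv. rewrite Rmult_assoc, Rinv_l; lra. }
  assert (0 <= eps * INR J)%R by (apply Rmult_le_pos; [lra|apply pos_INR]). nra.
Qed.

Lemma has_mean_conj (f : R -> C) (mu : C) :
  has_mean f mu -> has_mean (fun t => Cconj (f t)) (Cconj mu).
Proof.
  intros [t1 [H1 Hf]]. exists t1. split; [exact H1|]. intros tau Ht T eps He.
  destruct (Hf tau Ht T eps He) as [J1 HJ1]. exists J1. intros J HJ.
  rewrite <- Csum_conj, <- Cmod_conj, Cminus_conj, Cconj_conj, Cmult_conj, Cconj_conj.
  replace (Cconj (INR J)) with (RtoC (INR J)) by (apply injective_projections; simpl; ring).
  now apply HJ1.
Qed.

Lemma Cexp_i_neq_1 (x : R) : x <> 0%R -> (Rabs x < 2 * PI)%R -> Cexp (0%R, x) <> 1.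
Proof.
  intros H0 Hx E. unfold Cexp, Re, Im in E; simpl in E. rewrite exp_0 in E.
  assert (Ec : cos x = 1%R) by (apply (f_equal fst) in E; simpl in E; lra).
  replace x with (2 * (x / 2))%R in Ec by field. rewrite cos_2a_sin in Ec.
  assert (Es : sin (x / 2) = 0%R) by nra.
  assert (Hpi := PI_RGT_0). apply Rabs_lt_between in Hx.
  destruct (Rtotal_order x 0) as [H|[H|H]]; [|contradiction|].
  - assert (H1 := sin_gt_0 (- (x / 2)) ltac:(lra) ltac:(lra)). rewrite sin_neg in H1. lra.
  - assert (H1 := sin_gt_0 (x / 2) ltac:(lra) ltac:(lra)). lra.
Qed.

Lemma Csum_geom (z : C) (n : nat) : (1 - z) * Csum (fun j => Cpow z j) n = 1 - Cpow z n.
Proof.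
  induction n as [|n IH]; [simpl; ring|].
  simpl Csum. rewrite Cmult_plus_distr_l, IH, Cpow_S. ring.
Qed.

Lemma Cmod_Cexp_i (x : R) : Cmod (Cexp (0%R, x)) = 1%R.
Proof. rewrite Cmod_Cexp. apply exp_0. Qed.

(** Sampling gives a geometric sum, bounded by [2 / |1 - z|] whatever its length. The bound
    [2 PI / |lam|] on the step ensures [z <> 1]. *)
Lemma has_mean_char (lam : R) : lam <> 0%R -> has_mean (fun t => Cexp (0, lam * t)%R) 0.
Proof.
  intros Hl. assert (Hla := Rabs_pos_lt lam Hl). assert (Hpi := PI_RGT_0).
  exists (2 * PI / Rabs lam)%R. split; [apply Rdiv_lt_0_compat; lra|].
  intros tau [Ht0 Ht] T eps He.
  set (z := Cexp (0, lam * tau)%R).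
  assert (Hz : 1 - z <> 0).
  { intros E. apply (Cexp_i_neq_1 (lam * tau)%R).
    - apply Rmult_integral_contrapositive. lra.
    - rewrite Rabs_mult, (Rabs_pos_eq tau) by lra.
      apply Rmult_lt_compat_l with (r := Rabs lam) in Ht; [|exact Hla].
      replace (Rabs lam * (2 * PI / Rabs lam))%R with (2 * PI)%R in Ht by (field; lra). exact Ht.
    - change (z = 1). replace z with (1 - (1 - z)) by ring. rewrite E. ring. }
  assert (Hz1 : Cmod z = 1%R) by apply Cmod_Cexp_i.
  assert (Hm : (0 < Cmod (1 - z))%R) by now apply Cmod_gt_0.
  destruct (INR_unbounded (2 / Cmod (1 - z) / eps)%R) as [J0 HJ0].
  exists J0. intros J HJ.
  replace (INR J * 0) with (RtoC 0) by ring.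
  rewrite (Csum_ext _ (fun j => Cexp (0, lam * T)%R * Cpow z j)).
  2:{ intros j _. unfold z. rewrite <- Cexp_INR_mult, <- Cexp_plus. f_equal.
      apply injective_projections; simpl; ring. }
  rewrite Csum_mult_l.
  match goal with |- (Cmod ?b <= _)%R => match b with ?a - _ => replace b with a by ring end end.
  rewrite Cmod_mult, Cmod_Cexp_i, Rmult_1_l.
  assert (G := f_equal Cmod (Csum_geom z J)). rewrite Cmod_mult in G.
  assert (G1 : (Cmod (1 - Cpow z J) <= 2)%R).
  { eapply Rle_trans; [apply Cmod_triangle|].
    rewrite Cmod_opp, Cmod_pow, Hz1, pow1, Cmod_1. lra. }
  assert (HJ1 : (2 / Cmod (1 - z) / eps <= INR J)%R) by (apply le_INR in HJ; lra).
  apply Rmult_le_compat_r with (r := (eps * Cmod (1 - z))%R) in HJ1; [|nra].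
  replace (2 / Cmod (1 - z) / eps * (eps * Cmod (1 - z)))%R with 2%R in HJ1 by (field; lra).
  apply Rmult_le_reg_l with (Cmod (1 - z)); [exact Hm|].
  rewrite <- G in G1. apply Rle_trans with 2%R; [exact G1|nra].
Qed.

Lemma has_mean_pos (f : R -> R) (mu T : R) :
  has_mean (fun t => RtoC (f t)) mu -> (0 < mu)%R -> exists t, (T <= t)%R /\ (0 < f t)%R.
Proof.
  intros [tau0 [H0 H]] Hmu.
  destruct (H (tau0 / 2)%R ltac:(lra) T (mu / 2)%R ltac:(lra)) as [J0 HJ].
  specialize (HJ (S J0) ltac:(lia)).
  apply NNPP. intros Hn.
  assert (Hle : (Re (Csum (fun j => RtoC (f (T + INR j * (tau0 / 2))%R)) (S J0)) <= 0)%R).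
  { rewrite Re_Csum. apply Rle_trans with (Rsum (fun _ => 0%R) (S J0)).
    - apply Rsum_le. intros k _. simpl. apply Rnot_lt_le. intros Hlt. apply Hn.
      exists (T + INR k * (tau0 / 2))%R. split; [|exact Hlt].
      assert (Hk := pos_INR k). nra.
    - rewrite Rsum_const. lra. }
  assert (R1 := re_le_Cmod (Csum (fun j => RtoC (f (T + INR j * (tau0 / 2))%R)) (S J0) - INR (S J0) * mu)).
  set (A := Csum (fun j => RtoC (f (T + INR j * (tau0 / 2))%R)) (S J0)) in *.
  replace (Re (A - INR (S J0) * mu)) with (Re A - INR (S J0) * mu)%R in R1
    by (destruct A; unfold Re; simpl; ring).
  assert (HJ0 : (0 < INR (S J0))%R) by (apply lt_0_INR; lia).
  apply Rle_trans with (2 := HJ) in R1. apply Rabs_le_between in R1. nra.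
Qed.

(** * Kronecker's theorem for the logarithms of the primes *)

(* [n ^ (- i t)] *)
Definition ni (n : nat) (t : R) : C := Cexp (0, - (t * ln (INR n)))%R.

Lemma Cmod_ni (n : nat) (t : R) : Cmod (ni n t) = 1%R.
Proof. apply Cmod_Cexp_i. Qed.

Lemma ni_conj (n : nat) (t : R) : Cconj (ni n t) = ni n (- t).
Proof.
  unfold ni. rewrite <- Cexp_conj. f_equal. apply injective_projections; simpl; ring.
Qed.

Lemma ni_add (n : nat) (t u : R) : ni n (t + u) = ni n t * ni n u.
Proof.
  unfold ni. rewrite <- Cexp_plus. f_equal. apply injective_projections; simpl; ring.
Qed.

Lemma ni_1 (t : R) : ni 1 t = 1.
Proof.
  unfold ni. simpl. rewrite ln_1, Rmult_0_r, Ropp_0. exact Cexp_0.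
Qed.

Lemma ni_mult (n m : nat) (t : R) : (1 <= n)%nat -> (1 <= m)%nat -> ni (n * m) t = ni n t * ni m t.
Proof.
  intros Hn Hm. unfold ni. rewrite <- Cexp_plus, mult_INR, ln_mult by (apply lt_0_INR; lia).
  f_equal. apply injective_projections; simpl; ring.
Qed.

Lemma ni_pow (n k : nat) (t : R) : (1 <= n)%nat -> ni (n ^ k) t = Cpow (ni n t) k.
Proof.
  intros Hn. induction k as [|k IH]; [apply ni_1|].
  simpl Nat.pow. rewrite ni_mult, IH; [reflexivity|exact Hn|].
  assert (H := Nat.pow_nonzero n k). lia.
Qed.

(** Orthogonality holds because distinct integers have distinct logarithms; the independence of the
    logarithms of the primes enters later, as unique factorization. *)
Lemma has_mean_ni_conj_ni (n m : nat) :
  (1 <= n)%nat -> (1 <= m)%nat -> n <> m -> has_mean (fun t => ni n t * Cconj (ni m t)) 0.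
Proof.
  intros Hn Hm Hnm.
  apply has_mean_ext with (fun t => Cexp (0, (ln (INR m) - ln (INR n)) * t)%R).
  - intros t. rewrite ni_conj. unfold ni. rewrite <- Cexp_plus. f_equal.
    apply injective_projections; simpl; ring.
  - apply has_mean_char. intros E. apply Hnm. apply INR_eq.
    apply ln_inv; [apply lt_0_INR; lia|apply lt_0_INR; lia|lra].
Qed.

(** A list of pairs encodes the Dirichlet polynomial [sum c n^(-it)], repeated integers being
    allowed. Keeping lists unmerged makes the companion [N2] multiplicative on products by pure
    computation. *)
Definition ev (l : list (C * nat)) (t : R) : C :=
  fold_right (fun cn s => fst cn * ni (snd cn) t + s) 0 l.

Definition N2 (l : list (C * nat)) : R :=
  fold_right (fun cn s => Cmod (fst cn) ^ 2 + s)%R 0%R l.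

Lemma has_mean_cross (c : C) (n : nat) (l : list (C * nat)) :
  (1 <= n)%nat -> (forall m, In m (map snd l) -> (1 <= m)%nat /\ m <> n) ->
  has_mean (fun t => c * ni n t * Cconj (ev l t)) 0.
Proof.
  intros Hn. induction l as [|[d m] l IH]; intros H.
  - apply has_mean_ext with (fun _ => 0); [|apply has_mean_const].
    intros t. apply injective_projections; simpl; ring.
  - apply has_mean_ext with (fun t => (c * Cconj d) * (ni n t * Cconj (ni m t)) + c * ni n t * Cconj (ev l t)).
    + intros t. simpl. rewrite Cplus_conj, Cmult_conj. ring.
    + replace (RtoC 0) with ((c * Cconj d) * 0 + 0) by ring.
      apply has_mean_plus.
      * apply has_mean_scal. destruct (H m (or_introl eq_refl)). apply has_mean_ni_conj_ni; auto.
      * apply IH. intros k Hk. apply H. now right.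
Qed.

(** Parseval's identity: the cross terms between different integers have mean 0, which is where
    [NoDup] enters. *)
Lemma has_mean_sq (l : list (C * nat)) :
  NoDup (map snd l) -> (forall m, In m (map snd l) -> (1 <= m)%nat) ->
  has_mean (fun t => RtoC (Cmod (ev l t) ^ 2)) (N2 l).
Proof.
  induction l as [|[c n] l IH]; intros Hnd H1.
  - apply has_mean_ext with (fun _ => 0); [|apply has_mean_const].
    intros t. simpl. now rewrite Cmod_0, Rmult_0_l.
  - simpl in Hnd. inversion Hnd as [|? ? Hni Hnd']; subst.
    assert (Hx : has_mean (fun t => c * ni n t * Cconj (ev l t)) 0).
    { apply has_mean_cross; [apply H1; now left|]. intros m Hm. split; [apply H1; now right|].
      intros ->. contradiction. }
    apply has_mean_ext with (fun t => RtoC (Cmod c ^ 2) + RtoC (Cmod (ev l t) ^ 2) +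
      (c * ni n t * Cconj (ev l t) + Cconj (c * ni n t * Cconj (ev l t)))).
    + intros t. rewrite !Cmod2_conj. simpl.
      rewrite Cplus_conj, !Cmult_conj, Cconj_conj.
      assert (E : ni n t * Cconj (ni n t) = 1) by (rewrite <- Cmod2_conj, Cmod_ni; f_equal; ring).
      replace (c * Cconj c) with (c * Cconj c * (ni n t * Cconj (ni n t))) by (rewrite E; ring).
      ring.
    + simpl. rewrite RtoC_plus.
      replace (RtoC (Cmod c * (Cmod c * 1)) + N2 l) with
        (RtoC (Cmod c ^ 2) + N2 l + (0 + Cconj 0))
        by (simpl; apply injective_projections; simpl; ring).
      apply has_mean_plus; [apply has_mean_plus|apply has_mean_plus].
      * apply has_mean_const.
      * apply IH; [exact Hnd'|]. intros m Hm. apply H1. now right.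
      * exact Hx.
      * now apply has_mean_conj.
Qed.

(** The expanded product, over the primes [p] in the list, of the polynomials [P p] (pairs of
    coefficient and exponent) evaluated at [p^(-it)]; there is one entry for each choice of a term
    from every factor. *)
Fixpoint plist (P : nat -> list (C * nat)) (ps : list nat) : list (C * nat) :=
  match ps with
  | nil => (RtoC 1, 1%nat) :: nil
  | p :: ps' => flat_map (fun ca =>
      map (fun cn => (fst ca * fst cn, (Nat.pow p (snd ca) * snd cn)%nat)) (plist P ps')) (P p)
  end.

Definition ev1 (l : list (C * nat)) (x : C) : C :=
  fold_right (fun ca s => fst ca * Cpow x (snd ca) + s) 0 l.

Lemma prime_nat_ge2 (p : nat) : prime (Z.of_nat p) -> (2 <= p)%nat.
Proof. intros H. apply prime_ge_2 in H. lia. Qed.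

Lemma prime_divide_pow_mult (q p a n : nat) :
  prime (Z.of_nat q) -> prime (Z.of_nat p) ->
  (Z.of_nat q | Z.of_nat (p ^ a * n))%Z -> q = p \/ (Z.of_nat q | Z.of_nat n)%Z.
Proof.
  intros Hq Hp. induction a as [|a IH]; intros H.
  - right. now rewrite Nat.pow_0_r, Nat.mul_1_l in H.
  - rewrite Nat.pow_succ_r', <- Nat.mul_assoc, Nat2Z.inj_mul in H.
    apply prime_mult in H; [|exact Hq]. destruct H as [H|H]; [|auto].
    left. apply Nat2Z.inj. now apply prime_div_prime.
Qed.

Lemma plist_support (P : nat -> list (C * nat)) (ps : list nat) (n : nat) :
  (forall p, In p ps -> prime (Z.of_nat p)) -> In n (map snd (plist P ps)) ->
  (1 <= n)%nat /\ forall q, prime (Z.of_nat q) -> ~ In q ps -> ~ (Z.of_nat q | Z.of_nat n)%Z.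
Proof.
  revert n. induction ps as [|p ps IH]; intros n Hp Hn.
  - simpl in Hn. destruct Hn as [<-|[]]. split; [lia|]. intros q Hq _ Hd.
    apply prime_ge_2 in Hq. apply Z.divide_1_r_nonneg in Hd; simpl in *; lia.
  - apply in_map_iff in Hn. destruct Hn as [[c n'] [E Hin]]. simpl in E. subst n'.
    simpl in Hin. apply in_flat_map in Hin. destruct Hin as [[d a] [_ Hin]].
    apply in_map_iff in Hin. destruct Hin as [[e m] [E Hin]]. simpl in E. inversion E; subst.
    destruct (IH m) as [Hm1 Hm2].
    { intros q Hq. apply Hp. now right. }
    { apply in_map_iff. now exists (e, m). }
    assert (Hpp : prime (Z.of_nat p)) by (apply Hp; now left).
    split.
    + assert (H2 := prime_nat_ge2 p Hpp). assert (H3 := Nat.pow_nonzero p a). nia.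
    + intros q Hq Hni Hd. apply prime_divide_pow_mult in Hd; [|exact Hq|exact Hpp].
      destruct Hd as [->|Hd]; [apply Hni; now left|].
      apply (Hm2 q Hq); [|exact Hd]. intros Hin'. apply Hni. now right.
Qed.

Lemma prime_pow_mult_inj (p a b n m : nat) :
  prime (Z.of_nat p) -> ~ (Z.of_nat p | Z.of_nat n)%Z -> ~ (Z.of_nat p | Z.of_nat m)%Z ->
  (p ^ a * n = p ^ b * m)%nat -> a = b /\ n = m.
Proof.
  intros Hp. assert (Hp2 := prime_nat_ge2 p Hp).
  revert b n m. induction a as [|a IH]; intros b n m Hn Hm E.
  - destruct b as [|b]; [simpl in E; lia|]. exfalso. apply Hn.
    exists (Z.of_nat (p ^ b * m)). rewrite <- Nat2Z.inj_mul. f_equal. simpl in E. lia.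
  - destruct b as [|b].
    + exfalso. apply Hm. exists (Z.of_nat (p ^ a * n)). rewrite <- Nat2Z.inj_mul. f_equal. simpl in E. lia.
    + destruct (IH b n m Hn Hm) as [-> ->]; [|auto].
      rewrite !Nat.pow_succ_r', <- !Nat.mul_assoc in E. apply Nat.mul_cancel_l in E; lia.
Qed.

(** Unique factorization: the integers built from the other primes are prime to [p], so the exponent
    of [p] and the cofactor can both be read off. *)
Lemma plist_NoDup (P : nat -> list (C * nat)) (ps : list nat) :
  (forall p, In p ps -> prime (Z.of_nat p)) -> NoDup ps ->
  (forall p, NoDup (map snd (P p))) -> NoDup (map snd (plist P ps)).
Proof.
  intros Hp Hnd HP. induction ps as [|p ps IH]; [simpl; repeat constructor; auto|].
  inversion Hnd as [|? ? Hni Hnd']; subst.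
  assert (Hpp : prime (Z.of_nat p)) by (apply Hp; now left).
  assert (Hps : forall q, In q ps -> prime (Z.of_nat q)) by (intros q Hq; apply Hp; now right).
  specialize (IH Hps Hnd').
  assert (Hcop : forall n, In n (map snd (plist P ps)) -> ~ (Z.of_nat p | Z.of_nat n)%Z)
    by (intros n Hn; now apply (plist_support P ps n Hps Hn)).
  simpl. specialize (HP p). induction (P p) as [|[c a] L IHL]; [constructor|].
  simpl in HP. inversion HP as [|? ? Hna HP']; subst. simpl.
  rewrite map_app, map_map. simpl.
  rewrite <- (map_map snd (fun n => (p ^ a * n)%nat)).
  apply NoDup_app.
  - apply Injective_map_NoDup; [|exact IH]. intros n m E.
    assert (H3 := Nat.pow_nonzero p a). assert (H2 := prime_nat_ge2 p Hpp).
    apply Nat.mul_cancel_l in E; lia.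
  - now apply IHL.
  - intros k Hk1 Hk2. apply in_map_iff in Hk1. destruct Hk1 as [n [En Hn]].
    apply in_map_iff in Hk2. destruct Hk2 as [[d k'] [Ek Hk2]]. simpl in Ek. subst k'.
    apply in_flat_map in Hk2. destruct Hk2 as [[d' b] [Hb Hk2]].
    apply in_map_iff in Hk2. destruct Hk2 as [[e m] [E Hm]]. simpl in E. inversion E; subst.
    destruct (prime_pow_mult_inj p a b n m Hpp (Hcop n Hn)) as [Eab _]; [|congruence|].
    + apply Hcop. apply in_map_iff. now exists (e, m).
    + apply Hna. subst b. apply in_map_iff. now exists (d', a).
Qed.

Lemma ev_app (l1 l2 : list (C * nat)) (t : R) : ev (l1 ++ l2) t = ev l1 t + ev l2 t.
Proof. induction l1 as [|[c n] l IH]; simpl; [ring|]. rewrite IH. ring. Qed.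

Lemma N2_app (l1 l2 : list (C * nat)) : N2 (l1 ++ l2) = (N2 l1 + N2 l2)%R.
Proof. induction l1 as [|[c n] l IH]; simpl; [ring|]. rewrite IH. ring. Qed.

Lemma ev_plist_cons (P : nat -> list (C * nat)) (p : nat) (ps : list nat) (t : R) :
  (forall q, In q (p :: ps) -> prime (Z.of_nat q)) ->
  ev (plist P (p :: ps)) t = ev1 (P p) (ni p t) * ev (plist P ps) t.
Proof.
  intros Hp.
  assert (Hp2 : (2 <= p)%nat) by (apply prime_nat_ge2, Hp; now left).
  assert (Hs : forall n, In n (map snd (plist P ps)) -> (1 <= n)%nat)
    by (intros n Hn; eapply plist_support; [|exact Hn]; intros q Hq; apply Hp; now right).
  simpl. induction (P p) as [|[c a] L IH]; [simpl; ring|].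
  simpl. rewrite ev_app, IH.
  enough (E : ev (map (fun cn => (c * fst cn, (p ^ a * snd cn)%nat)) (plist P ps)) t
     = c * Cpow (ni p t) a * ev (plist P ps) t) by (rewrite E; ring).
  clear IH. induction (plist P ps) as [|[d n] l IHl]; [simpl; ring|].
  simpl. rewrite IHl by (intros m Hm; apply Hs; now right).
  rewrite ni_mult, ni_pow; [ring|lia| |apply Hs; now left].
  assert (H3 := Nat.pow_nonzero p a). lia.
Qed.

Lemma N2_plist_cons (P : nat -> list (C * nat)) (p : nat) (ps : list nat) :
  N2 (plist P (p :: ps)) = (N2 (P p) * N2 (plist P ps))%R.
Proof.
  simpl. induction (P p) as [|[c a] L IH]; [simpl; ring|].
  simpl. rewrite N2_app, IH.
  enough (E : N2 (map (fun cn => (c * fst cn, (p ^ a * snd cn)%nat)) (plist P ps))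
     = (Cmod c ^ 2 * N2 (plist P ps))%R) by (rewrite E; simpl; ring).
  clear IH. induction (plist P ps) as [|[d n] l IHl]; [simpl; ring|].
  simpl. rewrite IHl, Cmod_mult. simpl. ring.
Qed.

Lemma plist_ext (P P' : nat -> list (C * nat)) (ps : list nat) :
  (forall p, In p ps -> P p = P' p) -> plist P ps = plist P' ps.
Proof.
  induction ps as [|p ps IH]; intros H; [reflexivity|].
  simpl. rewrite IH by (intros q Hq; apply H; now right). now rewrite (H p (or_introl eq_refl)).
Qed.

(* The coefficients of the geometric sum [1 + wx + ... + (wx)^(q-1)]. *)
Definition geom_poly (w : C) (q : nat) : list (C * nat) :=
  map (fun a => (Cpow w a, a)) (seq 0 q).

Lemma ev1_geom_poly (w x : C) (q : nat) :
  (1 - w * x) * ev1 (geom_poly w q) x = 1 - Cpow (w * x) q.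
Proof.
  assert (E : forall s, (1 - w * x) * ev1 (map (fun a => (Cpow w a, a)) (seq s q)) x
     = Cpow (w * x) s - Cpow (w * x) (s + q)).
  { induction q as [|q IH]; intros s; [simpl; rewrite Nat.add_0_r; ring|].
    simpl. rewrite Cmult_plus_distr_l, IH, <- Cpow_mult_l, Nat.add_succ_r.
    rewrite Nat.add_succ_l. rewrite !Cpow_S. ring. }
  exact (E 0%nat).
Qed.

Lemma N2_geom_poly (w : C) (q : nat) : Cmod w = 1%R -> N2 (geom_poly w q) = INR q.
Proof.
  intros Hw. unfold geom_poly. generalize 0%nat as s. induction q as [|q IH]; intros s; [reflexivity|].
  simpl map. simpl N2. rewrite IH, Cmod_pow, Hw, pow1. rewrite S_INR. ring.
Qed.

Lemma Rsum_list_le (l : list nat) (f : nat -> R) (p : nat) :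
  (forall q, (0 <= f q)%R) -> In p l -> (f p <= fold_right (fun q s => f q + s)%R 0%R l)%R.
Proof.
  intros Hf. assert (Hs : forall l', (0 <= fold_right (fun q s => f q + s)%R 0%R l')%R).
  { induction l' as [|q l' IH]; simpl; [lra|]. specialize (Hf q). lra. }
  induction l as [|q l IH]; [intros []|].
  intros [->|H]; simpl.
  - specialize (Hs l). lra.
  - specialize (IH H). specialize (Hf q). lra.
Qed.

(* Bohr's argument: with [w p = conj (z p)] and [D] the product of the sums
   [1 + ... + (w p p^(-it))^(q-1)], the mean square of [(1 - w p p^(-it)) D]
   is [2/q] times that of [D]. *)
Theorem kronecker_primes (ps : list nat) (z : nat -> C) (T eta : R) :
  (forall p, In p ps -> prime (Z.of_nat p)) -> NoDup ps ->
  (forall p, Cmod (z p) = 1%R) -> (0 < eta)%R ->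
  exists t, (T <= t)%R /\ forall p, In p ps -> (Cmod (ni p t - z p) < eta)%R.
Proof.
  intros Hp Hnd Hz He.
  set (r := INR (length ps)).
  (* The condition [eta^2 q > 2 r] makes [eta^2 - 2 r / q] positive, the decisive factor in the mean
     of [f] below. *)
  destruct (INR_unbounded (2 * r / eta ^ 2 + 1)%R) as [q Hq].
  assert (He2 : (0 < eta ^ 2)%R) by now apply pow_lt.
  assert (Hr : (0 <= r)%R) by apply pos_INR.
  assert (Hq1 : (1 < INR q)%R).
  { assert (0 <= 2 * r / eta ^ 2)%R by (apply Rdiv_le_0_compat; lra). lra. }
  assert (Hq0 : (0 < q)%nat) by (apply INR_lt; simpl; lra).
  assert (Hqr : (2 * r < eta ^ 2 * INR q)%R).
  { apply Rmult_lt_compat_l with (r := (eta ^ 2)%R) in Hq; [|exact He2].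
    replace (eta ^ 2 * (2 * r / eta ^ 2 + 1))%R with (2 * r + eta ^ 2)%R in Hq by (field; lra). lra. }
  set (w := fun p => Cconj (z p)).
  assert (Hw : forall p, Cmod (w p) = 1%R) by (intros p; unfold w; now rewrite Cmod_conj).
  set (P0 := fun p => geom_poly (w p) q).
  (* Multiplying the geometric sum by [1 - w x] leaves [1 - (w x)^q]: two coefficients of modulus 1
     instead of [q], hence the ratio [2 / q] of mean squares. *)
  set (Q := fun p => (RtoC 1, 0%nat) :: (- Cpow (w p) q, q) :: nil).
  set (P1 := fun p0 p => if Nat.eq_dec p p0 then Q p else P0 p).
  assert (HP0 : forall p, NoDup (map snd (P0 p))).
  { intros p. unfold P0, geom_poly. rewrite map_map, map_id. apply seq_NoDup. }
  assert (HP1 : forall p0 p, NoDup (map snd (P1 p0 p))).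
  { intros p0 p. unfold P1. destruct Nat.eq_dec; [|apply HP0]. simpl.
    constructor; [simpl; intros [H|[]]; lia|]. constructor; [intros []|constructor]. }
  assert (HN0 : (0 < N2 (plist P0 ps))%R).
  { clear - Hw Hq1. induction ps as [|p ps IH]; [simpl; rewrite Cmod_1; lra|].
    rewrite N2_plist_cons. apply Rmult_lt_0_compat; [|exact IH].
    unfold P0. rewrite N2_geom_poly by apply Hw. lra. }
  assert (HQ : forall p t, ev1 (Q p) (ni p t) = (1 - w p * ni p t) * ev1 (P0 p) (ni p t)).
  { intros p t. unfold P0. rewrite ev1_geom_poly. unfold Q. simpl. rewrite Cpow_mult_l. ring. }
  assert (HNQ : forall p, N2 (Q p) = 2%R).
  { intros p. unfold Q. simpl. rewrite Cmod_opp, Cmod_pow, Hw, pow1, Cmod_1. ring. }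
  assert (HE : forall ps', (forall p, In p ps' -> prime (Z.of_nat p)) -> NoDup ps' ->
     forall p0, In p0 ps' ->
     (forall t, ev (plist (P1 p0) ps') t = (1 - w p0 * ni p0 t) * ev (plist P0 ps') t) /\
     (INR q * N2 (plist (P1 p0) ps') = 2 * N2 (plist P0 ps'))%R).
  { induction ps' as [|p ps' IH]; intros Hp' Hnd' p0 Hin; [destruct Hin|].
    inversion Hnd' as [|? ? Hni Hnd'']; subst.
    destruct (Nat.eq_dec p p0) as [->|Hne].
    - assert (Eext : plist (P1 p0) ps' = plist P0 ps').
      { apply plist_ext. intros p Hp1. unfold P1. destruct Nat.eq_dec; [|reflexivity].
        subst. contradiction. }
      split.
      + intros t. rewrite !ev_plist_cons by assumption. rewrite Eext.
        unfold P1 at 1. destruct Nat.eq_dec; [|contradiction]. rewrite HQ. ring.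
      + rewrite !N2_plist_cons, Eext. unfold P1 at 1. destruct Nat.eq_dec; [|contradiction].
        rewrite HNQ. unfold P0 at 2. rewrite N2_geom_poly by apply Hw. ring.
    - destruct Hin as [->|Hin]; [contradiction|].
      destruct (IH ltac:(intros q' Hq'; apply Hp'; now right) Hnd'' p0 Hin) as [I1 I2].
      assert (E1 : P1 p0 p = P0 p) by (unfold P1; destruct Nat.eq_dec; [contradiction|reflexivity]).
      split.
      + intros t. rewrite !ev_plist_cons by assumption. rewrite I1, E1. ring.
      + rewrite !N2_plist_cons, E1.
        replace (INR q * (N2 (P0 p) * N2 (plist (P1 p0) ps')))%R with
          (N2 (P0 p) * (INR q * N2 (plist (P1 p0) ps')))%R by ring. rewrite I2. ring. }
  (* One function serves all primes at once: where it is positive, each [|1 - w p p^(-it)|^2 |D|^2]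
     is below [eta^2 |D|^2], and [D] cannot vanish. *)
  set (f := fun t => (eta ^ 2 * Cmod (ev (plist P0 ps) t) ^ 2
     - fold_right (fun p s => Cmod (ev (plist (P1 p) ps) t) ^ 2 + s) 0 ps)%R).
  assert (Hge1 : forall P' n, In n (map snd (plist P' ps)) -> (1 <= n)%nat)
    by (intros P' n Hn; eapply plist_support; [exact Hp|exact Hn]).
  assert (Hmean : has_mean (fun t => RtoC (f t)) (RtoC (N2 (plist P0 ps) * (eta ^ 2 - 2 * r / INR q))%R)).
  { assert (Hpart : forall l, (forall p, In p l -> In p ps) ->
      has_mean (fun t => RtoC (fold_right (fun p s => Cmod (ev (plist (P1 p) ps) t) ^ 2 + s)%R 0%R l))
        (RtoC (INR (length l) * (2 * N2 (plist P0 ps) / INR q))%R)).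
    { induction l as [|p l IH]; intros Hl.
      - simpl. rewrite Rmult_0_l. apply has_mean_const.
      - simpl fold_right. change (length (p :: l)) with (S (length l)). rewrite S_INR.
        replace ((INR (length l) + 1) * (2 * N2 (plist P0 ps) / INR q))%R with
          (N2 (plist (P1 p) ps) + INR (length l) * (2 * N2 (plist P0 ps) / INR q))%R.
        + rewrite RtoC_plus.
          apply has_mean_ext with (fun t => RtoC (Cmod (ev (plist (P1 p) ps) t) ^ 2) +
            RtoC (fold_right (fun p s => Cmod (ev (plist (P1 p) ps) t) ^ 2 + s)%R 0%R l)).
          * intros t. now rewrite <- RtoC_plus.
          * apply has_mean_plus.
            -- apply has_mean_sq; [now apply plist_NoDup|apply Hge1].
            -- apply IH. intros p' Hp'. apply Hl. now right.
        + destruct (HE ps Hp Hnd p (Hl p (or_introl eq_refl))) as [_ E2].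
          rewrite <- E2. field. lra. }
    apply has_mean_ext with (fun t => RtoC (eta ^ 2) * RtoC (Cmod (ev (plist P0 ps) t) ^ 2) +
      - (1) * RtoC (fold_right (fun p s => Cmod (ev (plist (P1 p) ps) t) ^ 2 + s)%R 0%R ps)).
    - intros t. unfold f. rewrite RtoC_minus, RtoC_mult. ring.
    - replace (RtoC (N2 (plist P0 ps) * (eta ^ 2 - 2 * r / INR q))%R) with
        (RtoC (eta ^ 2) * RtoC (N2 (plist P0 ps)) + - (1) * RtoC (INR (length ps) * (2 * N2 (plist P0 ps) / INR q))%R).
      + apply has_mean_plus; apply has_mean_scal.
        * apply has_mean_sq; [now apply plist_NoDup|apply Hge1].
        * now apply Hpart.
      + fold r. apply injective_projections; simpl; [field; lra|ring]. }
  destruct (has_mean_pos f _ T Hmean) as [t [HT Ht]].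
  { apply Rmult_lt_0_compat; [exact HN0|].
    apply Rmult_lt_reg_r with (INR q); [lra|].
    replace ((eta ^ 2 - 2 * r / INR q) * INR q)%R with (eta ^ 2 * INR q - 2 * r)%R by (field; lra). lra. }
  exists t. split; [exact HT|]. intros p Hin.
  unfold f in Ht.
  assert (Hle := Rsum_list_le ps (fun p => Cmod (ev (plist (P1 p) ps) t) ^ 2)%R p
    ltac:(intros; apply pow2_ge_0) Hin). simpl in Hle.
  destruct (HE ps Hp Hnd p Hin) as [E1 _].
  rewrite E1, Cmod_mult in Hle.
  set (D := Cmod (ev (plist P0 ps) t)) in *.
  assert (HD : (0 <= D)%R) by apply Cmod_ge_0.
  assert (Ez : ni p t - z p = - z p * (1 - w p * ni p t)).
  { assert (E : z p * w p = 1) by (unfold w; rewrite <- Cmod2_conj, Hz; f_equal; ring).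
    replace (- z p * (1 - w p * ni p t)) with ((z p * w p) * ni p t - z p) by ring. rewrite E. ring. }
  rewrite Ez, Cmod_mult, Cmod_opp, Hz, Rmult_1_l.
  set (x := Cmod (1 - w p * ni p t)) in *.
  apply Rnot_le_lt. intros Hx.
  assert (eta ^ 2 <= x ^ 2)%R by (apply pow_incr; lra).
  assert (0 <= D ^ 2)%R by apply pow2_ge_0.
  simpl in *. nra.
Qed.

(** * Prime powers *)

(* Junk values unless [prime_power n]. *)
Definition pbase (n : nat) : nat :=
  epsilon (inhabits O) (fun p => exists k, prime (Z.of_nat p) /\ (1 <= k)%nat /\ n = Nat.pow p k).

Definition pexp (n : nat) : nat :=
  epsilon (inhabits O) (fun k => (1 <= k)%nat /\ n = Nat.pow (pbase n) k).

Lemma prime_power_spec (n : nat) : prime_power n ->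
  prime (Z.of_nat (pbase n)) /\ (1 <= pexp n)%nat /\ n = Nat.pow (pbase n) (pexp n).
Proof.
  intros H.
  assert (H1 : exists k, prime (Z.of_nat (pbase n)) /\ (1 <= k)%nat /\ n = Nat.pow (pbase n) k)
    by exact (epsilon_spec (inhabits O) (fun p => exists k, prime (Z.of_nat p) /\ (1 <= k)%nat /\ n = Nat.pow p k) H).
  destruct H1 as [k [Hp Hk]]. split; [exact Hp|].
  exact (epsilon_spec (inhabits O) (fun k => (1 <= k)%nat /\ n = Nat.pow (pbase n) k) (ex_intro _ k Hk)).
Qed.

Lemma pbase_le (n : nat) : prime_power n -> (pbase n <= n)%nat.
Proof.
  intros H. destruct (prime_power_spec n H) as (Hp & Hk & E). apply prime_nat_ge2 in Hp.
  rewrite E at 2. rewrite <- (Nat.pow_1_r (pbase n)) at 1. apply Nat.pow_le_mono_r; lia.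
Qed.

Lemma pexp_lt (n : nat) : prime_power n -> (pexp n < n)%nat.
Proof.
  intros H. destruct (prime_power_spec n H) as (Hp & Hk & E). apply prime_nat_ge2 in Hp.
  rewrite E at 2. apply Nat.pow_gt_lin_r. lia.
Qed.

(** * Partial sums of Dirichlet series *)

Lemma Cmod_Rcpow (x : R) (s : C) : Cmod (Rcpow x s) = Rpower x (Re s).
Proof.
  unfold Rcpow, Rpower. rewrite Cmod_Cexp. f_equal.
  destruct s; unfold Re; simpl; ring.
Qed.

Lemma Rcpow_plus (x : R) (s w : C) : Rcpow x (s + w) = Rcpow x s * Rcpow x w.
Proof. unfold Rcpow. rewrite <- Cexp_plus. f_equal. ring. Qed.

Lemma Rcpow_opp_shift (n : nat) (s : C) (t : R) :
  Rcpow (INR n) (- (s + (0%R, t))) = Rcpow (INR n) (- s) * ni n t.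
Proof.
  replace (- (s + (0%R, t))) with (- s + (0, - t)%R)
    by (apply injective_projections; simpl; ring).
  rewrite Rcpow_plus. f_equal. unfold ni, Rcpow. f_equal.
  apply injective_projections; simpl; ring.
Qed.

Definition dsum (a : nat -> C) (s : C) (X : nat) : C := Csum (dirichlet_term a s) X.

Lemma Cmod_dirichlet_term (a : nat -> C) (s : C) (k : nat) :
  Cmod (dirichlet_term a s k) = (Cmod (a (S k)) * Rpower (INR (S k)) (- Re s))%R.
Proof.
  unfold dirichlet_term. rewrite Cmod_mult, Cmod_Rcpow. do 2 f_equal.
Qed.

Lemma Rpower_pos (x y : R) : (0 < Rpower x y)%R.
Proof. apply exp_pos. Qed.

Lemma Rpower_INR_le (n : nat) (x y : R) :
  (x <= y)%R -> (Rpower (INR (S n)) x <= Rpower (INR (S n)) y)%R.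
Proof.
  intros H. apply Rle_Rpower; [|exact H].
  rewrite S_INR. assert (H1 := pos_INR n). lra.
Qed.

Lemma holo_Rcpow (x : R) (z : C) : holo (fun s => Rcpow x (- s)) z.
Proof.
  unfold Rcpow. apply (holo_comp Cexp (fun s => - s * RtoC (ln x))); [|apply holo_Cexp].
  apply holo_mult; [apply holo_opp, holo_id|apply holo_const].
Qed.

Lemma holo_Csum (f : nat -> C -> C) (n : nat) (z : C) :
  (forall k, holo (f k) z) -> holo (fun s => Csum (fun k => f k s) n) z.
Proof.
  intros H. induction n as [|n IH]; simpl; [apply holo_const|now apply holo_plus].
Qed.

Lemma holo_Cprod (f : nat -> C -> C) (n : nat) (z : C) :
  (forall k, holo (f k) z) -> holo (fun s => Cprod (fun k => f k s) n) z.
Proof.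
  intros H. induction n as [|n IH]; simpl; [apply holo_const|now apply holo_mult].
Qed.

Lemma holo_dsum (a : nat -> C) (X : nat) (z : C) : holo (fun s => dsum a s X) z.
Proof.
  apply (holo_Csum (fun k s => dirichlet_term a s k)). intros k. unfold dirichlet_term.
  apply holo_mult; [apply holo_const|apply holo_Rcpow].
Qed.

Lemma Cmod_dsum_le (a : nat -> C) (s : C) (x : R) (X : nat) :
  (x <= Re s)%R ->
  (Cmod (dsum a s X) <= Rsum (fun k => Cmod (a (S k)) * Rpower (INR (S k)) (- x)) X)%R.
Proof.
  intros Hs. eapply Rle_trans; [apply Cmod_Csum|]. apply Rsum_le. intros k _.
  rewrite Cmod_dirichlet_term. apply Rmult_le_compat_l; [apply Cmod_ge_0|].
  apply Rpower_INR_le. lra.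
Qed.

Lemma Rsum_inv_sq_tail (X Y : nat) : (1 <= X <= Y)%nat ->
  (Rsum (fun k => / INR (S k) ^ 2) Y - Rsum (fun k => / INR (S k) ^ 2) X <= / INR X - / INR Y)%R.
Proof.
  intros [H1 H]. induction H as [|Y H IH]; [lra|].
  rewrite Rsum_S. assert (HY : (0 < INR Y)%R) by (apply lt_0_INR; lia).
  assert (E : (/ INR (S Y) ^ 2 <= / INR Y - / INR (S Y))%R).
  { rewrite S_INR.
    apply Rmult_le_reg_r with (INR Y * (INR Y + 1) ^ 2)%R; [apply Rmult_lt_0_compat; [lra|apply pow_lt; lra]|].
    replace (/ (INR Y + 1) ^ 2 * (INR Y * (INR Y + 1) ^ 2))%R with (INR Y) by (field; lra).
    replace ((/ INR Y - / (INR Y + 1)) * (INR Y * (INR Y + 1) ^ 2))%R with (INR Y + 1)%R by (field; lra).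
    lra. }
  lra.
Qed.

Lemma Rsum_inv_sq_le (X : nat) : (Rsum (fun k => / INR (S k) ^ 2) X <= 2)%R.
Proof.
  destruct X as [|X]; [simpl; lra|].
  assert (H := Rsum_inv_sq_tail 1 (S X) ltac:(lia)).
  assert (H1 : (0 < / INR (S X))%R) by (apply Rinv_0_lt_compat, lt_0_INR; lia).
  assert (E : Rsum (fun k => / INR (S k) ^ 2)%R 1 = 1%R) by (simpl; field).
  rewrite E in H. simpl (INR 1) in H. rewrite Rinv_1 in H. lra.
Qed.

Lemma sum_n_Csum (u : nat -> C) (n : nat) :
  sum_n (G := C_AbelianMonoid) u n = Csum u (S n).
Proof.
  induction n as [|n IH].
  - rewrite sum_O. simpl. ring.
  - rewrite sum_Sn, IH. reflexivity.
Qed.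

Lemma is_series_C_tail (u : nat -> C) (l : C) (K : R) (X : nat) :
  (0 <= K)%R -> (1 <= X)%nat ->
  is_series (K := C_AbsRing) (V := C_NormedModule) u l ->
  (forall k, (Cmod (u k) <= K * / INR (S k) ^ 2)%R) ->
  (Cmod (l - Csum u X) <= K * / INR X)%R.
Proof.
  intros HK HX Hl Hu.
  assert (Hpart : forall Y, (X <= Y)%nat -> (Cmod (Csum u Y - Csum u X) <= K * / INR X)%R).
  { intros Y HY. apply Rle_trans with (K * (Rsum (fun k => / INR (S k) ^ 2) Y - Rsum (fun k => / INR (S k) ^ 2) X))%R.
    - induction HY as [|Y HY IH].
      + replace (Csum u X - Csum u X) with (RtoC 0) by ring. rewrite Cmod_0. lra.
      + rewrite Csum_S, Rsum_S. replace (Csum u Y + u Y - Csum u X) with ((Csum u Y - Csum u X) + u Y) by ring.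
        eapply Rle_trans; [apply Cmod_triangle|]. specialize (Hu Y). lra.
    - apply Rmult_le_compat_l; [exact HK|].
      assert (H := Rsum_inv_sq_tail X Y ltac:(lia)).
      assert (H1 : (0 < / INR Y)%R) by (apply Rinv_0_lt_compat, lt_0_INR; lia). lra. }
  apply Rnot_lt_le. intros Hlt.
  set (d := (Cmod (l - Csum u X) - K * / INR X)%R) in *.
  assert (Hd : (0 < d)%R) by (unfold d; lra).
  assert (Hloc : locally (T := C_UniformSpace) l (fun y => Cmod (y - l) < d)%R)
    by (apply locally_C_iff; exists d; auto).
  destruct (Hl _ Hloc) as [N HN].
  specialize (HN (max N X) (Nat.le_max_l _ _)). simpl in HN. rewrite sum_n_Csum in HN.
  specialize (Hpart (S (max N X)) ltac:(lia)).
  assert (T := Cmod_triangle (l - Csum u (S (max N X))) (Csum u (S (max N X)) - Csum u X)).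
  replace (l - Csum u (S (max N X)) + (Csum u (S (max N X)) - Csum u X)) with (l - Csum u X) in T by ring.
  rewrite (Cmod_sub_sym l (Csum u (S (max N X)))) in T. unfold d in HN. lra.
Qed.

(** The setting after multiplying out the possible pole at 1: two entire functions with the same
    quotient as [F] and [G]. At the abscissa 3 the condition [theta < 1/2] makes the terms of the
    logarithm smaller than a multiple of [1/n^2]. *)
Record log_ratio (HF HG : C -> C) (beta : nat -> C) (c : R) : Prop := {
  lr_holo_F : forall z, holo HF z;
  lr_holo_G : forall z, holo HG z;
  lr_c : (0 < c)%R;
  lr_le : forall s, (1 / 2 < Re s)%R -> (Cmod (HF s) <= c * Cmod (HG s))%R;
  lr_G : forall s, (3 <= Re s)%R -> HG s <> 0;
  lr_log : forall s, (3 <= Re s)%R -> exists L, is_dirichlet beta s L /\ HF s = Cexp L * HG s;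
  lr_support : forall n, (1 <= n)%nat -> ~ prime_power n -> beta n = 0;
  lr_beta : exists K theta : R, (0 < K)%R /\ (theta < 1 / 2)%R /\
    forall n, (1 <= n)%nat -> (Cmod (beta n) <= K * Rpower (INR n) theta)%R
}.

Lemma beta_term_le (beta : nat -> C) (K theta : R) (k : nat) (s : C) :
  (0 < K)%R -> (theta < 1 / 2)%R ->
  (forall n, (1 <= n)%nat -> (Cmod (beta n) <= K * Rpower (INR n) theta)%R) ->
  (3 <= Re s)%R -> (Cmod (beta (S k)) * Rpower (INR (S k)) (- Re s) <= K * / INR (S k) ^ 2)%R.
Proof.
  intros HK Ht Hb Hs. specialize (Hb (S k) ltac:(lia)).
  assert (Hp := Rpower_pos (INR (S k)) (- Re s)).
  apply Rle_trans with (K * Rpower (INR (S k)) theta * Rpower (INR (S k)) (- Re s))%R.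
  { apply Rmult_le_compat_r; lra. }
  rewrite Rmult_assoc, <- Rpower_plus. apply Rmult_le_compat_l; [lra|].
  rewrite <- (Rpower_pow 2) by (apply lt_0_INR; lia). rewrite <- Rpower_Ropp.
  apply Rpower_INR_le. simpl. lra.
Qed.

(** [K] is uniform in [s], hence in vertical translates, so one truncation length serves all of
    them. [L] is only some logarithm of the quotient at [s], close to the partial sum. *)
Lemma log_ratio_tail (HF HG : C -> C) (beta : nat -> C) (c : R) :
  log_ratio HF HG beta c -> exists K, (0 < K)%R /\
    (forall k s, (3 <= Re s)%R -> (Cmod (beta (S k)) * Rpower (INR (S k)) (- Re s) <= K * / INR (S k) ^ 2)%R) /\
    forall X s, (1 <= X)%nat -> (3 <= Re s)%R ->
      exists L, (Cmod (L - dsum beta s X) <= K * / INR X)%R /\ HF s = Cexp L * HG s.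
Proof.
  intros H. destruct (lr_beta _ _ _ _ H) as (K & theta & HK & Ht & Hb).
  exists K. split; [exact HK|].
  assert (Hterm : forall k s, (3 <= Re s)%R ->
    (Cmod (beta (S k)) * Rpower (INR (S k)) (- Re s) <= K * / INR (S k) ^ 2)%R)
    by (intros; eapply beta_term_le; eauto).
  split; [exact Hterm|].
  intros X s HX Hs. destruct (lr_log _ _ _ _ H s Hs) as [L [HL E]].
  exists L. split; [|exact E]. apply is_series_C_tail; auto; [lra|].
  intros k. rewrite Cmod_dirichlet_term. now apply Hterm.
Qed.

(* At a prime power [n], the sum of the values at [n] of the [m] completely
   multiplicative functions with values [zz j p] at the primes [p]. *)
Definition kappa (zz : nat -> nat -> C) (m n : nat) : C :=
  Csum (fun j => Cpow (zz j (pbase n)) (pexp n)) m.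

Lemma Cpow_sub_le (x y : C) (k : nat) :
  Cmod x = 1%R -> Cmod y = 1%R -> (Cmod (Cpow x k - Cpow y k) <= INR k * Cmod (x - y))%R.
Proof.
  intros Hx Hy. induction k as [|k IH].
  - simpl. replace (1 - 1) with (RtoC 0) by ring. rewrite Cmod_0. lra.
  - rewrite !Cpow_S, S_INR.
    replace (x * Cpow x k - y * Cpow y k) with (x * (Cpow x k - Cpow y k) + (x - y) * Cpow y k) by ring.
    eapply Rle_trans; [apply Cmod_triangle|].
    rewrite !Cmod_mult, Cmod_pow, Hx, Hy, pow1. lra.
Qed.

Lemma Cprod_mult (f g : nat -> C) (m : nat) :
  Cprod (fun j => f j * g j) m = Cprod f m * Cprod g m.
Proof. induction m as [|m IH]; simpl; [ring|]. rewrite IH. ring. Qed.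

Lemma Cprod_ext (f g : nat -> C) (m : nat) :
  (forall j, (j < m)%nat -> f j = g j) -> Cprod f m = Cprod g m.
Proof. induction m as [|m IH]; intros H; simpl; [easy|]. rewrite IH, H; auto. Qed.

Lemma Cprod_Cexp (f : nat -> C) (m : nat) : Cprod (fun j => Cexp (f j)) m = Cexp (Csum f m).
Proof. induction m as [|m IH]; simpl; [now rewrite Cexp_0|]. now rewrite IH, Cexp_plus. Qed.

Lemma Cprod_neq_0 (f : nat -> C) (m : nat) :
  (forall j, (j < m)%nat -> f j <> 0) -> Cprod f m <> 0.
Proof.
  induction m as [|m IH]; intros H; simpl.
  - apply C1_nz.
  - apply Cmult_neq_0; auto.
Qed.

Lemma Cmod_Cprod_le (f g : nat -> C) (c : R) (m : nat) :
  (0 <= c)%R -> (forall j, (Cmod (f j) <= c * Cmod (g j))%R) ->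
  (Cmod (Cprod f m) <= c ^ m * Cmod (Cprod g m))%R.
Proof.
  intros Hc H. induction m as [|m IH]; simpl.
  - rewrite Cmod_1. lra.
  - rewrite !Cmod_mult.
    replace (c * c ^ m * (Cmod (Cprod g m) * Cmod (g m)))%R with
      (c ^ m * Cmod (Cprod g m) * (c * Cmod (g m)))%R by ring.
    apply Rmult_le_compat; auto; apply Cmod_ge_0.
Qed.

(** Approximation at the primes up to [X] suffices: a [k]-th power multiplies the error by at most
    [k], and the exponent of a prime power up to [X] is below [X]. *)
Lemma kronecker_prime_powers (zz : nat -> C) (X : nat) (eta : R) :
  (forall p, Cmod (zz p) = 1%R) -> (0 < eta)%R ->
  exists t, forall n, (n <= X)%nat -> prime_power n ->
    (Cmod (ni n t - Cpow (zz (pbase n)) (pexp n)) <= INR X * eta)%R.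
Proof.
  intros Hz He.
  set (isp := fun p => if excluded_middle_informative (prime (Z.of_nat p)) then true else false).
  set (ps := filter isp (seq 0 (S X))).
  destruct (kronecker_primes ps zz 0 eta) as [t [_ Ht]]; auto.
  - intros p Hp. apply filter_In in Hp. destruct Hp as [_ Hp]. unfold isp in Hp.
    destruct excluded_middle_informative; [assumption|discriminate].
  - apply NoDup_filter, seq_NoDup.
  - exists t. intros n Hn Hpp. destruct (prime_power_spec n Hpp) as (Hp & Hk & E).
    assert (Hb := pbase_le n Hpp). assert (Hlt := pexp_lt n Hpp).
    assert (H2 := prime_nat_ge2 _ Hp).
    rewrite E at 1. rewrite ni_pow by lia.
    eapply Rle_trans; [apply Cpow_sub_le; [apply Cmod_ni|apply Hz]|].
    apply Rmult_le_compat; [apply pos_INR|apply Cmod_ge_0|apply le_INR; lia|].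
    left. apply Ht. apply filter_In. split; [apply in_seq; lia|].
    unfold isp. destruct excluded_middle_informative; [reflexivity|contradiction].
Qed.

(** The bound on [u] is asked only where [b] does not vanish, since Kronecker's theorem controls the
    translates at prime powers only. *)
Lemma Cmod_Csum_mult_le (b u : nat -> C) (M : R) (X : nat) :
  (0 <= M)%R -> (forall k, (k < X)%nat -> b k <> 0 -> (Cmod (u k) <= M)%R) ->
  (Cmod (Csum (fun k => b k * u k)%C X) <= M * Rsum (fun k => Cmod (b k)) X)%R.
Proof.
  intros HM H. eapply Rle_trans; [apply Cmod_Csum|]. rewrite <- Rsum_mult_l.
  apply Rsum_le. intros k Hk. rewrite Cmod_mult.
  destruct (classic (b k = 0)) as [E|E].
  - rewrite E, Cmod_0. lra.
  - rewrite Rmult_comm. apply Rmult_le_compat_r; [apply Cmod_ge_0|auto].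
Qed.

(* The product of [m] vertical translates of [HF / HG] is bounded by [c ^ m], and
   by Kronecker's theorem it is close to [exp (sum beta kappa n^-s)] far to the
   right, hence on the whole half plane by the two-constants theorem. *)
Theorem twisted_log_bound (HF HG : C -> C) (beta : nat -> C) (c : R)
    (zz : nat -> nat -> C) (m : nat) (B0 sigma eps : R) :
  log_ratio HF HG beta c -> (forall j p, Cmod (zz j p) = 1%R) ->
  (forall X, (Rsum (fun k => Cmod (beta (S k) * kappa zz m (S k)) * Rpower (INR (S k)) (- (1 / 2))) X <= B0)%R) ->
  (1 / 2 < sigma <= 3)%R -> (0 < eps)%R ->
  exists X0, forall X, (X0 <= X)%nat ->
    (Re (dsum (fun n => beta n * kappa zz m n)%C (RtoC sigma) X) <= INR m * ln c + eps)%R.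
Proof.
  intros HR Hz HB0 Hs He.
  assert (Hc := lr_c _ _ _ _ HR).
  assert (Hcm : (0 < c ^ m)%R) by now apply pow_lt.
  (* The discs are centred at 4: radius 1 stays in [Re s >= 3], radius [7/2] reaches the line
     [Re s = 1/2], and the disc of the intermediate radius [rho] contains [sigma] in its
     interior. *)
  set (rho := ((4 - sigma + 7 / 2) / 2)%R).
  assert (Hrho : (4 - sigma < rho < 7 / 2)%R) by (unfold rho; lra).
  set (B := (c ^ m + exp B0)%R). assert (HeB := exp_pos B0).
  assert (He1 : (1 < exp eps)%R) by (rewrite <- exp_0; apply exp_increasing; lra).
  (* Chosen so that [c^m + eta] is exactly [exp (m ln c + eps)]. *)
  set (eta := (c ^ m * (exp eps - 1))%R).
  assert (Heta : (0 < eta)%R) by (apply Rmult_lt_0_compat; lra).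
  destruct (two_constants 1 rho (7 / 2) B eta) as [e0 [He0 H2c]];
    [lra|lra|lra|unfold B; lra|exact Heta|].
  destruct (log_ratio_tail _ _ _ _ HR) as (K & HK & Hterm & Htail).
  set (delta := Rmin (1 / 2) (e0 / (3 * exp B0))).
  assert (Hdelta : (0 < delta)%R) by (apply Rmin_pos; [lra|apply Rdiv_lt_0_compat; lra]).
  destruct (INR_unbounded (2 * INR m * K / delta + 1)%R) as [X0 HX0].
  exists X0. intros X HX.
  assert (Hm := pos_INR m).
  assert (HXR : (2 * INR m * K / delta + 1 < INR X)%R) by (apply le_INR in HX; lra).
  assert (H0X : (0 <= 2 * INR m * K / delta)%R)
    by (apply Rdiv_le_0_compat; [apply Rmult_le_pos; lra|exact Hdelta]).
  assert (HX1 : (1 <= X)%nat) by (apply INR_le; simpl; lra).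
  (* Half of [delta] is allotted to the tails of the [m] series, half to Kronecker's approximation,
     whose total error is [m X nu] times a coefficient sum of at most [2 K]. *)
  set (nu := (delta / (4 * (INR m + 1) * K * INR X))%R).
  assert (Hnu : (0 < nu)%R).
  { apply Rdiv_lt_0_compat; [exact Hdelta|]. repeat apply Rmult_lt_0_compat; lra. }
  assert (Ht : forall j, exists t, forall n, (n <= X)%nat -> prime_power n ->
    (Cmod (ni n t - Cpow (zz j (pbase n)) (pexp n)) <= INR X * nu)%R)
    by (intros j; apply kronecker_prime_powers; auto).
  set (t := fun j => proj1_sig (constructive_indefinite_description _ (Ht j))).
  assert (Ht' : forall j n, (n <= X)%nat -> prime_power n ->
    (Cmod (ni n (t j) - Cpow (zz j (pbase n)) (pexp n)) <= INR X * nu)%R).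
  { intros j. unfold t. destruct constructive_indefinite_description; assumption. }
  clearbody t. clear Ht.
  set (a := fun n => beta n * kappa zz m n).
  set (num := fun s : C => Cprod (fun j => HF (s + (0%R, t j))%C) m).
  set (den := fun s : C => Cprod (fun j => HG (s + (0%R, t j))%C) m).
  set (ex := fun s : C => Cexp (dsum a s X)).
  assert (Hnum : forall z, holo num z).
  { intros z. apply (holo_Cprod (fun j s => HF (s + (0%R, t j))%C)). intros j.
    apply holo_shift, (lr_holo_F _ _ _ _ HR). }
  assert (Hden : forall z, holo den z).
  { intros z. apply (holo_Cprod (fun j s => HG (s + (0%R, t j))%C)). intros j.
    apply holo_shift, (lr_holo_G _ _ _ _ HR). }
  assert (Hex : forall z, holo ex z).
  { intros z. apply (holo_comp Cexp (fun s => dsum a s X)); [apply holo_dsum|apply holo_Cexp]. }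
  assert (HLam : forall s, (1 / 2 <= Re s)%R -> (Cmod (dsum a s X) <= B0)%R)
    by (intros s Hs'; eapply Rle_trans; [apply (Cmod_dsum_le a s (1 / 2)); exact Hs'|apply HB0]).
  assert (Hexb : forall s, (1 / 2 <= Re s)%R -> (Cmod (ex s) <= exp B0)%R).
  { intros s Hs'. now apply Cmod_Cexp_le, HLam. }
  assert (Hre : forall (s : C) (u : R), Re (s + (0%R, u)) = Re s)
    by (intros [x y] u; unfold Re; simpl; ring).
  assert (Hmain : forall z, (Cmod (z - RtoC 4) <= rho)%R ->
    (Cmod (num z - ex z * den z) <= eta * Cmod (den z))%R).
  { apply (H2c (fun z => num z - ex z * den z) den).
    - intros w _. split; [|apply Hden]. apply holo_minus; [apply Hnum|].
      apply holo_mult; [apply Hex|apply Hden].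
    - intros w Hw.
      assert (Hrw : (1 / 2 < Re w)%R).
      { assert (H1 := re_sub_abs_le w (RtoC 4)).
        apply Rle_lt_trans with (2 := Hw) in H1. apply Rabs_lt_between in H1. simpl in H1. lra. }
      eapply Rle_trans; [apply Cmod_triangle|]. rewrite Cmod_opp, Cmod_mult.
      unfold B. rewrite Rmult_plus_distr_r. apply Rplus_le_compat.
      + apply Cmod_Cprod_le; [lra|]. intros j. apply (lr_le _ _ _ _ HR). rewrite Hre. exact Hrw.
      + apply Rmult_le_compat_r; [apply Cmod_ge_0|]. apply Hexb. lra.
    - intros w Hw.
      assert (Hrw : (3 <= Re w)%R).
      { apply Re_ge_of_disc in Hw. lra. }
      assert (HL : forall j, exists L, (Cmod (L - dsum beta (w + (0%R, t j)) X) <= K * / INR X)%R /\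
         HF (w + (0%R, t j)) = Cexp L * HG (w + (0%R, t j))).
      { intros j. apply Htail; [exact HX1|]. rewrite Hre. exact Hrw. }
      set (L := fun j => proj1_sig (constructive_indefinite_description _ (HL j))).
      assert (HL' : forall j, (Cmod (L j - dsum beta (w + (0%R, t j)) X) <= K * / INR X)%R /\
         HF (w + (0%R, t j)) = Cexp (L j) * HG (w + (0%R, t j))).
      { intros j. unfold L. destruct constructive_indefinite_description; assumption. }
      clearbody L. clear HL.
      assert (En : num w = Cexp (Csum L m) * den w).
      { unfold num, den. rewrite <- Cprod_Cexp, <- Cprod_mult. apply Cprod_ext.
        intros j _. apply HL'. }
      rewrite En. replace (Cexp (Csum L m) * den w - ex w * den w)
        with ((Cexp (Csum L m) - ex w) * den w) by ring.
      rewrite Cmod_mult. apply Rmult_le_compat_r; [apply Cmod_ge_0|].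
      assert (Hdiff : (Cmod (Csum L m - dsum a w X) <= delta)%R).
      { replace (Csum L m - dsum a w X) with
          (Csum (fun j => L j - dsum beta (w + (0%R, t j)) X) m +
           (Csum (fun j => dsum beta (w + (0%R, t j)) X)%C m - dsum a w X)).
        2:{ rewrite Csum_minus. ring. }
        eapply Rle_trans; [apply Cmod_triangle|].
        assert (P1 : (Cmod (Csum (fun j => L j - dsum beta (w + (0%R, t j)) X)%C m) <= delta / 2)%R).
        { eapply Rle_trans; [apply Cmod_Csum|].
          apply Rle_trans with (Rsum (fun _ => K * / INR X)%R m).
          - apply Rsum_le. intros j _. apply HL'.
          - rewrite Rsum_const.
            apply Rmult_le_reg_r with (INR X * (2 / delta))%R;
              [apply Rmult_lt_0_compat; [lra|apply Rdiv_lt_0_compat; lra]|].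
            replace (INR m * (K * / INR X) * (INR X * (2 / delta)))%R with (2 * INR m * K / delta)%R by (field; lra).
            replace (delta / 2 * (INR X * (2 / delta)))%R with (INR X) by (field; lra). lra. }
        assert (P2 : (Cmod (Csum (fun j => dsum beta (w + (0%R, t j)) X)%C m - dsum a w X) <= delta / 2)%R).
        { unfold dsum. rewrite Csum_swap, <- Csum_minus.
          rewrite (Csum_ext _ (fun k => dirichlet_term beta w k *
             (Csum (fun j => ni (S k) (t j) - Cpow (zz j (pbase (S k))) (pexp (S k))) m))).
          2:{ intros k _. unfold a, kappa, dirichlet_term. rewrite Csum_minus.
              rewrite (Csum_ext (fun j => _ * Rcpow _ (- (w + _)))
                (fun j => beta (S k) * Rcpow (INR (S k)) (- w) * ni (S k) (t j)))
                by (intros j _; rewrite Rcpow_opp_shift; ring).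
              rewrite Csum_mult_l. ring. }
          eapply Rle_trans; [apply (Cmod_Csum_mult_le _ _ (INR m * (INR X * nu)))|].
          - apply Rmult_le_pos; [exact Hm|]. apply Rmult_le_pos; lra.
          - intros k Hk Hb. assert (Hpp : prime_power (S k)).
            { apply NNPP. intros Hn. apply Hb. unfold dirichlet_term.
              rewrite (lr_support _ _ _ _ HR); [ring|lia|exact Hn]. }
            eapply Rle_trans; [apply Cmod_Csum|]. rewrite <- Rsum_const. apply Rsum_le.
            intros j _. apply Ht'; [lia|exact Hpp].
          - assert (HS : (Rsum (fun k => Cmod (dirichlet_term beta w k)) X <= K * 2)%R).
            { eapply Rle_trans; [apply Rsum_le; intros k _; rewrite Cmod_dirichlet_term; apply Hterm; exact Hrw|].
              rewrite Rsum_mult_l. apply Rmult_le_compat_l; [lra|apply Rsum_inv_sq_le]. }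
            apply Rle_trans with (INR m * (INR X * nu) * (K * 2))%R.
            + apply Rmult_le_compat_l; [|exact HS].
              apply Rmult_le_pos; [exact Hm|]. apply Rmult_le_pos; lra.
            + unfold nu. replace (INR m * (INR X * (delta / (4 * (INR m + 1) * K * INR X))) * (K * 2))%R
                with (INR m / (INR m + 1) * (delta / 2))%R by (field; lra).
              assert (INR m / (INR m + 1) <= 1)%R.
              { apply Rmult_le_reg_r with (INR m + 1)%R; [lra|].
                unfold Rdiv. rewrite Rmult_assoc, Rinv_l; lra. }
              nra. }
        lra. }
      assert (D1 : (delta <= 1 / 2)%R) by apply Rmin_l.
      assert (D2 : (delta <= e0 / (3 * exp B0))%R) by apply Rmin_r.
      eapply Rle_trans; [apply (Cmod_Cexp_sub_le _ _ B0 delta); [apply HLam; lra|exact Hdiff|exact D1]|].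
      apply Rmult_le_compat_l with (r := (3 * exp B0)%R) in D2; [|lra].
      replace (3 * exp B0 * (e0 / (3 * exp B0)))%R with e0 in D2 by (field; lra). lra. }
  (* [den] may vanish at [sigma], so it cannot be cancelled there. If the bound failed, continuity
     would make it fail on a disc, forcing [den = 0] on it and hence everywhere, against its
     non-vanishing at 3. *)
  assert (Hexs : (Cmod (ex (RtoC sigma)) <= c ^ m + eta)%R).
  { apply Rnot_lt_le. intros Hlt.
    assert (Hcont := holo_cont _ _ (Hex (RtoC sigma))).
    destruct (proj1 (contC_iff _ _) Hcont (Cmod (ex (RtoC sigma)) - (c ^ m + eta))%R ltac:(lra)) as [d [Hd Hd']].
    set (r := (Rmin d (rho - (4 - sigma)) / 2)%R).
    assert (Hr : (0 < r)%R) by (unfold r; assert (0 < Rmin d (rho - (4 - sigma)))%R by (apply Rmin_pos; lra); lra).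
    assert (Hr1 : (r < d)%R) by (assert (H1 := Rmin_l d (rho - (4 - sigma))); unfold r in *; lra).
    assert (Hr2 : (r < rho - (4 - sigma))%R) by (assert (H1 := Rmin_r d (rho - (4 - sigma))); unfold r in *; lra).
    assert (Hden0 : forall z, den z = 0).
    { apply (identity_principle den (RtoC sigma) r Hden Hr).
      intros w Hw. apply NNPP. intros Hn. apply Cmod_gt_0 in Hn.
      specialize (Hd' w ltac:(lra)).
      assert (T1 := Cmod_triangle_sub (ex (RtoC sigma)) (ex w)). rewrite Cmod_sub_sym in T1.
      assert (Hw4 : (Cmod (w - RtoC 4) <= rho)%R).
      { replace (w - RtoC 4) with ((w - RtoC sigma) + (RtoC (sigma - 4)))
          by (rewrite RtoC_minus; ring).
        eapply Rle_trans; [apply Cmod_triangle|]. rewrite Cmod_R, Rabs_left1 by lra. lra. }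
      specialize (Hmain w Hw4).
      assert (T2 := Cmod_triangle_sub (ex w * den w) (num w)).
      rewrite Cmod_sub_sym, Cmod_mult in T2.
      assert (Hrw : (1 / 2 < Re w)%R).
      { apply Re_ge_of_disc in Hw4. lra. }
      assert (Hnd : (Cmod (num w) <= c ^ m * Cmod (den w))%R).
      { apply Cmod_Cprod_le; [lra|]. intros j. apply (lr_le _ _ _ _ HR). rewrite Hre. exact Hrw. }
      nra. }
    revert Hden0. intros H0. specialize (H0 (RtoC 3)). revert H0. unfold den. apply Cprod_neq_0.
    intros j _. apply (lr_G _ _ _ _ HR). rewrite Hre. simpl. lra. }
  unfold ex in Hexs. rewrite Cmod_Cexp in Hexs.
  replace (c ^ m + eta)%R with (exp (INR m * ln c + eps)) in Hexs.
  - apply Rnot_lt_le. intros Hlt. apply exp_increasing in Hlt.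
    exact (Rlt_irrefl _ (Rle_lt_trans _ _ _ Hexs Hlt)).
  - unfold eta. rewrite exp_plus. rewrite <- (exp_ln (c ^ m)) by exact Hcm.
    rewrite ln_pow by exact Hc. ring.
Qed.

(** * Roots of unity and the descent on exponents *)

Lemma polar_form (b : C) : exists phi : R, b = Cmod b * Cexp (0%R, phi).
Proof.
  destruct (classic (b = 0)) as [->|Hb].
  { exists 0%R. rewrite Cmod_0. ring. }
  apply Cmod_gt_0 in Hb.
  set (x := (Re b / Cmod b)%R). set (y := (Im b / Cmod b)%R).
  assert (Hxy : (x ^ 2 + y ^ 2 = 1)%R).
  { unfold x, y. assert (H := Cmod2_alt b).
    replace ((Re b / Cmod b) ^ 2 + (Im b / Cmod b) ^ 2)%R with ((Re b ^ 2 + Im b ^ 2) / Cmod b ^ 2)%R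
      by (field; lra).
    rewrite <- H. field. lra. }
  assert (Hx : (-1 <= x <= 1)%R) by nra.
  assert (Hsq : sqrt (1 - x ^ 2) = Rabs y).
  { replace (1 - x ^ 2)%R with (y²)%R by (unfold Rsqr; lra). apply sqrt_Rsqr_abs. }
  assert (Hbx : (Re b = Cmod b * x)%R) by (unfold x; field; lra).
  assert (Hby : (Im b = Cmod b * y)%R) by (unfold y; field; lra).
  exists (if Rle_dec 0 y then acos x else - acos x)%R.
  unfold Cexp, Re, Im; simpl. rewrite exp_0.
  assert (Hs : sin (acos x) = Rabs y).
  { rewrite sin_acos by exact Hx. rewrite <- Hsq. f_equal. unfold Rsqr. ring. }
  unfold Re, Im in Hbx, Hby. clearbody x y.
  destruct (Rle_dec 0 y) as [H|H].
  - rewrite cos_acos, Hs, Rabs_pos_eq by lra.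
    apply injective_projections; simpl; [rewrite Hbx at 1|rewrite Hby at 1]; ring.
  - rewrite cos_neg, sin_neg, cos_acos, Hs, Rabs_left by lra.
    apply injective_projections; simpl; [rewrite Hbx at 1|rewrite Hby at 1]; ring.
Qed.

Lemma exists_rotation (b : C) (k : nat) : (1 <= k)%nat ->
  exists w : C, Cmod w = 1%R /\ b * Cpow w k = Cmod b.
Proof.
  intros Hk. destruct (polar_form b) as [phi E].
  exists (Cexp (0, - phi / INR k)%R). split; [apply Cmod_Cexp_i|].
  rewrite <- Cexp_INR_mult.
  replace (INR k * (0, - phi / INR k)%R) with ((0, - phi)%R : C).
  2:{ assert (INR k <> 0%R) by (apply not_0_INR; lia).
      apply injective_projections; simpl; [ring|field; assumption]. }
  rewrite E at 1. rewrite <- Cmult_assoc, <- Cexp_plus.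
  replace ((0%R, phi) + (0, - phi)%R) with (RtoC 0)
    by (apply injective_projections; simpl; ring).
  rewrite Cexp_0. ring.
Qed.

Definition zeta_root (d j : nat) : C := Cexp (0, 2 * PI * INR j / INR d)%R.

Lemma Cexp_2PI_INR (n : nat) : Cexp (0, 2 * PI * INR n)%R = 1.
Proof.
  unfold Cexp, Re, Im; simpl. rewrite exp_0.
  replace (2 * PI * INR n)%R with (0 + 2 * INR n * PI)%R by ring.
  rewrite cos_period, sin_period, cos_0, sin_0.
  apply injective_projections; simpl; ring.
Qed.

(** Allowing [e] full periods lets the [K]-th roots ([e = 2]) and the [2K]-th roots ([e = 1]) be
    used with the same number [2K] of translates. *)
Lemma sum_zeta_root_lt (d e k : nat) : (0 < k < d)%nat ->
  Csum (fun j => Cpow (zeta_root d j) k) (e * d) = 0.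
Proof.
  intros Hk. assert (Hd : (0 < INR d)%R) by (apply lt_0_INR; lia).
  assert (Hk0 : (0 < INR k)%R) by (apply lt_0_INR; lia).
  assert (Hkd : (INR k < INR d)%R) by (apply lt_INR; lia).
  assert (Hpi := PI_RGT_0).
  set (z := Cexp (0, 2 * PI * INR k / INR d)%R).
  rewrite (Csum_ext _ (fun j => Cpow z j)).
  2:{ intros j _. unfold z, zeta_root. rewrite <- !Cexp_INR_mult. f_equal.
      apply injective_projections; simpl; [ring|field; lra]. }
  assert (Hz : Cpow z (e * d) = 1).
  { unfold z. rewrite <- Cexp_INR_mult, <- (Cexp_2PI_INR (e * k)). f_equal.
    apply injective_projections; simpl; [ring|]. rewrite !mult_INR. field. lra. }
  assert (Hz1 : 1 - z <> 0).
  { intros E. apply (Cexp_i_neq_1 (2 * PI * INR k / INR d)%R).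
    - apply Rgt_not_eq. apply Rdiv_lt_0_compat; [|exact Hd]. apply Rmult_lt_0_compat; lra.
    - assert (E1 : (0 < INR k / INR d < 1)%R).
      { split; [now apply Rdiv_lt_0_compat|]. apply Rmult_lt_reg_r with (INR d); [exact Hd|].
        unfold Rdiv. rewrite Rmult_assoc, Rinv_l; lra. }
      replace (2 * PI * INR k / INR d)%R with (2 * PI * (INR k / INR d))%R by (field; lra).
      rewrite Rabs_pos_eq; nra.
    - change (z = 1). replace z with (1 - (1 - z)) by ring. rewrite E. ring. }
  assert (G := Csum_geom z (e * d)). rewrite Hz in G.
  apply NNPP. intros Hn.
  apply (Cmult_neq_0 _ _ Hz1 Hn). etransitivity; [exact G|]. ring.
Qed.

Lemma sum_zeta_root_eq (d m : nat) : (0 < d)%nat ->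
  Csum (fun j => Cpow (zeta_root d j) d) m = INR m.
Proof.
  intros Hd. rewrite (Csum_ext _ (fun _ => 1)).
  - rewrite Csum_const. ring.
  - intros j _. unfold zeta_root. rewrite <- Cexp_INR_mult, <- (Cexp_2PI_INR j). f_equal.
    assert (INR d <> 0%R) by (apply not_0_INR; lia).
    apply injective_projections; simpl; [ring|field; assumption].
Qed.

Lemma Rsum_delta_le (P : nat -> Prop) (g : R) (X : nat) :
  (0 <= g)%R -> (forall i j, P i -> P j -> i = j) ->
  (Rsum (fun j => if excluded_middle_informative (P j) then g else 0%R) X <= g)%R.
Proof.
  intros Hg HP. induction X as [|X IH]; simpl; [exact Hg|].
  destruct excluded_middle_informative as [H|H]; [|lra].
  enough (E : Rsum (fun j => if excluded_middle_informative (P j) then g else 0%R) X = 0%R) by lra.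
  rewrite (Rsum_ext _ (fun _ => 0%R)); [rewrite Rsum_const; ring|].
  intros k Hk. destruct excluded_middle_informative as [H'|H']; [|reflexivity].
  specialize (HP _ _ H H'). lia.
Qed.

Lemma Rsum_delta_eq (a X : nat) (g : nat -> R) : (a < X)%nat ->
  Rsum (fun j => if excluded_middle_informative (a = j) then g j else 0%R) X = g a.
Proof.
  intros Ha. induction X as [|X IH]; [lia|]. simpl.
  destruct (excluded_middle_informative (a = X)) as [->|H].
  - rewrite (Rsum_ext _ (fun _ => 0%R)); [rewrite Rsum_const; ring|].
    intros k Hk. destruct excluded_middle_informative; [lia|reflexivity].
  - rewrite IH by lia. ring.
Qed.

(** A prime power is determined by its base and exponent, neither exceeding it, so the sum embeds
    into a square of pairs, where it can be estimated one variable at a time. *)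
Lemma Rsum_prime_powers_le (u : nat -> R) (g : nat -> nat -> R) (X : nat) :
  (forall a b, (0 <= g a b)%R) ->
  (forall j, ~ prime_power (S j) -> u j = 0%R) ->
  (forall j, prime_power (S j) -> (u j <= g (pbase (S j)) (pexp (S j)))%R) ->
  (Rsum u X <= Rsum (fun a => Rsum (fun b => g a b) (S X)) (S X))%R.
Proof.
  intros Hg H0 Hu.
  set (P := fun a b j => prime_power (S j) /\ pbase (S j) = a /\ pexp (S j) = b).
  apply Rle_trans with (Rsum (fun j => Rsum (fun a => Rsum (fun b =>
    if excluded_middle_informative (P a b j) then g a b else 0%R) (S X)) (S X)) X).
  - apply Rsum_le. intros j Hj.
    destruct (classic (prime_power (S j))) as [Hpp|Hpp].
    + eapply Rle_trans; [now apply Hu|].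
      assert (Hb := pbase_le _ Hpp). assert (He := pexp_lt _ Hpp).
      rewrite (Rsum_ext _ (fun a => if excluded_middle_informative (pbase (S j) = a)
        then g a (pexp (S j)) else 0%R)).
      * rewrite (Rsum_delta_eq _ _ (fun a => g a (pexp (S j)))) by lia. lra.
      * intros a _. destruct (excluded_middle_informative (pbase (S j) = a)) as [E|E].
        -- rewrite (Rsum_ext _ (fun b => if excluded_middle_informative (pexp (S j) = b)
             then g a b else 0%R)).
           ++ rewrite Rsum_delta_eq by lia. reflexivity.
           ++ intros b _. unfold P. repeat destruct excluded_middle_informative; tauto || reflexivity.
        -- rewrite (Rsum_ext _ (fun _ => 0%R)); [rewrite Rsum_const; ring|].
           intros b _. unfold P. destruct excluded_middle_informative; [tauto|reflexivity].
    + rewrite (H0 j Hpp). apply Rsum_nonneg. intros a _. apply Rsum_nonneg. intros b _.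
      destruct excluded_middle_informative; [apply Hg|lra].
  - rewrite Rsum_swap. apply Rsum_le. intros a _. rewrite Rsum_swap. apply Rsum_le. intros b _.
    apply (Rsum_delta_le (P a b)); [apply Hg|].
    intros i j (Hi & Ei1 & Ei2) (Hj & Ej1 & Ej2).
    apply prime_power_spec in Hi. apply prime_power_spec in Hj.
    destruct Hi as (_ & _ & Ei). destruct Hj as (_ & _ & Ej). congruence.
Qed.

Lemma Rsum_geom_le (x : R) (X : nat) : (0 <= x < 1)%R -> (Rsum (fun b => x ^ b) X <= / (1 - x))%R.
Proof.
  intros Hx. assert (E : ((1 - x) * Rsum (fun b => x ^ b) X = 1 - x ^ X)%R).
  { induction X as [|X IH]; [simpl; ring|]. rewrite Rsum_S, Rmult_plus_distr_l, IH. simpl. ring. }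
  apply Rmult_le_reg_l with (1 - x)%R; [lra|]. rewrite E, Rinv_r by lra.
  assert (H := pow_le x X ltac:(lra)). lra.
Qed.

Lemma Re_RtoC (x : R) : Re (RtoC x) = x.
Proof. reflexivity. Qed.

(** Outside the prime powers [pexp] takes junk values; in all uses such terms carry a zero
    coefficient. *)
Definition high_exp_sum (beta : nat -> C) (k X : nat) : R :=
  Rsum (fun j => if (k <? pexp (S j))%nat
    then Cmod (beta (S j)) * Rpower (INR (S j)) (- (1 / 2)) else 0)%R X.

(** With [d = 1/2 - theta] the term at [p^e] is at most [K p^(-d e)]. Once [k d > 2] and [e > k],
    this is at most [K p^(-2) 2^(-d (e - k))], whose double sum converges. *)
Lemma high_exp_sum_bounded_large (beta : nat -> C) (K theta : R) :
  (0 < K)%R -> (theta < 1 / 2)%R ->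
  (forall n, (1 <= n)%nat -> ~ prime_power n -> beta n = 0) ->
  (forall n, (1 <= n)%nat -> (Cmod (beta n) <= K * Rpower (INR n) theta)%R) ->
  exists (k : nat) (W : R), forall X, (high_exp_sum beta k X <= W)%R.
Proof.
  intros HK Ht H0 Hb. set (d := (1 / 2 - theta)%R). assert (Hd : (0 < d)%R) by (unfold d; lra).
  destruct (INR_unbounded (2 / d)%R) as [k Hk].
  assert (Hkd : (2 < INR k * d)%R).
  { apply Rmult_lt_compat_r with (r := d) in Hk; [|exact Hd].
    unfold Rdiv in Hk. rewrite Rmult_assoc, Rinv_l in Hk; lra. }
  set (x := Rpower 2 (- d)).
  assert (Hx : (0 < x < 1)%R).
  { split; [apply Rpower_pos|]. rewrite <- (Rpower_O 2) by lra. apply Rpower_lt; lra. }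
  (* The value 0 at [a = 0] avoids the junk inverse of 0; bases that are not prime only enlarge the
     sum. *)
  set (g := fun a b : nat => if (a =? 0)%nat then 0%R else (K * / x ^ k * (/ INR a ^ 2 * x ^ b))%R).
  assert (Hxk : (0 < / x ^ k)%R) by (apply Rinv_0_lt_compat, pow_lt; lra).
  assert (Hg : forall a b, (0 <= g a b)%R).
  { intros a b. unfold g. destruct (Nat.eqb_spec a 0) as [E|E]; [lra|].
    assert (0 < INR a)%R by (apply lt_0_INR; lia).
    assert (0 < / INR a ^ 2)%R by (apply Rinv_0_lt_compat, pow_lt; lra).
    assert (0 < x ^ b)%R by (apply pow_lt; lra).
    apply Rmult_le_pos; [|nra]. apply Rmult_le_pos; lra. }
  exists k, (K * / x ^ k * (2 * / (1 - x)))%R. intros X.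
  eapply Rle_trans; [apply (Rsum_prime_powers_le _ g)|].
  - exact Hg.
  - intros j Hj. rewrite (H0 (S j)); [|lia|exact Hj]. rewrite Cmod_0, Rmult_0_l. now destruct (_ <? _)%nat.
  - intros j Hj. destruct (prime_power_spec _ Hj) as (Hp & He & E).
    assert (Hp2 := prime_nat_ge2 _ Hp).
    set (p := pbase (S j)) in *. set (e := pexp (S j)) in *.
    destruct (Nat.ltb_spec k e) as [Hlt|Hge]; [|apply Hg].
    assert (HpR : (2 <= INR p)%R) by (apply (le_INR 2); exact Hp2).
    specialize (Hb (S j) ltac:(lia)).
    apply Rle_trans with (K * Rpower (INR (S j)) theta * Rpower (INR (S j)) (- (1 / 2)))%R.
    { apply Rmult_le_compat_r; [apply Rlt_le, Rpower_pos|exact Hb]. }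
    rewrite Rmult_assoc, <- Rpower_plus.
    replace (theta + - (1 / 2))%R with (- d)%R by (unfold d; ring).
    unfold g. destruct (Nat.eqb_spec p 0) as [E0|_]; [lia|].
    rewrite !Rmult_assoc. apply Rmult_le_compat_l; [lra|].
    rewrite E, pow_INR, <- Rpower_pow, Rpower_mult by lra.
    replace (INR e * - d)%R with (- (INR k * d) + INR (e - k) * - d)%R
      by (rewrite minus_INR by lia; ring).
    rewrite Rpower_plus.
    replace (/ x ^ k * (/ INR p ^ 2 * x ^ e))%R with (/ INR p ^ 2 * x ^ (e - k))%R.
    2:{ replace e with (k + (e - k))%nat at 2 by lia. rewrite pow_add. field.
        assert (x ^ k <> 0)%R by (apply pow_nonzero; lra).
        split; [lra|assumption]. }
    apply Rmult_le_compat; try (apply Rlt_le, Rpower_pos).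
    + rewrite <- Rpower_pow, <- Rpower_Ropp by lra. apply Rle_Rpower; [lra|]. simpl. lra.
    + replace (INR (e - k) * - d)%R with (- d * INR (e - k))%R by ring.
      rewrite <- Rpower_mult, Rpower_pow by apply Rpower_pos.
      apply pow_incr. split; [apply Rlt_le, Rpower_pos|].
      rewrite !Rpower_Ropp. unfold x. rewrite Rpower_Ropp.
      apply Rinv_le_contravar; [apply Rpower_pos|]. apply Rle_Rpower_l; lra.
  - apply Rle_trans with (Rsum (fun a => K * / x ^ k * / (1 - x) *
      (if (a =? 0)%nat then 0 else / INR a ^ 2))%R (S X)).
    + apply Rsum_le. intros a _. unfold g. destruct (a =? 0)%nat eqn:Ea.
      * rewrite Rsum_const. lra.
      * apply Nat.eqb_neq in Ea. rewrite !Rsum_mult_l.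
        assert (0 < / INR a ^ 2)%R by (apply Rinv_0_lt_compat, pow_lt, lt_0_INR; lia).
        assert (Hs := Rsum_geom_le x (S X) ltac:(lra)).
        replace (K * / x ^ k * / (1 - x) * / INR a ^ 2)%R with
          (K * / x ^ k * (/ INR a ^ 2 * / (1 - x)))%R by ring.
        apply Rmult_le_compat_l; [apply Rmult_le_pos; lra|].
        apply Rmult_le_compat_l; [lra|exact Hs].
    + rewrite Rsum_mult_l.
      replace (K * / x ^ k * (2 * / (1 - x)))%R with (K * / x ^ k * / (1 - x) * 2)%R by ring.
      apply Rmult_le_compat_l.
      { apply Rmult_le_pos; [apply Rmult_le_pos; lra|]. apply Rlt_le, Rinv_0_lt_compat. lra. }
      assert (E : forall Y, Rsum (fun a => if (a =? 0)%nat then 0 else / INR a ^ 2)%R (S Y)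
          = Rsum (fun a => / INR (S a) ^ 2)%R Y).
      { induction Y as [|Y IH]; [simpl; ring|]. rewrite Rsum_S, IH. reflexivity. }
      rewrite E. apply Rsum_inv_sq_le.
Qed.

Lemma Rle_limit_right (f : R -> R) (a M : R) :
  continuous f a -> (forall x, (a < x <= a + 1)%R -> (f x <= M)%R) -> (f a <= M)%R.
Proof.
  intros Hf H. apply Rnot_lt_le. intros Hlt.
  destruct (proj1 (filterlim_locally f (f a)) Hf (mkposreal (f a - M) ltac:(lra))) as [d Hd].
  assert (Hd0 := cond_pos d).
  set (x := (a + Rmin 1 (d / 2))%R).
  assert (H1 := Rmin_l 1 (d / 2)). assert (H2 := Rmin_r 1 (d / 2)).
  assert (H3 : (0 < Rmin 1 (d / 2))%R) by (apply Rmin_pos; lra).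
  specialize (Hd x). unfold ball in Hd; simpl in Hd.
  unfold AbsRing_ball, abs, minus, plus, opp in Hd; simpl in Hd.
  assert (Hb : (Rabs (x + - a) < d)%R) by (unfold x; rewrite Rabs_pos_eq; lra).
  specialize (Hd Hb). apply Rabs_lt_between in Hd.
  specialize (H x ltac:(unfold x; lra)). lra.
Qed.

Lemma continuous_Rsum (f : nat -> R -> R) (n : nat) (x : R) :
  (forall k, continuous (f k) x) -> continuous (fun t => Rsum (fun k => f k t) n) x.
Proof.
  intros H. induction n as [|n IH]; simpl; [apply continuous_const|].
  now apply (continuous_plus (V := R_NormedModule)).
Qed.

(* The characters [z_j(p) = omega_p e(j/k)] ([p^k <= N], with [omega_p] making
   [beta(p^k) omega_p^k] nonnegative) and [z_j(p) = e(j/2k)] ([p^k > N]), [j < 2k],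
   kill all prime powers with exponent at most [k], except those with [n = p^k <= N]. *)
Lemma high_exp_sum_step (HF HG : C -> C) (beta : nat -> C) (c : R) (k : nat) :
  log_ratio HF HG beta c ->
  (exists W, forall X, (high_exp_sum beta (S k) X <= W)%R) ->
  exists W, forall X, (high_exp_sum beta k X <= W)%R.
Proof.
  intros HR [W HW]. set (K := S k).
  assert (HK0 : (0 < INR (2 * K))%R) by (apply lt_0_INR; unfold K; lia).
  assert (Hom : forall p, exists w, Cmod w = 1%R /\ beta (p ^ K)%nat * Cpow w K = Cmod (beta (p ^ K)%nat))
    by (intros p; apply exists_rotation; unfold K; lia).
  set (om := fun p => proj1_sig (constructive_indefinite_description _ (Hom p))).
  assert (Hom' : forall p, Cmod (om p) = 1%R /\ beta (p ^ K)%nat * Cpow (om p) K = Cmod (beta (p ^ K)%nat)).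
  { intros p. unfold om. destruct constructive_indefinite_description; assumption. }
  clearbody om. clear Hom.
  (* Exponent exactly [K] contributes at most [W + ln c], higher exponents at most [W]. The bound
     [2K ln c] from [2K] translates is divided by the weight [2K] of the surviving terms, so nothing
     depends on [N]. *)
  exists (2 * W + ln c)%R. intros N.
  set (zz := fun j p => if (p ^ K <=? N)%nat then om p * zeta_root K j else zeta_root (2 * K) j).
  assert (Hzr : forall d j, Cmod (zeta_root d j) = 1%R) by (intros; apply Cmod_Cexp_i).
  assert (Hzz : forall j p, Cmod (zz j p) = 1%R).
  { intros j p. unfold zz. destruct (_ <=? _)%nat; [|apply Hzr].
    rewrite Cmod_mult, Hzr. rewrite (proj1 (Hom' p)). ring. }
  set (kap := kappa zz (2 * K)).
  assert (Hkle : forall n, (Cmod (kap n) <= INR (2 * K))%R).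
  { intros n. unfold kap, kappa. eapply Rle_trans; [apply Cmod_Csum|].
    rewrite (Rsum_ext _ (fun _ => 1%R)); [rewrite Rsum_const; lra|].
    intros j _. rewrite Cmod_pow, Hzz, pow1. reflexivity. }
  assert (Hklt : forall n, prime_power n -> (pexp n < K)%nat -> kap n = 0).
  { intros n Hn Hlt. destruct (prime_power_spec n Hn) as (_ & H1 & _).
    unfold kap, kappa, zz. destruct (_ <=? _)%nat.
    - rewrite (Csum_ext _ (fun j => Cpow (om (pbase n)) (pexp n) * Cpow (zeta_root K j) (pexp n)))
        by (intros; apply Cpow_mult_l).
      rewrite Csum_mult_l, sum_zeta_root_lt by lia. ring.
    - assert (H := sum_zeta_root_lt (2 * K) 1 (pexp n) ltac:(lia)).
      rewrite Nat.mul_1_l in H. exact H. }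
  assert (Hkeq : forall n, prime_power n -> pexp n = K ->
    (if (n <=? N)%nat then beta n * kap n = INR (2 * K) * Cmod (beta n) else kap n = 0)).
  { intros n Hn E. destruct (prime_power_spec n Hn) as (_ & H1 & En).
    unfold kap, kappa, zz. rewrite E in *. rewrite <- En. destruct (_ <=? _)%nat.
    - rewrite (Csum_ext _ (fun j => Cpow (om (pbase n)) K * Cpow (zeta_root K j) K))
        by (intros; apply Cpow_mult_l).
      rewrite Csum_mult_l, sum_zeta_root_eq by (unfold K; lia).
      rewrite Cmult_assoc. rewrite En at 1. rewrite (proj2 (Hom' (pbase n))), <- En. ring.
    - assert (H := sum_zeta_root_lt (2 * K) 1 K ltac:(unfold K; lia)).
      rewrite Nat.mul_1_l in H. exact H. }
  (* The twist vanishes at [p^K > N], so only finitely many terms with exponent [K] survive. This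
     supplies the bound at [1/2], uniform in the truncation [X], that the twisted estimate takes as
     input; it may depend on [N], unlike the conclusion. *)
  set (low := fun (s : R) X => Rsum (fun j => if ((pexp (S j) =? K) && (S j <=? N))%nat%bool
     then Cmod (beta (S j)) * Rpower (INR (S j)) (- s) else 0)%R X).
  set (hi := fun (s : R) X => Rsum (fun j => if (K <? pexp (S j))%nat
     then Cmod (beta (S j)) * Rpower (INR (S j)) (- s) else 0)%R X).
  assert (Hterm0 : forall j s, (0 <= Cmod (beta (S j)) * Rpower (INR (S j)) s)%R)
    by (intros; apply Rmult_le_pos; [apply Cmod_ge_0|apply Rlt_le, Rpower_pos]).
  assert (HlowN : forall s X, (low s X <= low s N)%R).
  { intros s X. destruct (le_lt_dec X N) as [H|H].
    - apply Rsum_incr; [exact H|]. intros j. destruct (_ && _)%bool; [apply Hterm0|lra].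
    - unfold low. assert (HNX : (N <= X)%nat) by lia.
      clear H. induction HNX as [|X HNX IH]; [lra|]. rewrite Rsum_S.
      replace (S X <=? N)%nat with false by (symmetry; apply Nat.leb_gt; lia).
      rewrite Bool.andb_false_r. lra. }
  assert (Hhi : forall s X, (1 / 2 <= s)%R -> (hi s X <= W)%R).
  { intros s X Hs. eapply Rle_trans; [|apply (HW X)]. apply Rsum_le. intros j _.
    fold K. destruct (K <? pexp (S j))%nat; [|lra].
    apply Rmult_le_compat_l; [apply Cmod_ge_0|]. apply Rpower_INR_le. lra. }
  assert (Hsigma : forall s, (1 / 2 < s <= 1 / 2 + 1)%R -> (low s N <= W + ln c)%R).
  { intros s Hs. apply Rnot_lt_le. intros Hlt.
    set (eps := (INR (2 * K) * (low s N - (W + ln c)) / 2)%R).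
    assert (Heps : (0 < eps)%R).
    { unfold eps. apply Rdiv_lt_0_compat; [|lra]. apply Rmult_lt_0_compat; lra. }
    destruct (twisted_log_bound HF HG beta c zz (2 * K) (INR (2 * K) * (low (1 / 2) N + W))%R s eps HR Hzz)
      as [X0 HX0]; [|lra|exact Heps|].
    - intros X.
      apply Rle_trans with (INR (2 * K) * (low (1 / 2) X + hi (1 / 2) X))%R.
      + unfold low, hi. rewrite <- Rsum_plus, <- Rsum_mult_l. apply Rsum_le. intros j _.
        fold kap. rewrite Cmod_mult.
        destruct (classic (prime_power (S j))) as [Hpp|Hpp].
        2:{ rewrite (lr_support _ _ _ _ HR (S j)); [|lia|exact Hpp].
            rewrite Cmod_0, !Rmult_0_l. destruct (_ && _)%bool, (_ <? _)%nat; lra. }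
        assert (Hj := Hterm0 j (- (1 / 2))%R). specialize (Hkle (S j)).
        destruct (Nat.lt_trichotomy (pexp (S j)) K) as [H|[H|H]].
        * rewrite (Hklt _ Hpp H), Cmod_0, Rmult_0_r, Rmult_0_l.
          apply Rmult_le_pos; [lra|]. destruct (_ && _)%bool, (_ <? _)%nat; lra.
        * specialize (Hkeq _ Hpp H). rewrite H, Nat.eqb_refl, Nat.ltb_irrefl.
          destruct (S j <=? N)%nat; simpl andb; cbv iota.
          -- rewrite <- Cmod_mult, Hkeq, Cmod_mult, !Cmod_R, (Rabs_pos_eq (INR _)) by lra.
             rewrite Rabs_pos_eq by apply Cmod_ge_0. lra.
          -- rewrite Hkeq, Cmod_0. lra.
        * replace (K <? pexp (S j))%nat with true by (symmetry; apply Nat.ltb_lt; exact H).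
          assert (Hge : (0 <= if ((pexp (S j) =? K) && (S j <=? N))%nat%bool
            then Cmod (beta (S j)) * Rpower (INR (S j)) (- (1 / 2)) else 0)%R)
            by (destruct (_ && _)%bool; lra).
          apply Rle_trans with (INR (2 * K) * (Cmod (beta (S j)) * Rpower (INR (S j)) (- (1 / 2))))%R.
          -- rewrite (Rmult_comm (Cmod (beta (S j)))), Rmult_assoc. apply Rmult_le_compat_r; assumption.
          -- apply Rmult_le_compat_l; lra.
      + apply Rmult_le_compat_l; [lra|]. apply Rplus_le_compat; [apply HlowN|apply Hhi; lra].
    - specialize (HX0 (max X0 N) (Nat.le_max_l _ _)).
      (* Since [|kap| <= 2K], the higher exponents can lower the real part by at most [2K] times
         [hi]. *)
      assert (Hlow : (INR (2 * K) * (low s (max X0 N) - hi s (max X0 N)) <=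
        Re (dsum (fun n => beta n * kappa zz (2 * K) n)%C (RtoC s) (max X0 N)))%R).
      { unfold dsum. rewrite Re_Csum. unfold low, hi.
        replace (Rsum (fun j => if ((pexp (S j) =? K) && (S j <=? N))%nat%bool
           then Cmod (beta (S j)) * Rpower (INR (S j)) (- s) else 0)%R (max X0 N) -
           Rsum (fun j => if (K <? pexp (S j))%nat
           then Cmod (beta (S j)) * Rpower (INR (S j)) (- s) else 0)%R (max X0 N))%R with
          (Rsum (fun j => (if ((pexp (S j) =? K) && (S j <=? N))%nat%bool
           then Cmod (beta (S j)) * Rpower (INR (S j)) (- s) else 0) + -1 *
           (if (K <? pexp (S j))%nat
           then Cmod (beta (S j)) * Rpower (INR (S j)) (- s) else 0))%R (max X0 N))
          by (rewrite Rsum_plus, Rsum_mult_l; ring).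
        rewrite <- Rsum_mult_l. apply Rsum_le. intros j _.
        fold kap. unfold dirichlet_term.
        assert (Hrc : Rcpow (INR (S j)) (- RtoC s) = RtoC (Rpower (INR (S j)) (- s))).
        { unfold Rcpow, Rpower. rewrite <- RtoC_opp, <- RtoC_mult. apply Cexp_RtoC. }
        rewrite Hrc.
        assert (Hj := Hterm0 j (- s)%R). assert (Hp := Rpower_pos (INR (S j)) (- s)).
        destruct (classic (prime_power (S j))) as [Hpp|Hpp].
        2:{ rewrite (lr_support _ _ _ _ HR (S j)); [|lia|exact Hpp].
            rewrite Cmod_0, !Rmult_0_l, !Cmult_0_l. rewrite ?Re_RtoC.
            destruct (_ && _)%bool, (_ <? _)%nat; lra. }
        destruct (Nat.lt_trichotomy (pexp (S j)) K) as [H|[H|H]].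
        + rewrite (Hklt _ Hpp H).
          replace (pexp (S j) =? K)%nat with false by (symmetry; apply Nat.eqb_neq; lia).
          replace (K <? pexp (S j))%nat with false by (symmetry; apply Nat.ltb_ge; lia).
          simpl. lra.
        + specialize (Hkeq _ Hpp H). rewrite H, Nat.eqb_refl, Nat.ltb_irrefl.
          destruct (S j <=? N)%nat; simpl andb; cbv iota.
          * rewrite Hkeq, <- !RtoC_mult, Re_RtoC. lra.
          * rewrite Hkeq. replace (beta (S j) * 0 * RtoC (Rpower (INR (S j)) (- s))) with (RtoC 0) by ring.
            rewrite ?Re_RtoC. lra.
        + replace (pexp (S j) =? K)%nat with false by (symmetry; apply Nat.eqb_neq; lia).
          replace (K <? pexp (S j))%nat with true by (symmetry; apply Nat.ltb_lt; exact H).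
          simpl andb; cbv iota.
          assert (R1 := re_le_Cmod (beta (S j) * kap (S j) * RtoC (Rpower (INR (S j)) (- s)))).
          rewrite !Cmod_mult, Cmod_R, (Rabs_pos_eq (Rpower _ _)) in R1 by lra.
          apply Rabs_le_between in R1. destruct R1 as [R1 _].
          eapply Rle_trans; [|exact R1]. specialize (Hkle (S j)).
          apply Rmult_le_compat_l with (r := (Cmod (beta (S j)) * Rpower (INR (S j)) (- s))%R) in Hkle;
            [lra|exact Hj]. }
      assert (HhiX := Hhi s (max X0 N) ltac:(lra)).
      assert (HlowX : (low s N <= low s (max X0 N))%R).
      { apply Rsum_incr; [apply Nat.le_max_r|]. intros j. destruct (_ && _)%bool; [apply Hterm0|lra]. }
      assert (Hfin : (INR (2 * K) * (low s N - W) <= INR (2 * K) * ln c + eps)%R).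
      { eapply Rle_trans; [|exact HX0]. eapply Rle_trans; [|exact Hlow].
        apply Rmult_le_compat_l; lra. }
      unfold eps in Hfin. nra. }
  (* The twisted bound requires [sigma > 1/2]; as [low s N] is a finite sum, it is continuous in [s]
     and the bound passes to [1/2]. *)
  assert (Hlim : (low (1 / 2) N <= W + ln c)%R).
  { apply (Rle_limit_right (fun s => low s N)); [|exact Hsigma].
    apply (continuous_Rsum (fun j s => if ((pexp (S j) =? K) && (S j <=? N))%nat%bool
     then Cmod (beta (S j)) * Rpower (INR (S j)) (- s) else 0)%R).
    intros j. destruct (_ && _)%bool; [|apply continuous_const].
    apply (ex_derive_continuous (V := R_NormedModule)). unfold Rpower. auto_derive. trivial. }
  apply Rle_trans with (low (1 / 2) N + hi (1 / 2) N)%R.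
  - unfold low, hi. rewrite <- Rsum_plus. apply Rsum_le. intros j Hj.
    assert (H0 := Hterm0 j (- (1 / 2))%R).
    replace (S j <=? N)%nat with true by (symmetry; apply Nat.leb_le; lia).
    rewrite Bool.andb_true_r.
    destruct (Nat.ltb_spec k (pexp (S j))) as [H|H].
    + destruct (Nat.eqb_spec (pexp (S j)) K), (Nat.ltb_spec K (pexp (S j))); unfold K in *; lra || lia.
    + destruct (Nat.eqb_spec (pexp (S j)) K), (Nat.ltb_spec K (pexp (S j))); lra.
  - specialize (Hhi (1 / 2)%R N ltac:(lra)). lra.
Qed.

Theorem log_coefficients_summable (HF HG : C -> C) (beta : nat -> C) (c : R) :
  log_ratio HF HG beta c ->
  exists W, forall X, (Rsum (fun j => Cmod (beta (S j)) * Rpower (INR (S j)) (- (1 / 2))) X <= W)%R.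
Proof.
  intros HR.
  destruct (lr_beta _ _ _ _ HR) as (K & theta & HK & Ht & Hb).
  destruct (high_exp_sum_bounded_large beta K theta HK Ht (lr_support _ _ _ _ HR) Hb) as [k Hk].
  (* Every prime power has exponent at least 1, so level 0 of the descent contains all nonzero
     terms. *)
  assert (H0 : exists W, forall X, (high_exp_sum beta 0 X <= W)%R).
  { induction k as [|k IH]; [exact Hk|]. apply IH. eapply high_exp_sum_step; [exact HR|exact Hk]. }
  destruct H0 as [W HW]. exists W. intros X. eapply Rle_trans; [|apply (HW X)].
  right. apply Rsum_ext. intros j _.
  destruct (classic (prime_power (S j))) as [Hpp|Hpp].
  - destruct (prime_power_spec _ Hpp) as (_ & He & _).
    replace (0 <? pexp (S j))%nat with true by (symmetry; apply Nat.ltb_lt; lia). reflexivity.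
  - rewrite (lr_support _ _ _ _ HR (S j)); [|lia|exact Hpp]. rewrite Cmod_0, Rmult_0_l.
    now destruct (_ <? _)%nat.
Qed.

(** * The logarithm of the quotient up to the critical line *)

Lemma bounded_Rsum_cauchy (f : nat -> R) (W eps : R) :
  (forall k, (0 <= f k)%R) -> (forall X, (Rsum f X <= W)%R) -> (0 < eps)%R ->
  exists X0, forall X Y, (X0 <= X)%nat -> (X <= Y)%nat -> (Rsum f Y - Rsum f X <= eps)%R.
Proof.
  intros Hf HW He.
  destruct (growing_cv (Rsum f)) as [l Hl].
  - intros n. rewrite Rsum_S. specialize (Hf n). lra.
  - exists W. intros x [n ->]. apply HW.
  - destruct (Hl (eps / 2)%R ltac:(lra)) as [N HN]. exists N. intros X Y HX HY.
    assert (H1 := HN X HX). assert (H2 := HN Y ltac:(lia)). unfold Rdist in *.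
    apply Rabs_lt_between in H1. apply Rabs_lt_between in H2. lra.
Qed.

Lemma Csum_tail_le (u : nat -> C) (f : nat -> R) (X Y : nat) :
  (X <= Y)%nat -> (forall k, (Cmod (u k) <= f k)%R) ->
  (Cmod (Csum u Y - Csum u X) <= Rsum f Y - Rsum f X)%R.
Proof.
  intros HXY Hu. induction HXY as [|Y HXY IH].
  - replace (Csum u X - Csum u X) with (RtoC 0) by ring. rewrite Cmod_0. lra.
  - rewrite Csum_S, Rsum_S. replace (Csum u Y + u Y - Csum u X) with ((Csum u Y - Csum u X) + u Y) by ring.
    eapply Rle_trans; [apply Cmod_triangle|]. specialize (Hu Y). lra.
Qed.

(** The identity [HF = exp(L) HG] is expressed by partial sums and a relative error. For fixed [s] a
    much longer sum, of length [Y], is compared first by the two-constants theorem with [D = 1];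
    absolute summability at [1/2] then returns from [Y] to [X] uniformly in [s]. *)
Theorem ratio_eq_exp_on_half_plane (HF HG : C -> C) (beta : nat -> C) (c eps : R) :
  log_ratio HF HG beta c -> (0 < eps)%R ->
  exists X0, forall X, (X0 <= X)%nat -> forall s, (1 / 2 <= Re s)%R ->
    (Cmod (HF s - Cexp (dsum beta s X) * HG s) <= eps * Cmod (HG s))%R.
Proof.
  intros HR He.
  destruct (log_coefficients_summable _ _ _ _ HR) as [W HW].
  set (y := fun j => (Cmod (beta (S j)) * Rpower (INR (S j)) (- (1 / 2)))%R).
  assert (Hy : forall j, (0 <= y j)%R)
    by (intros; apply Rmult_le_pos; [apply Cmod_ge_0|apply Rlt_le, Rpower_pos]).
  assert (HeW := exp_pos W).
  assert (Hterm : forall s k, (1 / 2 <= Re s)%R -> (Cmod (dirichlet_term beta s k) <= y k)%R).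
  { intros s k Hs. rewrite Cmod_dirichlet_term. apply Rmult_le_compat_l; [apply Cmod_ge_0|].
    apply Rpower_INR_le. lra. }
  assert (HdW : forall s X, (1 / 2 <= Re s)%R -> (Cmod (dsum beta s X) <= W)%R)
    by (intros s X Hs; eapply Rle_trans; [apply (Cmod_dsum_le _ _ _ _ Hs)|apply HW]).
  set (delta := Rmin (1 / 2) (eps / (3 * exp W))).
  assert (Hdelta : (0 < delta)%R) by (apply Rmin_pos; [lra|apply Rdiv_lt_0_compat; lra]).
  assert (D1 : (delta <= 1 / 2)%R) by apply Rmin_l.
  assert (D2 : (exp W * (3 * delta) <= eps)%R).
  { assert (D2 : (delta <= eps / (3 * exp W))%R) by apply Rmin_r.
    apply Rmult_le_compat_l with (r := (3 * exp W)%R) in D2; [|lra].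
    replace (3 * exp W * (eps / (3 * exp W)))%R with eps in D2 by (field; lra). lra. }
  destruct (bounded_Rsum_cauchy y W delta Hy HW Hdelta) as [X0 HX0].
  exists X0. intros X HX.
  assert (Hcau : forall s Y, (1 / 2 <= Re s)%R -> (X <= Y)%nat ->
    (Cmod (Cexp (dsum beta s Y) - Cexp (dsum beta s X)) <= eps)%R).
  { intros s Y Hs HY. eapply Rle_trans; [|exact D2].
    apply Cmod_Cexp_sub_le; [now apply HdW| |exact D1].
    eapply Rle_trans; [apply (Csum_tail_le _ y); [exact HY|intros; now apply Hterm]|].
    now apply HX0. }
  assert (Hopen : forall s, (1 / 2 < Re s)%R ->
    (Cmod (HF s - Cexp (dsum beta s X) * HG s) <= eps * Cmod (HG s))%R).
  { intros s Hs. apply Rnot_lt_le. intros Hlt.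
    set (nu := ((Cmod (HF s - Cexp (dsum beta s X) * HG s) - eps * Cmod (HG s)) / 2)%R).
    assert (Hnu : (0 < nu)%R) by (unfold nu; lra).
    (* The disc of radius [x0 - 1/2] about [x0 + i Im s] touches the line [Re = 1/2] and contains
       [s], and its concentric unit disc lies in [Re >= 3]. *)
    set (x0 := Rmax (Re s) 4). assert (Hx0 : (Re s <= x0)%R) by apply Rmax_l.
    assert (Hx04 : (4 <= x0)%R) by apply Rmax_r.
    set (z0 := (x0, Im s) : C). set (r2 := (x0 - 1 / 2)%R).
    assert (Hre : forall w, (Rabs (Re w - x0) <= Cmod (w - z0))%R).
    { intros w. exact (re_sub_abs_le w z0). }
    destruct (bounded_on_disc HF z0 r2) as [MF [HMF0 HMF]];
      [unfold r2; lra|intros; apply holo_cont, (lr_holo_F _ _ _ _ HR)|].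
    destruct (bounded_on_disc HG z0 r2) as [MG [HMG0 HMG]];
      [unfold r2; lra|intros; apply holo_cont, (lr_holo_G _ _ _ _ HR)|].
    assert (HB : (0 <= MF + exp W * MG)%R) by (assert (0 <= exp W * MG)%R by (apply Rmult_le_pos; lra); lra).
    destruct (two_constants 1 (Rmax 1 (x0 - Re s)) r2 (MF + exp W * MG) nu) as [e0 [He0 H2c]];
      [lra|apply Rmax_l|unfold r2; apply Rmax_lub_lt; lra|exact HB|exact Hnu|].
    destruct (log_ratio_tail _ _ _ _ HR) as (K & HK & _ & Htail).
    set (dl := Rmin (1 / 2) (e0 / (3 * exp W * (MG + 1)))).
    assert (Hq : (0 < 3 * exp W * (MG + 1))%R) by (apply Rmult_lt_0_compat; lra).
    assert (Hdl : (0 < dl)%R) by (apply Rmin_pos; [lra|apply Rdiv_lt_0_compat; lra]).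
    assert (L1 : (dl <= 1 / 2)%R) by apply Rmin_l.
    assert (L2 : (dl <= e0 / (3 * exp W * (MG + 1)))%R) by apply Rmin_r.
    apply Rmult_le_compat_l with (r := (3 * exp W * (MG + 1))%R) in L2; [|lra].
    replace (3 * exp W * (MG + 1) * (e0 / (3 * exp W * (MG + 1))))%R with e0 in L2 by (field; lra).
    destruct (INR_unbounded (K / dl)%R) as [Y0 HY0].
    set (Y := S (max X Y0)).
    assert (HYR : (K * / INR Y <= dl)%R).
    { assert (H1 : (INR Y0 <= INR Y)%R) by (apply le_INR; unfold Y; lia).
      assert (H2 : (0 < INR Y)%R) by (apply lt_0_INR; unfold Y; lia).
      apply Rmult_le_reg_r with (INR Y / dl)%R; [now apply Rdiv_lt_0_compat|].
      replace (K * / INR Y * (INR Y / dl))%R with (K / dl)%R by (field; lra).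
      replace (dl * (INR Y / dl))%R with (INR Y) by (field; lra). lra. }
    assert (Hs' : (Cmod (HF s - Cexp (dsum beta s Y) * HG s) <= nu * Cmod 1)%R).
    { apply (H2c (fun s => HF s - Cexp (dsum beta s Y) * HG s) (fun _ => 1) z0).
      - intros w _. split; [|apply holo_const].
        apply holo_minus; [apply (lr_holo_F _ _ _ _ HR)|].
        apply holo_mult; [|apply (lr_holo_G _ _ _ _ HR)].
        apply (holo_comp Cexp (fun s => dsum beta s Y)); [apply holo_dsum|apply holo_Cexp].
      - intros w Hw. rewrite Cmod_1, Rmult_1_r.
        assert (H1 := Hre w). apply Rle_lt_trans with (2 := Hw) in H1. apply Rabs_lt_between in H1.
        unfold r2 in *.
        eapply Rle_trans; [apply Cmod_triangle|]. rewrite Cmod_opp, Cmod_mult.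
        apply Rplus_le_compat; [apply HMF; lra|].
        apply Rmult_le_compat; try apply Cmod_ge_0; [|apply HMG; lra].
        apply Cmod_Cexp_le, HdW. lra.
      - intros w Hw. rewrite Cmod_1, Rmult_1_r.
        assert (H1 := Hre w). apply Rle_trans with (2 := Hw) in H1. apply Rabs_le_between in H1.
        destruct (Htail Y w ltac:(unfold Y; lia) ltac:(lra)) as [L [HL E]].
        rewrite E. replace (Cexp L * HG w - Cexp (dsum beta w Y) * HG w) with
          ((Cexp L - Cexp (dsum beta w Y)) * HG w) by ring.
        rewrite Cmod_mult.
        apply Rle_trans with (exp W * (3 * dl) * MG)%R.
        + apply Rmult_le_compat; try apply Cmod_ge_0.
          * apply Cmod_Cexp_sub_le; [apply HdW; lra|lra|exact L1].
          * apply HMG. unfold r2. lra.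
        + assert (0 <= exp W * (3 * dl))%R by (apply Rmult_le_pos; lra). lra.
      - replace (s - z0) with (RtoC (Re s - x0)).
        + rewrite Cmod_R, Rabs_left1 by lra. rewrite Ropp_minus_distr. apply Rmax_r.
        + unfold z0. destruct s; apply injective_projections; unfold Re, Im; simpl; ring. }
    rewrite Cmod_1, Rmult_1_r in Hs'.
    assert (Hc := Hcau s Y ltac:(lra) ltac:(unfold Y; lia)).
    assert (Hfin : (Cmod (HF s - Cexp (dsum beta s X) * HG s) <= nu + eps * Cmod (HG s))%R).
    { replace (HF s - Cexp (dsum beta s X) * HG s) with
        ((HF s - Cexp (dsum beta s Y) * HG s) + (Cexp (dsum beta s Y) - Cexp (dsum beta s X)) * HG s) by ring.
      eapply Rle_trans; [apply Cmod_triangle|]. rewrite Cmod_mult.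
      apply Rplus_le_compat; [exact Hs'|]. apply Rmult_le_compat_r; [apply Cmod_ge_0|exact Hc]. }
    unfold nu in Hfin. lra. }
  intros s Hs.
  (* Points with [Re s = 1/2] are reached as limits from the right. *)
  set (A := fun z => HF z - Cexp (dsum beta z X) * HG z).
  assert (HA : forall z, contC A z).
  { intros z. apply holo_cont, holo_minus; [apply (lr_holo_F _ _ _ _ HR)|].
    apply holo_mult; [|apply (lr_holo_G _ _ _ _ HR)].
    apply (holo_comp Cexp (fun s => dsum beta s X)); [apply holo_dsum|apply holo_Cexp]. }
  assert (HG' : forall z, contC HG z) by (intros; apply holo_cont, (lr_holo_G _ _ _ _ HR)).
  assert (Hline : forall (f : C -> C), (forall z, contC f z) ->
     continuous (fun t : R => Cmod (f (s + RtoC t))) 0%R).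
  { intros f Hf.
    apply (continuous_comp (U := R_UniformSpace) (V := C_UniformSpace) (fun t => f (s + RtoC t)) Cmod);
      [|apply continuous_Cmod].
    apply (contC_RtoC_comp (fun t => s + RtoC t) f); [|apply Hf].
    apply contC_plus; [apply contC_const|].
    apply continuous_pairC; [apply continuous_id|apply continuous_const]. }
  assert (H0 : (Cmod (A (s + RtoC 0)%C) + - eps * Cmod (HG (s + RtoC 0)%C) <= 0)%R).
  { apply (Rle_limit_right (fun t => Cmod (A (s + RtoC t)%C) + - eps * Cmod (HG (s + RtoC t)%C))%R).
    - apply (continuous_plus (V := R_NormedModule)); [now apply Hline|].
      apply (continuous_scal_r (V := R_NormedModule)). now apply Hline.
    - intros t Ht. assert (H := Hopen (s + RtoC t)). unfold A.
      replace (Re (s + RtoC t)) with (Re s + t)%R in H by (destruct s; reflexivity).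
      specialize (H ltac:(lra)). lra. }
  rewrite Cplus_0_r in H0. unfold A in H0. lra.
Qed.

(** * The Gamma function *)

Definition convC (u : nat -> C) (l : C) : Prop :=
  forall eps : R, (0 < eps)%R -> exists N, forall n, (N <= n)%nat -> (Cmod (u n - l) < eps)%R.

Lemma Clim_unique (u : nat -> C) (l : C) : convC u l -> Clim u = l.
Proof.
  intros H. unfold Clim.
  assert (H1 : is_lim_seq (fun n => Re (u n)) (Re l)).
  { apply is_lim_seq_spec. intros eps. destruct (H eps (cond_pos eps)) as [N HN].
    exists N. intros n Hn. eapply Rle_lt_trans; [apply re_sub_abs_le|now apply HN]. }
  assert (H2 : is_lim_seq (fun n => Im (u n)) (Im l)).
  { apply is_lim_seq_spec. intros eps. destruct (H eps (cond_pos eps)) as [N HN].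
    exists N. intros n Hn. eapply Rle_lt_trans; [apply im_sub_abs_le|now apply HN]. }
  apply is_lim_seq_unique in H1. apply is_lim_seq_unique in H2.
  rewrite H1, H2. destruct l; reflexivity.
Qed.

Lemma convC_cauchy (u : nat -> C) :
  (forall eps, (0 < eps)%R -> exists N, forall n m, (N <= n)%nat -> (n <= m)%nat -> (Cmod (u m - u n) < eps)%R) ->
  exists l, convC u l.
Proof.
  intros H.
  assert (Hp : forall p : C -> R, (forall z w, (Rabs (p z - p w) <= Cmod (z - w))%R) -> exists x, Un_cv (fun n => p (u n)) x).
  { intros p Hp. assert (Hc : Cauchy_crit (fun n => p (u n))).
    { intros eps He. destruct (H eps He) as [N HN]. exists N. intros n m Hn Hm. unfold Rdist.
      eapply Rle_lt_trans; [apply Hp|]. destruct (Nat.le_ge_cases n m).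
      - rewrite Cmod_sub_sym. apply HN; assumption.
      - apply HN; assumption. }
    destruct (Rcomplete.R_complete _ Hc) as [x Hx]. now exists x. }
  destruct (Hp Re re_sub_abs_le) as [x Hx].
  destruct (Hp Im im_sub_abs_le) as [y Hy].
  exists (x, y). intros eps He.
  destruct (Hx (eps / 2)%R ltac:(lra)) as [N1 H1]. destruct (Hy (eps / 2)%R ltac:(lra)) as [N2 H2].
  exists (max N1 N2). intros n Hn.
  specialize (H1 n ltac:(lia)). specialize (H2 n ltac:(lia)). unfold Rdist in *.
  eapply Rle_lt_trans; [apply Cmod_le_re_im|].
  replace (Re (u n - (x, y))) with (Re (u n) - x)%R by (destruct (u n); unfold Re; simpl; ring).
  replace (Im (u n - (x, y))) with (Im (u n) - y)%R by (destruct (u n); unfold Im; simpl; ring).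
  lra.
Qed.

Lemma convC_le (u v : nat -> C) (l l' : C) (M : R) :
  convC u l -> convC v l' -> (forall n, (Cmod (u n) <= M * Cmod (v n))%R) -> (0 <= M)%R ->
  (Cmod l <= M * Cmod l')%R.
Proof.
  intros Hu Hv H HM. apply Rnot_lt_le. intros Hlt.
  set (d := ((Cmod l - M * Cmod l') / (2 * (M + 1)))%R).
  assert (Hd : (0 < d)%R) by (apply Rdiv_lt_0_compat; lra).
  destruct (Hu d Hd) as [N1 H1]. destruct (Hv d Hd) as [N2 H2].
  specialize (H1 (max N1 N2) ltac:(lia)). specialize (H2 (max N1 N2) ltac:(lia)).
  specialize (H (max N1 N2)). set (n := max N1 N2) in *.
  assert (T1 := Cmod_triangle_sub l (u n)). rewrite Cmod_sub_sym in T1.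
  assert (T2 := Cmod_triangle_sub (v n) l').
  assert (E : ((M + 1) * d = (Cmod l - M * Cmod l') / 2)%R) by (unfold d; field; lra).
  nra.
Qed.

Lemma convC_mult (u v : nat -> C) (l l' : C) :
  convC u l -> convC v l' -> convC (fun n => u n * v n) (l * l').
Proof.
  intros Hu Hv eps He.
  set (M := (Cmod l + Cmod l' + 1)%R).
  assert (H1 := Cmod_ge_0 l). assert (H2 := Cmod_ge_0 l').
  assert (Hd : (0 < Rmin 1 (eps / (2 * M)))%R)
    by (apply Rmin_pos; [lra|apply Rdiv_lt_0_compat; unfold M; lra]).
  destruct (Hu _ Hd) as [N1 HN1]. destruct (Hv _ Hd) as [N2 HN2].
  exists (max N1 N2). intros n Hn.
  specialize (HN1 n ltac:(lia)). specialize (HN2 n ltac:(lia)).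
  assert (A1 := Rlt_le_trans _ _ _ HN1 (Rmin_l _ _)).
  assert (A2 := Rlt_le_trans _ _ _ HN1 (Rmin_r _ _)).
  assert (A3 := Rlt_le_trans _ _ _ HN2 (Rmin_r _ _)).
  replace (u n * v n - l * l') with ((u n - l) * (v n - l') + (u n - l) * l' + l * (v n - l')) by ring.
  assert (Hs : (M * (eps / (2 * M)) = eps / 2)%R) by (field; unfold M; lra).
  eapply Rle_lt_trans; [apply Cmod_triangle|].
  eapply Rle_lt_trans; [apply Rplus_le_compat_r, Cmod_triangle|].
  rewrite !Cmod_mult.
  assert (B1 := Cmod_ge_0 (u n - l)). assert (B2 := Cmod_ge_0 (v n - l')).
  unfold M in *. nra.
Qed.

Lemma convC_minus (u v : nat -> C) (l l' : C) :
  convC u l -> convC v l' -> convC (fun n => u n - v n) (l - l').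
Proof.
  intros Hu Hv eps He.
  destruct (Hu (eps / 2)%R ltac:(lra)) as [N1 HN1]. destruct (Hv (eps / 2)%R ltac:(lra)) as [N2 HN2].
  exists (max N1 N2). intros n Hn. specialize (HN1 n ltac:(lia)). specialize (HN2 n ltac:(lia)).
  replace (u n - v n - (l - l')) with ((u n - l) - (v n - l')) by ring.
  eapply Rle_lt_trans; [apply Cmod_triangle|]. rewrite Cmod_opp. lra.
Qed.

Lemma Cprod_one_plus_sub_1_le (w : nat -> C) (n : nat) :
  (Cmod (Cprod (fun k => 1 + w k)%C n - 1) <= exp (Rsum (fun k => Cmod (w k)) n) - 1)%R.
Proof.
  induction n as [|n IH].
  - simpl. replace (1 - 1) with (RtoC 0) by ring. rewrite Cmod_0, exp_0. lra.
  - simpl. rewrite exp_plus. set (P := Cprod (fun k => 1 + w k)%C n) in *.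
    replace (P * (1 + w n) - 1) with ((P - 1) * (1 + w n) + w n) by ring.
    eapply Rle_trans; [apply Cmod_triangle|]. rewrite Cmod_mult.
    assert (H1 : (Cmod (1 + w n) <= exp (Cmod (w n)))%R).
    { eapply Rle_trans; [apply Cmod_triangle|]. rewrite Cmod_1.
      assert (H := exp_ineq1_le (Cmod (w n))). lra. }
    assert (H2 := exp_ineq1_le (Cmod (w n))). assert (H3 := Cmod_ge_0 (P - 1)).
    assert (H4 := Cmod_ge_0 (1 + w n)). nra.
Qed.

Lemma Cprod_add (f : nat -> C) (n m : nat) :
  Cprod f (n + m) = Cprod f n * Cprod (fun k => f (n + k)%nat) m.
Proof.
  induction m as [|m IH]; [rewrite Nat.add_0_r; simpl; ring|].
  rewrite Nat.add_succ_r. simpl. rewrite IH. ring.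
Qed.

Lemma Rsum_add (f : nat -> R) (n m : nat) :
  Rsum f (n + m) = (Rsum f n + Rsum (fun k => f (n + k)%nat) m)%R.
Proof.
  induction m as [|m IH]; [rewrite Nat.add_0_r; simpl; ring|].
  rewrite Nat.add_succ_r. simpl. rewrite IH. ring.
Qed.

(** The bound [1/4] keeps all partial products within [exp (1/4) - 1 <= 1/2] of 1, so the limit
    cannot be 0. *)
Lemma Cprod_converges (w : nat -> C) :
  (forall n, (Rsum (fun k => Cmod (w k)) n <= 1 / 4)%R) ->
  exists l : C, l <> 0 /\ convC (Cprod (fun k => 1 + w k)%C) l.
Proof.
  intros Hw.
  assert (H4 : (exp (1 / 4) - 1 <= 1 / 2)%R).
  { assert (H := exp_taylor1_le (1 / 4) ltac:(rewrite Rabs_pos_eq; lra)). lra. }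
  assert (Hb : forall n, (Cmod (Cprod (fun k => 1 + w k)%C n - 1) <= 1 / 2)%R).
  { intros n. eapply Rle_trans; [apply Cprod_one_plus_sub_1_le|].
    apply Rle_trans with (exp (1 / 4) - 1)%R; [|exact H4].
    apply Rplus_le_compat_r, exp_le_mono, Hw. }
  destruct (convC_cauchy (Cprod (fun k => 1 + w k)%C)) as [l Hl].
  { intros eps He.
    set (d := Rmin (1 / 2) (eps / 12)). assert (Hd : (0 < d)%R) by (apply Rmin_pos; lra).
    destruct (bounded_Rsum_cauchy (fun k => Cmod (w k)) (1 / 4) d
      (fun k => Cmod_ge_0 _) Hw Hd) as [N HN].
    exists N. intros n m Hn Hm. specialize (HN n m Hn Hm).
    replace m with (n + (m - n))%nat in HN |- * by lia. rewrite Rsum_add in HN. rewrite Cprod_add.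
    set (P := Cprod (fun k => 1 + w k)%C n) in *.
    set (Q := Cprod (fun k => 1 + w (n + k)%nat) (m - n)).
    replace (P * Q - P) with (P * (Q - 1)) by ring. rewrite Cmod_mult.
    assert (HP : (Cmod P <= 2)%R).
    { assert (T := Cmod_triangle (P - 1) 1). replace (P - 1 + 1) with P in T by ring.
      rewrite Cmod_1 in T. specialize (Hb n). fold P in Hb. lra. }
    assert (HQ : (Cmod (Q - 1) <= exp d - 1)%R).
    { unfold Q. eapply Rle_trans; [apply Cprod_one_plus_sub_1_le|].
      apply Rplus_le_compat_r, exp_le_mono. lra. }
    assert (D1 : (d <= 1 / 2)%R) by apply Rmin_l. assert (D2 : (d <= eps / 12)%R) by apply Rmin_r.
    assert (He1 := exp_taylor1_le d ltac:(rewrite Rabs_pos_eq; lra)).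
    assert (exp d - 1 <= 2 * d)%R by nra.
    assert (HP0 := Cmod_ge_0 P). assert (HQ0 := Cmod_ge_0 (Q - 1)).
    apply Rle_lt_trans with (2 * (2 * d))%R; [apply Rmult_le_compat; lra|lra]. }
  exists l. split; [|exact Hl].
  intros E. destruct (Hl (1 / 2)%R ltac:(lra)) as [N HN]. specialize (HN N (Nat.le_refl N)).
  specialize (Hb N). rewrite E in HN.
  set (P := Cprod (fun k => 1 + w k)%C N) in *.
  assert (T := Cmod_triangle (P - 0) (- (P - 1))).
  replace (P - 0 + - (P - 1)) with (RtoC 1) in T by ring. rewrite Cmod_opp, Cmod_1 in T. lra.
Qed.

Definition gauss (s : C) (n : nat) : C :=
  INR (fact n) * Rcpow (INR n) s / Cprod (fun k => s + INR k) (S n).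

Lemma add_INR_neq_0 (s : C) (k : nat) : (0 < Re s)%R -> s + INR k <> 0.
Proof.
  intros Hs E. apply (f_equal Re) in E.
  replace (Re (s + INR k)) with (Re s + INR k)%R in E by (destruct s; reflexivity).
  assert (H := pos_INR k). simpl in E. lra.
Qed.

Lemma Cprod_add_INR_neq_0 (s : C) (n : nat) :
  (0 < Re s)%R -> Cprod (fun k => s + INR k) n <> 0.
Proof. intros Hs. apply Cprod_neq_0. intros k _. now apply add_INR_neq_0. Qed.

Lemma gauss_neq_0 (s : C) (n : nat) : (0 < Re s)%R -> gauss s n <> 0.
Proof.
  intros Hs. unfold gauss. apply Cmult_neq_0; [apply Cmult_neq_0|].
  - intros E. apply RtoC_inj in E. revert E. apply INR_fact_neq_0.
  - apply Cexp_neq_0.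
  - intros E.
    assert (H := Cprod_add_INR_neq_0 s (S n) Hs).
    apply C1_nz. rewrite <- (Cinv_l _ H), E. ring.
Qed.

(** The quotient of consecutive terms of [gauss], with [(1 + 1/n)^s] written as an exponential. *)
Definition gauss_step (s : C) (n : nat) : C :=
  INR (S n) * Cexp (s * (ln (INR (S n)) - ln (INR n))%R) / (s + INR (S n)).

Lemma gauss_S (s : C) (n : nat) :
  (0 < Re s)%R -> gauss s (S n) = gauss s n * gauss_step s n.
Proof.
  intros Hs. unfold gauss, gauss_step.
  assert (H1 := Cprod_add_INR_neq_0 s (S n) Hs). assert (H2 := add_INR_neq_0 s (S n) Hs).
  change (Cprod (fun k => s + INR k) (S (S n))) with (Cprod (fun k => s + INR k) (S n) * (s + INR (S n))).
  set (P := Cprod (fun k => s + INR k) (S n)) in *.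
  rewrite fact_simpl, mult_INR, RtoC_mult.
  unfold Rcpow.
  replace (s * RtoC (ln (INR (S n)))) with (s * RtoC (ln (INR n)) + s * RtoC (ln (INR (S n)) - ln (INR n))%R)
    by (rewrite RtoC_minus; ring).
  rewrite Cexp_plus. field. auto.
Qed.

Lemma ln_step_bounds (n : nat) : (1 <= n)%nat ->
  (/ INR (S n) <= ln (INR (S n)) - ln (INR n) <= / INR n)%R.
Proof.
  intros Hn. assert (H : (0 < INR n)%R) by (apply lt_0_INR; lia).
  assert (HS : INR (S n) = (INR n + 1)%R) by apply S_INR.
  assert (Hub : forall x, (0 < x)%R -> (ln x <= x - 1)%R).
  { intros x Hx. assert (E := exp_ineq1_le (ln x)). rewrite exp_ln in E by exact Hx. lra. }
  split.
  - assert (E := Hub (INR n / INR (S n))%R ltac:(apply Rdiv_lt_0_compat; lra)).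
    rewrite ln_div in E by lra.
    replace (INR n / INR (S n) - 1)%R with (- / INR (S n))%R in E by (rewrite HS; field; lra). lra.
  - assert (E := Hub (INR (S n) / INR n)%R ltac:(apply Rdiv_lt_0_compat; lra)).
    rewrite ln_div in E by lra.
    replace (INR (S n) / INR n - 1)%R with (/ INR n)%R in E by (rewrite HS; field; lra). lra.
Qed.

(** The contributions of order [1/n] from the exponential and from [(n+1)/(s+n+1)] cancel, leaving a
    summable deviation. *)
Lemma gauss_step_bound (s : C) (n : nat) :
  (0 < Re s)%R -> (1 <= n)%nat -> (2 * Cmod s <= INR n)%R ->
  (Cmod (gauss_step s n - 1) <= (4 * Cmod s ^ 2 + Cmod s) * / INR n ^ 2)%R.
Proof.
  intros Hs Hn Hsn. set (d := (ln (INR (S n)) - ln (INR n))%R).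
  assert (Hd := ln_step_bounds n Hn). fold d in Hd.
  assert (H : (0 < INR n)%R) by (apply lt_0_INR; lia).
  assert (HS : INR (S n) = (INR n + 1)%R) by apply S_INR.
  assert (Hs0 := Cmod_ge_0 s).
  assert (Hi : (0 < / INR n)%R) by now apply Rinv_0_lt_compat.
  assert (HiS : (0 < / INR (S n))%R) by (apply Rinv_0_lt_compat; lra).
  assert (Hne := add_INR_neq_0 s (S n) Hs).
  set (E := Cexp (s * RtoC d) - 1 - s * RtoC d).
  assert (Hmod : Cmod (s * RtoC d) = (Cmod s * d)%R)
    by (rewrite Cmod_mult, Cmod_R, Rabs_pos_eq; [reflexivity|lra]).
  assert (Hsd : (Cmod s * d <= Cmod s * / INR n)%R) by (apply Rmult_le_compat_l; lra).
  assert (Hhalf : (Cmod s * / INR n <= 1 / 2)%R).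
  { apply Rmult_le_reg_r with (INR n); [exact H|]. rewrite Rmult_assoc, Rinv_l by lra. lra. }
  assert (HE : (Cmod E <= 4 * (Cmod s * / INR n) ^ 2)%R).
  { unfold E. eapply Rle_trans; [apply Cexp_taylor1; rewrite Hmod; lra|].
    rewrite Hmod. apply Rmult_le_compat_l; [lra|]. apply pow_incr. split; [|exact Hsd].
    apply Rmult_le_pos; lra. }
  replace (gauss_step s n - 1) with ((INR (S n) * E + s * RtoC (INR (S n) * d - 1)) / (s + INR (S n))).
  2:{ unfold gauss_step, E. fold d. rewrite RtoC_minus, RtoC_mult. field. exact Hne. }
  rewrite Cmod_div by exact Hne.
  assert (Hden : (INR (S n) <= Cmod (s + INR (S n)))%R).
  { assert (R1 := re_le_Cmod (s + INR (S n))).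
    replace (Re (s + INR (S n))) with (Re s + INR (S n))%R in R1 by (destruct s; reflexivity).
    rewrite Rabs_pos_eq in R1; lra. }
  assert (Hnum : (Cmod (INR (S n) * E + s * RtoC (INR (S n) * d - 1)) <=
     INR (S n) * (4 * (Cmod s * / INR n) ^ 2) + Cmod s * / INR n)%R).
  { eapply Rle_trans; [apply Cmod_triangle|]. rewrite !Cmod_mult, !Cmod_R.
    rewrite (Rabs_pos_eq (INR (S n))) by lra.
    apply Rplus_le_compat; [apply Rmult_le_compat_l; lra|].
    apply Rmult_le_compat_l; [exact Hs0|]. apply Rabs_le.
    destruct Hd as [Hd1 Hd2].
    apply Rmult_le_compat_l with (r := INR (S n)) in Hd1; [|lra].
    apply Rmult_le_compat_l with (r := INR (S n)) in Hd2; [|lra].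
    rewrite Rinv_r in Hd1 by lra.
    replace (INR (S n) * / INR n)%R with (1 + / INR n)%R in Hd2 by (rewrite HS; field; lra). lra. }
  apply Rmult_le_reg_r with (Cmod (s + INR (S n))); [lra|].
  unfold Rdiv. rewrite Rmult_assoc, Rinv_l, Rmult_1_r by lra.
  eapply Rle_trans; [exact Hnum|].
  apply Rle_trans with ((4 * Cmod s ^ 2 + Cmod s) * / INR n ^ 2 * INR (S n))%R.
  - replace ((4 * Cmod s ^ 2 + Cmod s) * / INR n ^ 2 * INR (S n))%R with
      (INR (S n) * (4 * (Cmod s * / INR n) ^ 2) + Cmod s * / INR n * (INR (S n) / INR n))%R by (field; lra).
    apply Rplus_le_compat_l.
    rewrite <- (Rmult_1_r (Cmod s * / INR n)) at 1. apply Rmult_le_compat_l.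
    + apply Rmult_le_pos; lra.
    + apply Rmult_le_reg_r with (INR n); [exact H|]. unfold Rdiv. rewrite Rmult_assoc, Rinv_l; lra.
  - apply Rmult_le_compat_l; [|exact Hden]. apply Rmult_le_pos; [nra|].
    apply Rlt_le, Rinv_0_lt_compat, pow_lt, H.
Qed.

(** [CGamma] is defined through [Clim], which is junk without convergence. Beyond some [n0] the
    sequence is a product of steps whose deviations add up to at most [1/4], which gives convergence
    and non-vanishing together. *)
Theorem gauss_converges (s : C) : (0 < Re s)%R ->
  CGamma s <> 0 /\ convC (gauss s) (CGamma s).
Proof.
  intros Hs. assert (Hs0 := Cmod_ge_0 s).
  set (A := (4 * Cmod s ^ 2 + Cmod s)%R). assert (HA : (0 <= A)%R) by (unfold A; nra).
  (* The part [2 |s|] puts the step estimate in force; the part [4 A] brings the tail [A / n0] below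
     [1/4]. *)
  destruct (INR_unbounded (2 * Cmod s + 4 * A + 1)%R) as [n0 Hn0].
  assert (Hn1 : (1 <= n0)%nat) by (apply INR_le; simpl; lra).
  set (w := fun k => gauss_step s (S (n0 + k)) - 1).
  assert (Hw : forall n, (Rsum (fun k => Cmod (w k)) n <= 1 / 4)%R).
  { intros n. apply Rle_trans with (A * (Rsum (fun k => / INR (S k) ^ 2) (n0 + n) - Rsum (fun k => / INR (S k) ^ 2) n0))%R.
    - rewrite Rsum_add.
      replace (A * (Rsum (fun k => / INR (S k) ^ 2) n0 + Rsum (fun k => / INR (S (n0 + k)) ^ 2) n - Rsum (fun k => / INR (S k) ^ 2) n0))%R
        with (A * Rsum (fun k => / INR (S (n0 + k)) ^ 2)%R n)%R by ring.
      rewrite <- Rsum_mult_l. apply Rsum_le. intros k _. unfold w.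
      apply gauss_step_bound; [exact Hs|lia|].
      assert (H : (INR n0 <= INR (S (n0 + k)))%R) by (apply le_INR; lia). lra.
    - assert (H := Rsum_inv_sq_tail n0 (n0 + n) ltac:(lia)).
      assert (H1 : (0 < / INR (n0 + n))%R) by (apply Rinv_0_lt_compat, lt_0_INR; lia).
      assert (HA' : (A * / INR n0 <= 1 / 4)%R).
      { apply Rmult_le_reg_r with (INR n0); [lra|]. rewrite Rmult_assoc, Rinv_l by lra. lra. }
      eapply Rle_trans; [|exact HA']. apply Rmult_le_compat_l; [exact HA|lra]. }
  destruct (Cprod_converges w Hw) as [l [Hl0 Hl]].
  assert (Hg : forall n, gauss s (S n0 + n) = gauss s (S n0) * Cprod (fun k => 1 + w k)%C n).
  { induction n as [|n IH]; [rewrite Nat.add_0_r; simpl; ring|].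
    rewrite Nat.add_succ_r, gauss_S, IH by exact Hs. unfold w. simpl. ring. }
  assert (Hconv : convC (gauss s) (gauss s (S n0) * l)).
  { intros eps He.
    assert (Hc := proj1 (Cmod_gt_0 _) (gauss_neq_0 s (S n0) Hs)).
    destruct (Hl (eps / Cmod (gauss s (S n0)))%R ltac:(now apply Rdiv_lt_0_compat)) as [N HN].
    exists (S n0 + N)%nat. intros n Hn.
    replace n with (S n0 + (n - S n0))%nat by lia. rewrite Hg.
    specialize (HN (n - S n0)%nat ltac:(lia)).
    match goal with |- (Cmod (?a * ?b - _) < _)%R => replace (a * b - a * l) with (a * (b - l)) by ring end.
    rewrite Cmod_mult.
    apply Rmult_lt_compat_l with (r := Cmod (gauss s (S n0))) in HN; [|exact Hc].
    replace (Cmod (gauss s (S n0)) * (eps / Cmod (gauss s (S n0))))%R with eps in HN by (field; lra).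
    exact HN. }
  assert (E : CGamma s = gauss s (S n0) * l) by (apply Clim_unique; exact Hconv).
  rewrite E. split; [|exact Hconv]. apply Cmult_neq_0; [now apply gauss_neq_0|exact Hl0].
Qed.

(** The finite form of [Gamma(s)^2 / (Gamma(s+iu) Gamma(s-iu)) = prod (1 + u^2/(s+k)^2)]: factorials
    and powers of [n] cancel, and [(s+k)^2 + u^2] splits as [(s+k+iu)(s+k-iu)]. *)
Lemma gauss_sq (s : C) (u : R) (n : nat) : (0 < Re s)%R ->
  gauss s n * gauss s n = gauss (s + (0, u)%R) n * gauss (s - (0, u)%R) n *
    Cprod (fun k => 1 + RtoC (u ^ 2) / ((s + INR k) * (s + INR k))) (S n).
Proof.
  intros Hs.
  assert (Hp : (0 < Re (s + (0, u)%R))%R) by (destruct s; unfold Re in *; simpl in *; lra).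
  assert (Hm : (0 < Re (s - (0, u)%R))%R) by (destruct s; unfold Re in *; simpl in *; lra).
  unfold gauss.
  assert (E : Cprod (fun k => s + (0, u)%R + INR k) (S n) * Cprod (fun k => s - (0, u)%R + INR k) (S n)
     = Cprod (fun k => s + INR k) (S n) * Cprod (fun k => s + INR k) (S n) *
       Cprod (fun k => 1 + RtoC (u ^ 2) / ((s + INR k) * (s + INR k))) (S n)).
  { rewrite <- !Cprod_mult. apply Cprod_ext. intros k _. assert (H := add_INR_neq_0 s k Hs).
    replace (RtoC (u ^ 2)) with (- ((0, u)%R * (0, u)%R) : C)
      by (apply injective_projections; simpl; ring).
    field. exact H. }
  assert (E2 : Rcpow (INR n) (s + (0, u)%R) * Rcpow (INR n) (s - (0, u)%R) = Rcpow (INR n) s * Rcpow (INR n) s).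
  { rewrite <- !Rcpow_plus. f_equal. ring. }
  assert (H1 := Cprod_add_INR_neq_0 _ (S n) Hs).
  assert (H2 := Cprod_add_INR_neq_0 _ (S n) Hp).
  assert (H3 := Cprod_add_INR_neq_0 _ (S n) Hm).
  set (P := Cprod (fun k => s + INR k) (S n)) in *.
  set (P1 := Cprod (fun k => s + (0, u)%R + INR k) (S n)) in *.
  set (P2 := Cprod (fun k => s - (0, u)%R + INR k) (S n)) in *.
  set (V := Cprod (fun k => 1 + RtoC (u ^ 2) / ((s + INR k) * (s + INR k))) (S n)) in *.
  transitivity (INR (fact n) * INR (fact n) * (Rcpow (INR n) s * Rcpow (INR n) s) / (P * P)).
  { field. exact H1. }
  rewrite <- E2.
  transitivity (INR (fact n) * INR (fact n) * (Rcpow (INR n) (s + (0, u)%R) * Rcpow (INR n) (s - (0, u)%R)) / (P1 * P2) * V).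
  2:{ field. auto. }
  assert (HV : V <> 0).
  { intros HV. apply (Cmult_neq_0 _ _ H2 H3). rewrite E, HV. ring. }
  rewrite E. field. auto.
Qed.

Lemma Rsum_inv_shift_sq_le (y : R) (n : nat) : (1 < y)%R ->
  (Rsum (fun k => / (INR k + y) ^ 2) n <= / (y - 1))%R.
Proof.
  intros Hy.
  enough (H : (Rsum (fun k => / (INR k + y) ^ 2) n <= / (y - 1) - / (INR n + y - 1))%R).
  { assert (H0 := pos_INR n).
    assert (0 < / (INR n + y - 1))%R by (apply Rinv_0_lt_compat; lra). lra. }
  induction n as [|n IH].
  - simpl. rewrite Rplus_0_l. lra.
  - rewrite Rsum_S, S_INR. assert (H0 := pos_INR n).
    assert (E : (/ (INR n + y) ^ 2 <= / (INR n + y - 1) - / (INR n + 1 + y - 1))%R).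
    { replace (INR n + 1 + y - 1)%R with (INR n + y)%R by ring. set (x := (INR n + y)%R).
      assert (Hx : (1 < x)%R) by (unfold x; lra).
      apply Rmult_le_reg_r with (x ^ 2 * (x - 1))%R; [apply Rmult_lt_0_compat; [apply pow_lt; lra|lra]|].
      replace (/ x ^ 2 * (x ^ 2 * (x - 1)))%R with (x - 1)%R by (field; lra).
      replace ((/ (x - 1) - / x) * (x ^ 2 * (x - 1)))%R with x by (field; lra). lra. }
    lra.
Qed.

(** By the product formula the deviation from 1 is governed by [sum u^2/|s+k|^2], which is of order
    [u^2 / Im s]. *)
Theorem CGamma_second_difference (s : C) (u : R) : (0 < Re s)%R -> (1 < Im s)%R ->
  (Cmod (CGamma s * CGamma s / (CGamma (s + (0, u)%R) * CGamma (s - (0, u)%R)) - 1)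
    <= exp (2 * u ^ 2 / (Im s - 1)) - 1)%R.
Proof.
  intros Hs Hy.
  assert (Hp : (0 < Re (s + (0, u)%R))%R) by (destruct s; unfold Re in *; simpl in *; lra).
  assert (Hm : (0 < Re (s - (0, u)%R))%R) by (destruct s; unfold Re in *; simpl in *; lra).
  destruct (gauss_converges _ Hs) as [_ H1].
  destruct (gauss_converges _ Hp) as [N2 H2].
  destruct (gauss_converges _ Hm) as [N3 H3].
  set (g := CGamma s) in *. set (gp := CGamma (s + (0, u)%R)) in *. set (gm := CGamma (s - (0, u)%R)) in *.
  assert (HM : (0 <= exp (2 * u ^ 2 / (Im s - 1)) - 1)%R).
  { assert (H := exp_ineq1_le (2 * u ^ 2 / (Im s - 1))).
    assert (0 <= 2 * u ^ 2 / (Im s - 1))%R; [|lra].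
    apply Rdiv_le_0_compat; [|lra]. assert (H0 := pow2_ge_0 u). lra. }
  assert (Hlim : (Cmod (g * g - gp * gm) <= (exp (2 * u ^ 2 / (Im s - 1)) - 1) * Cmod (gp * gm))%R).
  { apply (convC_le (fun n => gauss s n * gauss s n - gauss (s + (0, u)%R) n * gauss (s - (0, u)%R) n)
      (fun n => gauss (s + (0, u)%R) n * gauss (s - (0, u)%R) n)).
    - apply convC_minus; now apply convC_mult.
    - now apply convC_mult.
    - intros n. rewrite (gauss_sq s u n Hs).
      set (x := gauss (s + (0, u)%R) n * gauss (s - (0, u)%R) n).
      match goal with |- (Cmod (x * ?P - x) <= _)%R => replace (x * P - x) with ((P - 1) * x) by ring end.
      rewrite Cmod_mult. apply Rmult_le_compat_r; [apply Cmod_ge_0|].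
      eapply Rle_trans; [apply (Cprod_one_plus_sub_1_le (fun k => RtoC (u ^ 2) / ((s + INR k) * (s + INR k))))|].
      apply Rplus_le_compat_r, exp_le_mono.
      assert (Hsum : (Rsum (fun k => Cmod (RtoC (u ^ 2) / ((s + INR k) * (s + INR k)))) (S n) <= 2 * u ^ 2 / (Im s - 1))%R).
      { apply Rle_trans with (Rsum (fun k => 2 * u ^ 2 * / (INR k + Im s) ^ 2)%R (S n)).
        - apply Rsum_le. intros k _. assert (Hk := add_INR_neq_0 s k Hs).
          rewrite Cmod_div by (now apply Cmult_neq_0). rewrite Cmod_mult, Cmod_R.
          rewrite Rabs_pos_eq by apply pow2_ge_0.
          assert (Hk0 := pos_INR k).
          (* This is [(x + y)^2 <= 2 (x^2 + y^2)] with [x = k] and [y = Im s]; the positive real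
             part of [s] only increases the modulus. *)
          assert (Hsq : ((INR k + Im s) ^ 2 <= 2 * (Cmod (s + INR k) * Cmod (s + INR k)))%R).
          { assert (E : (Cmod (s + INR k) * Cmod (s + INR k) = (Re s + INR k) ^ 2 + Im s ^ 2)%R).
            { replace (Cmod (s + INR k) * Cmod (s + INR k))%R with (Cmod (s + INR k) ^ 2)%R by ring.
              rewrite Cmod2_alt. destruct s; unfold Re, Im; simpl; ring. }
            rewrite E. assert (H := pow2_ge_0 (INR k - Im s)). nra. }
          assert (Hpos : (0 < (INR k + Im s) ^ 2)%R) by (apply pow_lt; lra).
          unfold Rdiv. replace (2 * u ^ 2 * / (INR k + Im s) ^ 2)%R with (u ^ 2 * (2 * / (INR k + Im s) ^ 2))%R by ring.
          apply Rmult_le_compat_l; [apply pow2_ge_0|].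
          replace (2 * / (INR k + Im s) ^ 2)%R with (/ ((INR k + Im s) ^ 2 / 2))%R by (field; lra).
          apply Rinv_le_contravar; lra.
        - rewrite Rsum_mult_l. unfold Rdiv. apply Rmult_le_compat_l.
          + assert (H := pow2_ge_0 u). lra.
          + now apply Rsum_inv_shift_sq_le. }
      exact Hsum.
    - exact HM. }
  assert (Hne : gp * gm <> 0) by now apply Cmult_neq_0.
  replace (g * g / (gp * gm) - 1) with ((g * g - gp * gm) / (gp * gm)) by (field; auto).
  rewrite Cmod_div by exact Hne. apply Cmod_gt_0 in Hne.
  apply Rmult_le_reg_r with (Cmod (gp * gm)); [exact Hne|].
  unfold Rdiv. rewrite Rmult_assoc, Rinv_l, Rmult_1_r by lra. exact Hlim.
Qed.

(* The second multiplicative difference of [g] tends to 1: all exponentially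
   and power-like parts of a product of Gamma factors cancel in it. *)
Definition flat_at_infinity (g : R -> C) : Prop :=
  (forall t, g t <> 0) /\
  forall eps U : R, (0 < eps)%R -> exists T0 : R, forall t u, (T0 <= t)%R -> (Rabs u <= U)%R ->
    (Cmod (g t * g t / (g (t + u)%R * g (t - u)%R) - 1) <= eps)%R.

Lemma flat_mult (f g : R -> C) :
  flat_at_infinity f -> flat_at_infinity g -> flat_at_infinity (fun t => f t * g t).
Proof.
  intros [f0 Hf] [g0 Hg]. split; [intros t; now apply Cmult_neq_0|].
  intros eps U He. set (d := Rmin 1 (eps / 3)). assert (Hd : (0 < d)%R) by (apply Rmin_pos; lra).
  destruct (Hf d U Hd) as [T1 H1]. destruct (Hg d U Hd) as [T2 H2].
  exists (Rmax T1 T2). intros t u Ht Hu.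
  specialize (H1 t u (Rle_trans _ _ _ (Rmax_l _ _) Ht) Hu).
  specialize (H2 t u (Rle_trans _ _ _ (Rmax_r _ _) Ht) Hu).
  set (a := f t * f t / (f (t + u)%R * f (t - u)%R)) in *.
  set (b := g t * g t / (g (t + u)%R * g (t - u)%R)) in *.
  replace (f t * g t * (f t * g t) / (f (t + u)%R * g (t + u)%R * (f (t - u)%R * g (t - u)%R)) - 1)
    with ((a - 1) * (b - 1) + (a - 1) + (b - 1)).
  2:{ assert (F1 := f0 (t + u)%R). assert (F2 := f0 (t - u)%R).
      assert (G1 := g0 (t + u)%R). assert (G2 := g0 (t - u)%R).
      unfold a, b. field. auto. }
  assert (D1 : (d <= 1)%R) by apply Rmin_l. assert (D2 : (d <= eps / 3)%R) by apply Rmin_r.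
  eapply Rle_trans; [apply Cmod_triangle|].
  eapply Rle_trans; [apply Rplus_le_compat_r, Cmod_triangle|].
  rewrite Cmod_mult. assert (A := Cmod_ge_0 (a - 1)). assert (B := Cmod_ge_0 (b - 1)). nra.
Qed.

Lemma flat_const_1 : flat_at_infinity (fun _ => 1).
Proof.
  split; [intros; apply C1_nz|]. intros eps U He. exists 0%R. intros t u _ _.
  replace (1 * 1 / (1 * 1) - 1) with (RtoC 0) by (field; apply C1_nz). rewrite Cmod_0. lra.
Qed.

(** The logarithm of [Q^s] is linear in [t], so its second difference is exactly 0. *)
Lemma flat_Rcpow (Q x : R) : flat_at_infinity (fun t => Rcpow Q (x, t)).
Proof.
  split; [intros; apply Cexp_neq_0|]. intros eps U He. exists 0%R. intros t u _ _.
  replace (Rcpow Q (x, t) * Rcpow Q (x, t)) with (Rcpow Q (x, (t + u)%R) * Rcpow Q (x, (t - u)%R)).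
  - assert (H1 : Rcpow Q (x, (t + u)%R) <> 0) by apply Cexp_neq_0.
    assert (H2 : Rcpow Q (x, (t - u)%R) <> 0) by apply Cexp_neq_0.
    match goal with |- (Cmod ?z <= _)%R => replace z with (RtoC 0) by (field; auto) end.
    rewrite Cmod_0. lra.
  - rewrite <- !Rcpow_plus. f_equal. apply injective_projections; simpl; ring.
Qed.

Lemma flat_CGamma (lam x : R) (mu : C) : (0 < lam)%R -> (0 < x)%R -> (0 <= Re mu)%R ->
  flat_at_infinity (fun t => CGamma (RtoC lam * (x, t) + mu)).
Proof.
  intros Hl Hx Hmu.
  assert (Hre : forall t, (0 < Re (RtoC lam * (x, t) + mu))%R).
  { intros t. replace (Re (RtoC lam * (x, t) + mu)) with (lam * x + Re mu)%R
      by (destruct mu; unfold Re; simpl; ring).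
    assert (0 < lam * x)%R by now apply Rmult_lt_0_compat. lra. }
  assert (Him : forall t, Im (RtoC lam * (x, t) + mu) = (lam * t + Im mu)%R)
    by (intros t; destruct mu; unfold Im; simpl; ring).
  split; [intros t; now apply gauss_converges|].
  intros eps U He.
  set (V := (2 * (lam * U) ^ 2)%R).
  assert (HV : (0 <= V)%R) by (unfold V; assert (H := pow2_ge_0 (lam * U)); lra).
  set (d := Rmin (1 / 2) (eps / 2)). assert (Hd : (0 < d)%R) by (apply Rmin_pos; lra).
  set (Y := (V / d + 2)%R). assert (HVd : (0 <= V / d)%R) by (apply Rdiv_le_0_compat; lra).
  exists ((Y - Im mu) / lam)%R. intros t u Ht Hu.
  set (s := RtoC lam * (x, t) + mu).
  replace (RtoC lam * (x, (t + u)%R) + mu) with (s + (0, lam * u)%R)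
    by (unfold s; apply injective_projections; simpl; ring).
  replace (RtoC lam * (x, (t - u)%R) + mu) with (s - (0, lam * u)%R)
    by (unfold s; apply injective_projections; simpl; ring).
  assert (HY : (Y <= Im s)%R).
  { unfold s. rewrite Him. apply Rmult_le_compat_l with (r := lam) in Ht; [|lra].
    replace (lam * ((Y - Im mu) / lam))%R with (Y - Im mu)%R in Ht by (field; lra). lra. }
  assert (HY1 : (1 < Im s)%R) by (unfold Y in HY; lra).
  eapply Rle_trans; [apply (CGamma_second_difference s (lam * u) (Hre t) HY1)|].
  assert (Hle : (2 * (lam * u) ^ 2 / (Im s - 1) <= d)%R).
  { apply Rmult_le_reg_r with ((Im s - 1) / d)%R; [apply Rdiv_lt_0_compat; lra|].
    replace (2 * (lam * u) ^ 2 / (Im s - 1) * ((Im s - 1) / d))%R with (2 * (lam * u) ^ 2 / d)%R by (field; lra).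
    replace (d * ((Im s - 1) / d))%R with (Im s - 1)%R by (field; lra).
    apply Rle_trans with (V / d)%R; [|unfold Y in HY; lra].
    apply Rmult_le_compat_r; [apply Rlt_le, Rinv_0_lt_compat; lra|].
    unfold V. apply Rmult_le_compat_l; [lra|].
    rewrite !Rpow_mult_distr. apply Rmult_le_compat_l; [apply pow2_ge_0|].
    rewrite <- (pow2_abs u). apply pow_incr. split; [apply Rabs_pos|exact Hu]. }
  assert (D1 : (d <= 1 / 2)%R) by apply Rmin_l. assert (D2 : (d <= eps / 2)%R) by apply Rmin_r.
  assert (Hexp := exp_le_mono _ _ Hle).
  assert (He1 := exp_taylor1_le d ltac:(rewrite Rabs_pos_eq; lra)). nra.
Qed.

Lemma flat_gamma_factor (Q : R) (r : nat) (lambda : nat -> R) (mu : nat -> C) :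
  (forall j, (j < r)%nat -> (0 < lambda j)%R /\ (0 <= Re (mu j))%R) ->
  flat_at_infinity (fun t => Rcpow Q ((1 / 2)%R, t) *
    Cprod (fun j => CGamma (lambda j * ((1 / 2)%R, t) + mu j)) r).
Proof.
  intros H. apply flat_mult; [apply flat_Rcpow|].
  induction r as [|r IH]; [apply flat_const_1|].
  apply (flat_mult (fun t => Cprod (fun j => CGamma (lambda j * ((1 / 2)%R, t) + mu j)) r)).
  - apply IH. intros j Hj. apply H. lia.
  - destruct (H r ltac:(lia)) as [H1 H2]. apply flat_CGamma; [exact H1|lra|exact H2].
Qed.

(** * Second differences on the critical line *)

(** On the critical line [1 - conj s = s], so the functional equation relates a value to its own
    conjugate. The Gamma arguments have real part [lambda_j / 2 + Re mu_j > 0], away from all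
    poles. *)
Lemma critical_line_relation (F : C -> C) : functional_equation F ->
  exists (g : R -> C) (omega : C), flat_at_infinity g /\ omega <> 0 /\
    forall t, g t * F ((1 / 2)%R, t) = omega * Cconj (g t * F ((1 / 2)%R, t)).
Proof.
  intros (r & Q & lambda & mu & omega & HQ & Hlm & Hom & Heq).
  exists (fun t => Rcpow Q ((1 / 2)%R, t) * Cprod (fun j => CGamma (lambda j * ((1 / 2)%R, t) + mu j)) r), omega.
  split; [now apply flat_gamma_factor|].
  split; [apply Cmod_gt_0; lra|].
  intros t. assert (E : 1 - Cconj ((1 / 2)%R, t) = ((1 / 2)%R, t))
    by (apply injective_projections; simpl; lra).
  assert (Hd : completed_defined r lambda mu ((1 / 2)%R, t)).
  { split.
    - intros E1. apply (f_equal fst) in E1. simpl in E1. lra.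
    - intros j Hj [k Hk]. destruct (Hlm j Hj) as [Hl Hm]. apply (f_equal Re) in Hk.
      replace (Re (lambda j * ((1 / 2)%R, t) + mu j)) with (lambda j * (1 / 2) + Re (mu j))%R in Hk
        by (destruct (mu j); unfold Re; simpl; ring).
      replace (Re (- INR k)) with (- INR k)%R in Hk by reflexivity.
      assert (H := pos_INR k). lra. }
  specialize (Heq ((1 / 2)%R, t) Hd). rewrite E in Heq. exact (Heq Hd).
Qed.

(** Measuring the deviation from 1 through [exp e - 1] makes the errors of a product add exactly. *)
Definition near (e : R) (z : C) : Prop := (Cmod (z - 1) <= exp e - 1)%R.

Lemma near_mult (e f : R) (a b : C) : near e a -> near f b -> near (e + f) (a * b).
Proof.
  unfold near. intros Ha Hb. rewrite exp_plus.
  replace (a * b - 1) with ((a - 1) * (b - 1) + (a - 1) + (b - 1)) by ring.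
  eapply Rle_trans; [apply Cmod_triangle|].
  eapply Rle_trans; [apply Rplus_le_compat_r, Cmod_triangle|].
  rewrite Cmod_mult. assert (A := Cmod_ge_0 (a - 1)). assert (B := Cmod_ge_0 (b - 1)). nra.
Qed.

Lemma near_of_le (e : R) (a : C) : (Cmod (a - 1) <= e)%R -> near e a.
Proof. intros H. unfold near. assert (E := exp_ineq1_le e). lra. Qed.

Lemma near_1_neq_0 (e : R) (a : C) : (Cmod (a - 1) <= e)%R -> (e <= 1 / 2)%R -> a <> 0.
Proof.
  intros H He E. rewrite E in H. replace (0 - 1) with (- (1)) in H by ring.
  rewrite Cmod_opp, Cmod_1 in H. lra.
Qed.

Lemma near_inv (e : R) (a : C) : (Cmod (a - 1) <= e)%R -> (e <= 1 / 2)%R -> near (2 * e) (/ a).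
Proof.
  intros H He. assert (H0 := near_1_neq_0 e a H He). apply near_of_le.
  replace (/ a - 1) with (- (a - 1) / a) by (field; exact H0).
  rewrite Cmod_div, Cmod_opp by exact H0.
  assert (Ha : (1 / 2 <= Cmod a)%R).
  { assert (T := Cmod_triangle_sub 1 (1 - a)).
    replace (1 - (1 - a)) with a in T by ring.
    rewrite Cmod_1, (Cmod_sub_sym 1 a) in T. lra. }
  apply Rmult_le_reg_r with (Cmod a); [lra|]. unfold Rdiv. rewrite Rmult_assoc, Rinv_l by lra.
  assert (T := Cmod_ge_0 (a - 1)). nra.
Qed.

Lemma conj_ratio_eq (omega a ap am : C) :
  omega <> 0 -> a <> 0 -> a = omega * Cconj a -> ap = omega * Cconj ap -> am = omega * Cconj am ->
  Cconj (ap * am / (a * a)) = ap * am / (a * a).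
Proof.
  intros Ho Ha E Ep Em.
  assert (Hca : Cconj a <> 0).
  { intros E0. apply Ha. rewrite E, E0. ring. }
  rewrite Cdiv_conj by now apply Cmult_neq_0. rewrite !Cmult_conj.
  rewrite Ep at 2. rewrite Em at 2. rewrite E at 3 4. field. auto.
Qed.

Lemma im_minus (z w : C) : Im (z - w) = (Im z - Im w)%R.
Proof. reflexivity. Qed.

(* With [F = n e^L G] and [n] near 1, the unimodular constant of the functional
   equations cancels in second differences, so [e^D kappa] is real for
   [D = L(t+u) + L(t-u) - 2 L(t)] and some [kappa] near 1. *)
Lemma sin_second_difference_le (gF gG : R -> C) (oF oG : C) (f g : R -> C) (L : R -> C) (t u e : R) :
  (forall t, gF t <> 0) -> (forall t, gG t <> 0) -> oF <> 0 -> oG <> 0 ->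
  (forall t, gF t * f t = oF * Cconj (gF t * f t)) ->
  (forall t, gG t * g t = oG * Cconj (gG t * g t)) ->
  (forall x, (x = t \/ x = (t + u)%R \/ x = (t - u)%R) ->
     g x <> 0 /\ (Cmod (f x / (g x * Cexp (L x)) - 1) <= e)%R) ->
  (Cmod (gF t * gF t / (gF (t + u)%R * gF (t - u)%R) - 1) <= e)%R ->
  (Cmod (gG t * gG t / (gG (t + u)%R * gG (t - u)%R) - 1) <= e)%R ->
  (e <= 1 / 18)%R ->
  (Rabs (sin (Im (L (t + u)%R + L (t - u)%R - 2 * L t))) <= 18 * e)%R.
Proof.
  intros HgF HgG HoF HoG Hf Hg Hn HF HG He.
  destruct (Hn t) as [g0 n0]; [auto|].
  destruct (Hn (t + u)%R) as [gp np]; [auto|].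
  destruct (Hn (t - u)%R) as [gm nm]; [auto|].
  assert (E0 := Cexp_neq_0 (L t)). assert (Ep := Cexp_neq_0 (L (t + u)%R)).
  assert (Em := Cexp_neq_0 (L (t - u)%R)).
  assert (F0 := HgF t). assert (Fp := HgF (t + u)%R). assert (Fm := HgF (t - u)%R).
  assert (G0 := HgG t). assert (Gp := HgG (t + u)%R). assert (Gm := HgG (t - u)%R).
  assert (f0 : f t <> 0).
  { intros E. apply (near_1_neq_0 _ _ n0); [lra|]. rewrite E. field. auto. }
  set (x0 := f t / (g t * Cexp (L t))) in *.
  set (xp := f (t + u)%R / (g (t + u)%R * Cexp (L (t + u)%R))) in *.
  set (xm := f (t - u)%R / (g (t - u)%R * Cexp (L (t - u)%R))) in *.
  set (thF := gF t * gF t / (gF (t + u)%R * gF (t - u)%R)) in *.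
  set (thG := gG t * gG t / (gG (t + u)%R * gG (t - u)%R)) in *.
  set (D := L (t + u)%R + L (t - u)%R - 2 * L t).
  assert (hF : thF <> 0) by (apply (near_1_neq_0 _ _ HF); lra).
  assert (hx0 : x0 <> 0) by (apply (near_1_neq_0 _ _ n0); lra).
  set (kap := xp * xm * / x0 * / x0 * thG * / thF).
  (* Errors: [e] for each of [xp], [xm] and [thG], and [2 e] for each inverse, of [x0] (twice) and
     of [thF]; in total [9 e]. *)
  assert (Hkap : near (9 * e) kap).
  { replace (9 * e)%R with (e + e + 2 * e + 2 * e + e + 2 * e)%R by ring.
    unfold kap. repeat apply near_mult; try (apply near_of_le; assumption);
      apply near_inv; assumption || lra. }
  assert (He0 : (0 <= e)%R) by (eapply Rle_trans; [apply Cmod_ge_0|exact n0]).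
  (* The bound [e <= 1/18] is exactly what makes [9 e + 2 (9 e)^2] at most [18 e]. *)
  assert (Hk : (Cmod (kap - 1) <= 18 * e)%R).
  { unfold near in Hkap. assert (T := exp_taylor1_le (9 * e) ltac:(rewrite Rabs_pos_eq; lra)). nra. }
  assert (Hreal : Cconj (Cexp D * kap) = Cexp D * kap).
  { set (a := fun x => gF x * f x). set (b := fun x => gG x * g x).
    assert (Ez : Cexp D * kap = (a (t + u)%R * a (t - u)%R / (a t * a t)) / (b (t + u)%R * b (t - u)%R / (b t * b t))).
    { unfold D. replace (L (t + u)%R + L (t - u)%R - 2 * L t) with (L (t + u)%R + L (t - u)%R - L t - L t) by ring.
      rewrite !Cexp_minus, Cexp_plus. unfold kap, a, b, thF, thG, x0, xp, xm. field. repeat split; auto. }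
    assert (Ha0 : a t <> 0) by (now apply Cmult_neq_0).
    assert (Hb0 : b t <> 0) by (now apply Cmult_neq_0).
    rewrite Ez, Cdiv_conj.
    - rewrite (conj_ratio_eq oF), (conj_ratio_eq oG); auto; apply Hf || apply Hg.
    - assert (Hbp : b (t + u)%R <> 0) by (now apply Cmult_neq_0).
      assert (Hbm : b (t - u)%R <> 0) by (now apply Cmult_neq_0).
      apply Cmod_gt_0. rewrite Cmod_div by now apply Cmult_neq_0.
      apply Rdiv_lt_0_compat; apply Cmod_gt_0; now apply Cmult_neq_0. }
  assert (Him : Im (Cexp D * kap) = 0%R).
  { assert (H := f_equal Im Hreal). rewrite im_conj in H. lra. }
  (* Since [Cexp D * kap] is real, the imaginary part of [Cexp D] is due to [kap - 1] alone;
     dividing by [|Cexp D|] leaves the sine. *)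
  assert (Him2 : (Im (Cexp D) = - Im (Cexp D * (kap - 1)))%R).
  { replace (Cexp D * (kap - 1)) with (Cexp D * kap - Cexp D) by ring.
    rewrite im_minus, Him. ring. }
  assert (R1 := im_le_Cmod (Cexp D * (kap - 1))). rewrite Cmod_mult, Cmod_Cexp in R1.
  rewrite <- (Rabs_Ropp (Im _)), <- Him2 in R1.
  replace (Im (Cexp D)) with (exp (Re D) * sin (Im D))%R in R1 by reflexivity.
  assert (Hp := exp_pos (Re D)).
  rewrite Rabs_mult, (Rabs_pos_eq (exp _)) in R1 by lra.
  apply Rmult_le_reg_l in R1; [|exact Hp]. lra.
Qed.

Lemma sin_sub_le (a b : R) : (Rabs (sin a - sin b) <= Rabs (a - b))%R.
Proof.
  rewrite form4. rewrite !Rabs_mult.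
  assert (H1 := sin_abs_le ((a - b) / 2)). assert (H2 := COS_bound ((a + b) / 2)).
  assert (H3 : (Rabs (cos ((a + b) / 2)) <= 1)%R) by (apply Rabs_le; lra).
  assert (H4 := Rabs_pos (cos ((a + b) / 2))). assert (H5 := Rabs_pos (sin ((a - b) / 2))).
  assert (H6 : (Rabs ((a - b) / 2) = Rabs (a - b) / 2)%R)
    by (unfold Rdiv; rewrite Rabs_mult, (Rabs_pos_eq (/ 2)) by lra; reflexivity).
  rewrite (Rabs_pos_eq 2) by lra. rewrite H6 in H1. assert (H7 := Rabs_pos (a - b)). nra.
Qed.

(** A small sine only places [q] near a multiple of [PI]. Starting from 0, the continuous function
    [|q|] cannot pass the value [1/2], where the sine is at least [1/4] in modulus, so it stays near
    0. *)
Lemma small_of_small_sin (q : R -> R) (U eta : R) :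
  (0 <= U)%R -> (eta < 1 / 4)%R -> q 0%R = 0%R -> (forall u, continuous q u) ->
  (forall u, (0 <= u <= U)%R -> (Rabs (sin (q u)) <= eta)%R) -> (Rabs (q U) <= 2 * eta)%R.
Proof.
  intros HU He H0 Hc Hs.
  assert (Hlin : forall x, (Rabs x <= 1 / 2)%R -> (Rabs x / 2 <= Rabs (sin x))%R).
  { intros x Hx. assert (S := sin_sub_abs_le x ltac:(lra)).
    assert (T := Rabs_triang_inv x (sin x)). rewrite Rabs_minus_sym in T.
    rewrite <- pow2_abs in S. assert (P := Rabs_pos x). nra. }
  assert (Hhalf : (Rabs (q U) < 1 / 2)%R).
  { apply Rnot_le_lt. intros Hge.
    assert (Hca : forall u, continuous (fun u => Rabs (q u)) u)
      by (intros u; apply (continuous_comp q Rabs); [apply Hc|apply continuous_Rabs]).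
    destruct (IVT_gen (fun u => Rabs (q u)) 0 U (1 / 2)) as [u [Hu Eu]].
    - intros u. apply continuity_pt_filterlim. apply Hca.
    - rewrite H0, Rabs_R0, Rmin_left, Rmax_right; lra.
    - rewrite Rmin_left, Rmax_right in Hu by lra.
      specialize (Hs u Hu). specialize (Hlin (q u)). lra. }
  specialize (Hs U ltac:(lra)). specialize (Hlin (q U)). lra.
Qed.

(** * Almost periodic sums on the critical line *)

Definition line_sum (beta : nat -> C) (X : nat) (t : R) : C := dsum beta ((1 / 2)%R, t) X.

Lemma line_sum_eq (beta : nat -> C) (X : nat) (t : R) :
  line_sum beta X t = Csum (fun k => beta (S k) * RtoC (Rpower (INR (S k)) (- (1 / 2))) * ni (S k) t) X.
Proof.
  unfold line_sum, dsum. apply Csum_ext. intros k _. unfold dirichlet_term.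
  replace (((1 / 2)%R, t) : C) with (RtoC (1 / 2) + (0%R, t))
    by (apply injective_projections; simpl; ring).
  rewrite Rcpow_opp_shift.
  replace (Rcpow (INR (S k)) (- RtoC (1 / 2))) with (RtoC (Rpower (INR (S k)) (- (1 / 2)))).
  - ring.
  - unfold Rcpow, Rpower. rewrite <- RtoC_opp, <- RtoC_mult. symmetry. apply Cexp_RtoC.
Qed.

Lemma line_sum_cont (beta : nat -> C) (X : nat) (t : R) : contRC (line_sum beta X) t.
Proof.
  apply (contRC_vertical (fun s => dsum beta s X)). apply holo_cont, holo_dsum.
Qed.

Lemma contRC_Im (f : R -> C) (t : R) : contRC f t -> continuous (fun x => Im (f x)) t.
Proof.
  intros H. apply (continuous_comp (U := R_UniformSpace) (V := C_UniformSpace) f Im);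
    [exact H|apply continuous_Im].
Qed.

Lemma continuous_eps (f : R -> R) (x eps : R) : continuous f x -> (0 < eps)%R ->
  exists d, (0 < d)%R /\ forall y, (Rabs (y - x) < d)%R -> (Rabs (f y - f x) < eps)%R.
Proof.
  intros Hf He. destruct (proj1 (filterlim_locally f (f x)) Hf (mkposreal eps He)) as [d Hd].
  exists d. split; [apply cond_pos|]. intros y Hy. exact (Hd y Hy).
Qed.

Lemma dense_nonzero (H : C -> C) (x : R) (z1 : C) :
  (forall z, holo H z) -> H z1 <> 0 ->
  forall t d, (0 < d)%R -> exists t', (Rabs (t' - t) < d)%R /\ H (x, t') <> 0.
Proof.
  intros Hh Hz t d Hd. apply NNPP. intros Hn. apply Hz.
  apply (zero_on_segment H x (t - d) (t + d) Hh); [lra|].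
  intros t' Ht'. apply NNPP. intros Hn'. apply Hn. exists t'. split; [|exact Hn'].
  apply Rabs_lt_between. lra.
Qed.

(** The three points form a progression, so they cannot be moved independently: [t'] and a nearby
    right end [p] are chosen first, then the left end [m], whose reflection in [t'] stays close to
    [p], where [H] is nonzero by continuity. *)
Lemma dense_nonzero_triple (H : C -> C) (x : R) (z1 : C) :
  (forall z, holo H z) -> H z1 <> 0 ->
  forall t u d, (0 < d)%R -> exists t' u', (Rabs (t' - t) < d)%R /\ (Rabs (u' - u) < d)%R /\
    H (x, t') <> 0 /\ H (x, (t' + u')%R) <> 0 /\ H (x, (t' - u')%R) <> 0.
Proof.
  intros Hh Hz t u d Hd.
  destruct (dense_nonzero H x z1 Hh Hz t d Hd) as [t' [Ht' N0]].
  destruct (dense_nonzero H x z1 Hh Hz (t' + u) (d / 2) ltac:(lra)) as [p [Hp N1]].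
  assert (Hc : continuous (fun y : R => Cmod (H (x, y))) p).
  { apply (continuous_comp (U := R_UniformSpace) (V := C_UniformSpace) (fun y => H (x, y)) Cmod);
      [|apply continuous_Cmod]. apply contRC_vertical. apply holo_cont, Hh. }
  apply Cmod_gt_0 in N1.
  destruct (continuous_eps _ _ _ Hc N1) as [e [He Hnb]].
  destruct (dense_nonzero H x z1 Hh Hz (2 * t' - p) (Rmin e (d / 2)) ltac:(apply Rmin_pos; lra)) as [m [Hm N2]].
  assert (M1 := Rlt_le_trans _ _ _ Hm (Rmin_l _ _)).
  assert (M2 := Rlt_le_trans _ _ _ Hm (Rmin_r _ _)).
  exists t', (t' - m)%R. apply Rabs_lt_between in Hp. apply Rabs_lt_between in M2.
  repeat split; auto.
  - apply Rabs_lt_between. lra.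
  - apply Cmod_gt_0. replace (t' + (t' - m))%R with (2 * t' - m)%R by ring.
    specialize (Hnb (2 * t' - m)%R). rewrite <- Rabs_Ropp in M1.
    replace (- (m - (2 * t' - p)))%R with (2 * t' - m - p)%R in M1 by ring.
    specialize (Hnb M1). cbv beta in Hnb. apply Rabs_lt_between in Hnb. lra.
  - replace (t' - (t' - m))%R with m by ring. exact N2.
Qed.

Definition D2 (L : R -> C) (t u : R) : C := L (t + u)%R + L (t - u)%R - 2 * L t.

Lemma Im_D2 (L : R -> C) (t u : R) :
  Im (D2 L t u) = (Im (L (t + u)%R) + Im (L (t - u)%R) - 2 * Im (L t))%R.
Proof.
  unfold D2. destruct (L (t + u)%R), (L (t - u)%R), (L t). unfold Im; simpl. ring.
Qed.

Lemma Im_D2_cont (L : R -> C) (t u eps : R) : (forall x, contRC L x) -> (0 < eps)%R ->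
  exists d, (0 < d)%R /\ forall t' u', (Rabs (t' - t) < d)%R -> (Rabs (u' - u) < d)%R ->
    (Rabs (Im (D2 L t' u') - Im (D2 L t u)) < eps)%R.
Proof.
  intros HL He.
  assert (Hc : forall x, continuous (fun y => Im (L y)) x) by (intros; now apply contRC_Im).
  assert (He4 : (0 < eps / 4)%R) by lra.
  destruct (continuous_eps _ _ _ (Hc t) He4) as [d0 [H0 C0]].
  destruct (continuous_eps _ _ _ (Hc (t + u)%R) He4) as [d1 [H1 C1]].
  destruct (continuous_eps _ _ _ (Hc (t - u)%R) He4) as [d2 [H2 C2]].
  set (d := (Rmin d0 (Rmin d1 d2) / 2)%R).
  assert (Hm : (0 < Rmin d0 (Rmin d1 d2))%R) by (repeat apply Rmin_pos; assumption).
  assert (M0 : (2 * d <= d0)%R) by (assert (M := Rmin_l d0 (Rmin d1 d2)); unfold d; lra).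
  assert (M1 : (2 * d <= d1)%R)
    by (assert (M := Rmin_r d0 (Rmin d1 d2)); assert (M' := Rmin_l d1 d2); unfold d; lra).
  assert (M2 : (2 * d <= d2)%R)
    by (assert (M := Rmin_r d0 (Rmin d1 d2)); assert (M' := Rmin_r d1 d2); unfold d; lra).
  exists d. split; [unfold d; lra|]. intros t' u' Ht Hu.
  apply Rabs_lt_between in Ht. apply Rabs_lt_between in Hu.
  specialize (C0 t' ltac:(apply Rabs_lt_between; lra)).
  specialize (C1 (t' + u')%R ltac:(apply Rabs_lt_between; lra)).
  specialize (C2 (t' - u')%R ltac:(apply Rabs_lt_between; lra)).
  rewrite !Im_D2. apply Rabs_lt_between in C0. apply Rabs_lt_between in C1. apply Rabs_lt_between in C2.
  apply Rabs_lt_between. lra.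
Qed.

(** Only the imaginary part of the sum will be under control, and it mixes [n^(-it)] with [n^(it)].
    After multiplication by [(k0+1)^(it)] the conjugate terms have frequencies [log (n (k0+1))],
    nonzero because [k0 >= 1], so they average out. *)
Lemma has_mean_line_coefficient (y : nat -> C) (X k0 : nat) : (1 <= k0)%nat -> (k0 < X)%nat ->
  has_mean (fun t => (Csum (fun k => y k * ni (S k) t) X - Cconj (Csum (fun k => y k * ni (S k) t) X)) *
    Cconj (ni (S k0) t)) (y k0).
Proof.
  intros Hk0 HX.
  assert (H1 : forall Y, has_mean (fun t => Csum (fun k => y k * ni (S k) t) Y * Cconj (ni (S k0) t))
     (if (k0 <? Y)%nat then y k0 else 0)).
  { induction Y as [|Y IH].
    - apply has_mean_ext with (fun _ => 0); [intros; simpl; ring|apply has_mean_const].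
    - apply has_mean_ext with (fun t => Csum (fun k => y k * ni (S k) t) Y * Cconj (ni (S k0) t) +
        y Y * (ni (S Y) t * Cconj (ni (S k0) t))); [intros; simpl; ring|].
      destruct (Nat.eq_dec Y k0) as [->|Hne].
      + replace (k0 <? S k0)%nat with true by (symmetry; apply Nat.ltb_lt; lia).
        rewrite Nat.ltb_irrefl in IH.
        assert (Hg : has_mean (fun t => Csum (fun k => y k * ni (S k) t) k0 * Cconj (ni (S k0) t) +
          y k0 * (ni (S k0) t * Cconj (ni (S k0) t))) (0 + y k0 * 1)).
        { apply has_mean_plus; [exact IH|]. apply has_mean_scal.
          apply has_mean_ext with (fun _ => 1); [|apply has_mean_const].
          intros t. rewrite <- Cmod2_conj, Cmod_ni. f_equal. ring. }
        replace (0 + y k0 * 1) with (y k0) in Hg by ring. exact Hg.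
      + replace (k0 <? S Y)%nat with (k0 <? Y)%nat
          by (destruct (Nat.ltb_spec k0 Y), (Nat.ltb_spec k0 (S Y)); reflexivity || lia).
        replace (if (k0 <? Y)%nat then y k0 else 0) with ((if (k0 <? Y)%nat then y k0 else 0) + y Y * 0)
          by (destruct (k0 <? Y)%nat; ring).
        apply has_mean_plus; [exact IH|]. apply has_mean_scal. apply has_mean_ni_conj_ni; lia. }
  assert (H2 : forall Y, has_mean (fun t => Cconj (Csum (fun k => y k * ni (S k) t) Y) * Cconj (ni (S k0) t)) 0).
  { induction Y as [|Y IH].
    - apply has_mean_ext with (fun _ => 0); [|apply has_mean_const].
      intros t. simpl. apply injective_projections; simpl; ring.
    - apply has_mean_ext with (fun t => Cconj (Csum (fun k => y k * ni (S k) t) Y) * Cconj (ni (S k0) t) +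
        Cconj (y Y) * (ni 1 t * Cconj (ni (S Y * S k0) t))).
      + intros t. rewrite ni_1, ni_mult by lia. rewrite Csum_S, Cplus_conj, !Cmult_conj. ring.
      + replace (RtoC 0) with (0 + Cconj (y Y) * 0) by ring.
        apply has_mean_plus; [exact IH|]. apply has_mean_scal. apply has_mean_ni_conj_ni; lia. }
  specialize (H1 X). replace (k0 <? X)%nat with true in H1 by (symmetry; apply Nat.ltb_lt; lia).
  apply has_mean_ext with (fun t => Csum (fun k => y k * ni (S k) t) X * Cconj (ni (S k0) t) +
    - (1) * (Cconj (Csum (fun k => y k * ni (S k) t) X) * Cconj (ni (S k0) t))); [intros; ring|].
  replace (y k0) with (y k0 + - (1) * 0) by ring.
  apply has_mean_plus; [exact H1|now apply has_mean_scal].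
Qed.

Lemma has_mean_bound (f : R -> C) (mu : C) (T M : R) :
  has_mean f mu -> (forall t, (T <= t)%R -> (Cmod (f t) <= M)%R) -> (Cmod mu <= M)%R.
Proof.
  intros [tau0 [H0 H]] HM. apply Rnot_lt_le. intros Hlt.
  destruct (H (tau0 / 2)%R ltac:(lra) T ((Cmod mu - M) / 2)%R ltac:(lra)) as [J0 HJ].
  specialize (HJ (S J0) ltac:(lia)).
  set (A := Csum (fun j => f (T + INR j * (tau0 / 2))%R) (S J0)) in *.
  assert (HA : (Cmod A <= INR (S J0) * M)%R).
  { unfold A. eapply Rle_trans; [apply Cmod_Csum|]. rewrite <- Rsum_const. apply Rsum_le.
    intros j _. apply HM. assert (Hj := pos_INR j). nra. }
  assert (HJp : (0 < INR (S J0))%R) by (apply lt_0_INR; lia).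
  assert (Tr := Cmod_triangle_sub (INR (S J0) * mu) A).
  rewrite Cmod_sub_sym, Cmod_mult, Cmod_R, Rabs_pos_eq in Tr by lra. nra.
Qed.

(* The second difference with increment [pi / ln n] multiplies the coefficient
   of [n^(-it)] by [-4]. *)
Lemma coefficient_bound (beta : nat -> C) (X k0 : nat) (T eta : R) :
  (1 <= k0)%nat -> (k0 < X)%nat ->
  (forall t, (T <= t)%R -> (Rabs (Im (D2 (line_sum beta X) t (PI / ln (INR (S k0))))) <= eta)%R) ->
  (4 * (Cmod (beta (S k0)) * Rpower (INR (S k0)) (- (1 / 2))) <= 2 * eta)%R.
Proof.
  intros Hk0 HX HD. set (u := (PI / ln (INR (S k0)))%R) in *.
  set (x := fun k => beta (S k) * RtoC (Rpower (INR (S k)) (- (1 / 2)))).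
  set (y := fun k => x k * (ni (S k) u + ni (S k) (- u) - 2)).
  assert (ED : forall t, D2 (line_sum beta X) t u = Csum (fun k => y k * ni (S k) t) X).
  { intros t. unfold D2. rewrite !line_sum_eq, <- Csum_plus, <- Csum_mult_l, <- Csum_minus.
    apply Csum_ext. intros k _. unfold Rminus. rewrite !ni_add. unfold y, x. ring. }
  assert (Hln : (0 < ln (INR (S k0)))%R).
  { rewrite <- ln_1. apply ln_increasing; [lra|]. apply (lt_INR 1). lia. }
  assert (Hy : y k0 = - (4) * x k0).
  { unfold y. rewrite <- ni_conj.
    assert (E : ni (S k0) u = - (1)).
    { unfold ni, u. replace (- (PI / ln (INR (S k0)) * ln (INR (S k0))))%R with (- PI)%R by (field; lra).
      unfold Cexp, Re, Im; simpl. rewrite exp_0, cos_neg, sin_neg, cos_PI, sin_PI.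
      apply injective_projections; simpl; ring. }
    rewrite E. apply injective_projections; simpl; ring. }
  assert (HB := has_mean_bound _ _ T (2 * eta) (has_mean_line_coefficient y X k0 Hk0 HX)).
  rewrite Hy in HB. unfold x in HB.
  rewrite !Cmod_mult, Cmod_opp, !Cmod_R, (Rabs_pos_eq 4), (Rabs_pos_eq (Rpower _ _)) in HB
    by (try apply Rlt_le, Rpower_pos; lra).
  apply HB. intros t Ht. rewrite Cmod_mult, Cmod_conj, Cmod_ni, Rmult_1_r, <- ED.
  rewrite im_alt', !Cmod_mult, Cmod_Ci, !Cmod_R, (Rabs_pos_eq 2) by lra.
  specialize (HD t Ht). lra.
Qed.

Theorem log_coefficients_vanish (HF HG : C -> C) (beta : nat -> C) (c : R) (f g : R -> C)
    (gF gG : R -> C) (oF oG : C) (m : nat) :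
  log_ratio HF HG beta c ->
  flat_at_infinity gF -> flat_at_infinity gG -> oF <> 0 -> oG <> 0 ->
  (forall t, gF t * f t = oF * Cconj (gF t * f t)) ->
  (forall t, gG t * g t = oG * Cconj (gG t * g t)) ->
  (forall t, HF ((1 / 2)%R, t) = Cpow (((1 / 2)%R, t) - 1) m * f t) ->
  (forall t, HG ((1 / 2)%R, t) = Cpow (((1 / 2)%R, t) - 1) m * g t) ->
  forall n, (1 <= n)%nat -> beta n = 0.
Proof.
  intros HR [HgF FF] [HgG FG] HoF HoG Hf Hg EF EG.
  assert (Hvan : forall k0, (1 <= k0)%nat -> beta (S k0) = 0).
  (* The coefficient at 1 is treated separately: 1 is not a prime power, while the increment
     [PI / ln n] makes sense only for [n >= 2]. *)
  2:{ intros n Hn. destruct n as [|[|k]]; [lia| |apply Hvan; lia].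
      apply (lr_support _ _ _ _ HR); [lia|]. intros Hpp.
      assert (H := pexp_lt 1 Hpp). destruct (prime_power_spec 1 Hpp) as (_ & H1 & _). lia. }
  intros k0 Hk0.
  destruct (log_coefficients_summable _ _ _ _ HR) as [W HW].
  set (U := (PI / ln (INR (S k0)))%R).
  assert (HU : (0 <= U)%R).
  { assert (Hpi := PI_RGT_0). apply Rdiv_le_0_compat; [lra|].
    rewrite <- ln_1. apply ln_increasing; [lra|]. apply (lt_INR 1). lia. }
  assert (Heta : forall eta, (0 < eta < 1 / 4)%R ->
    (4 * (Cmod (beta (S k0)) * Rpower (INR (S k0)) (- (1 / 2))) <= 2 * (2 * eta))%R).
  { intros eta He. set (e := (eta / 18)%R).
    assert (HeW := exp_pos W).
    (* The factor [exp (- W)] compensates the later division by [Cexp (L x)], whose modulus is at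
       least [exp (- W)]. *)
    destruct (ratio_eq_exp_on_half_plane _ _ _ _ (e * exp (- W)) HR) as [X0 HX0].
    { apply Rmult_lt_0_compat; [unfold e; lra|apply exp_pos]. }
    (* The margin 1 in [U + 1], and in [T] below, leaves room to move [t] and [u] away from the
       zeros of [HG]. *)
    destruct (FF e (U + 1)%R ltac:(unfold e; lra)) as [T1 HT1].
    destruct (FG e (U + 1)%R ltac:(unfold e; lra)) as [T2 HT2].
    set (X := (X0 + S k0)%nat). set (L := line_sum beta X).
    set (T := (Rmax T1 T2 + 1)%R).
    apply (coefficient_bound beta X k0 T (2 * eta) Hk0); [unfold X; lia|].
    fold U. intros t Ht.
    assert (HLc : forall x, contRC L x) by (intros; apply line_sum_cont).
    assert (Hgood : forall t u, (Rmax T1 T2 <= t)%R -> (Rabs u <= U + 1)%R ->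
      HG ((1 / 2)%R, t) <> 0 -> HG ((1 / 2)%R, (t + u)%R) <> 0 -> HG ((1 / 2)%R, (t - u)%R) <> 0 ->
      (Rabs (sin (Im (D2 L t u))) <= eta)%R).
    { intros t' u' Ht' Hu' N0 Np Nm. replace eta with (18 * e)%R by (unfold e; field).
      apply (sin_second_difference_le gF gG oF oG f g L t' u' e HgF HgG HoF HoG Hf Hg).
      - intros x Hx.
        assert (Nx : HG ((1 / 2)%R, x) <> 0)
          by (destruct Hx as [E|[E|E]]; subst x; assumption).
        assert (Ngx : g x <> 0) by (intros E; apply Nx; rewrite EG, E; ring).
        split; [exact Ngx|].
        assert (Hx1 : ((1 / 2)%R, x) - 1 <> 0).
        { intros E. apply (f_equal fst) in E. simpl in E. lra. }
        assert (Hp := Cpow_nz _ m Hx1).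
        specialize (HX0 X ltac:(unfold X; lia) ((1 / 2)%R, x) ltac:(unfold Re; simpl; lra)).
        change (dsum beta ((1 / 2)%R, x) X) with (L x) in HX0.
        rewrite EF, EG in HX0. set (P := Cpow (((1 / 2)%R, x) - 1) m) in *.
        assert (EL := Cexp_neq_0 (L x)).
        replace (f x / (g x * Cexp (L x)) - 1) with ((P * f x - Cexp (L x) * (P * g x)) / (P * g x * Cexp (L x)))
          by (field; auto).
        rewrite Cmod_div by (repeat apply Cmult_neq_0; assumption).
        assert (HL : (exp (- W) <= Cmod (Cexp (L x)))%R).
        { rewrite Cmod_Cexp.
          assert (H1 : (Cmod (L x) <= W)%R)
            by (eapply Rle_trans; [apply (Cmod_dsum_le _ _ (1 / 2)); unfold Re; simpl; lra|apply HW]).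
          assert (H2 := re_le_Cmod (L x)). apply Rabs_le_between in H2. apply exp_le_mono. lra. }
        assert (Hpg : (0 < Cmod (P * g x))%R) by (apply Cmod_gt_0; now apply Cmult_neq_0).
        rewrite (Cmod_mult (P * g x)).
        assert (Hew := exp_pos (- W)).
        apply Rmult_le_reg_r with (Cmod (P * g x) * Cmod (Cexp (L x)))%R; [nra|].
        unfold Rdiv. rewrite Rmult_assoc, Rinv_l by nra. rewrite Rmult_1_r.
        eapply Rle_trans; [exact HX0|].
        assert (He0 : (0 < e)%R) by (unfold e; lra).
        replace (e * exp (- W) * Cmod (P * g x))%R with (e * Cmod (P * g x) * exp (- W))%R by ring.
        rewrite <- Rmult_assoc. apply Rmult_le_compat_l; [|exact HL].
        apply Rmult_le_pos; lra.
      - apply HT1; [|exact Hu']. eapply Rle_trans; [apply Rmax_l|exact Ht'].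
      - apply HT2; [|exact Hu']. eapply Rle_trans; [apply Rmax_r|exact Ht'].
      - unfold e. lra. }
    (* Where [HG] vanishes at one of the three points, nearby triples without zeros and the
       continuity of the finite sum give the same bound. *)
    assert (Hall : forall u, (0 <= u <= U)%R -> (Rabs (sin (Im (D2 L t u))) <= eta)%R).
    { intros u Hu. apply Rnot_lt_le. intros Hlt.
      destruct (Im_D2_cont L t u (Rabs (sin (Im (D2 L t u))) - eta) HLc ltac:(lra)) as [d [Hd Hd']].
      destruct (dense_nonzero_triple HG (1 / 2) (RtoC 3) (lr_holo_G _ _ _ _ HR)
        (lr_G _ _ _ _ HR (RtoC 3) ltac:(unfold Re; simpl; lra)) t u (Rmin d 1) ltac:(apply Rmin_pos; lra))
        as (t' & u' & H1 & H2 & N0 & Np & Nm).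
      assert (A1 := Rlt_le_trans _ _ _ H1 (Rmin_l _ _)). assert (A2 := Rlt_le_trans _ _ _ H1 (Rmin_r _ _)).
      assert (B1 := Rlt_le_trans _ _ _ H2 (Rmin_l _ _)). assert (B2 := Rlt_le_trans _ _ _ H2 (Rmin_r _ _)).
      specialize (Hd' t' u' A1 B1).
      apply Rabs_lt_between in A2. apply Rabs_lt_between in B2.
      assert (Hg' := Hgood t' u' ltac:(unfold T in Ht; lra) ltac:(apply Rabs_le; lra) N0 Np Nm).
      assert (S1 := sin_sub_le (Im (D2 L t u)) (Im (D2 L t' u'))).
      rewrite (Rabs_minus_sym (Im (D2 L t u))) in S1.
      assert (S2 := Rabs_triang_inv (sin (Im (D2 L t u))) (sin (Im (D2 L t' u')))). lra. }
    apply (small_of_small_sin (fun u => Im (D2 L t u)) U eta HU); [lra| | |exact Hall].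
    - rewrite Im_D2. rewrite Rplus_0_r, Rminus_0_r. ring.
    - intros u. apply filterlim_locally. intros eps.
      destruct (Im_D2_cont L t u eps HLc (cond_pos eps)) as [d [Hd Hd']].
      exists (mkposreal d Hd). intros u' Hu'. apply Hd'; [|exact Hu'].
      rewrite Rminus_diag, Rabs_R0. exact Hd. }
  assert (Hp := Rpower_pos (INR (S k0)) (- (1 / 2))).
  apply Cmod_eq_0, Rle_antisym; [|apply Cmod_ge_0].
  apply Rnot_lt_le. intros Hlt.
  set (A := (Cmod (beta (S k0)) * Rpower (INR (S k0)) (- (1 / 2)))%R) in *.
  assert (HA : (0 < A)%R) by (apply Rmult_lt_0_compat; assumption).
  (* This choice of [eta] would give [4 A <= 2 A]. *)
  specialize (Heta (Rmin (1 / 8) (A / 2)) ).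
  assert (M1 := Rmin_l (1 / 8) (A / 2)). assert (M2 := Rmin_r (1 / 8) (A / 2)).
  assert (M3 : (0 < Rmin (1 / 8) (A / 2))%R) by (apply Rmin_pos; lra).
  specialize (Heta ltac:(lra)). lra.
Qed.

(** * From two members of the Selberg class to their equality *)

Lemma holo_eq_0_of_right (f : C -> C) (z : C) :
  (forall z, holo f z) -> (forall s, (3 <= Re s)%R -> f s = 0) -> f z = 0.
Proof.
  intros Hf H. apply (identity_principle f (RtoC 4) 1); [exact Hf|lra|].
  intros w Hw. apply H. apply Re_ge_of_disc in Hw. lra.
Qed.

(** Each continuation is multiplied by the power of [s - 1] belonging to the other, so both carry
    the exponent [mF + mG] and the quotient is unchanged. Subtracting the coefficients of the two
    logarithms gives the logarithm of the quotient. *)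
Lemma log_ratio_of_selberg (F G : C -> C) (a a' : nat -> C) (c : R) :
  selberg_series a F -> selberg_series a' G -> (0 < c)%R ->
  (forall s : C, (1 / 2 < Re s)%R -> s <> RtoC 1 -> (Cmod (F s) <= c * Cmod (G s))%R) ->
  exists HF HG beta m, log_ratio HF HG beta c /\
    (forall s : C, s <> 1 -> HF s = Cpow (s - 1) m * F s) /\
    (forall s : C, s <> 1 -> HG s = Cpow (s - 1) m * G s).
Proof.
  intros SF SG Hc Hle.
  destruct (selberg_continuation _ _ SF) as (mF & HF & EF & _ & HFe).
  destruct (selberg_continuation _ _ SG) as (mG & HG & EG & _ & HGe).
  destruct (selberg_euler_product _ _ SF) as (b & th & K & Hth & Hb0 & HbK & HbL).
  destruct (selberg_euler_product _ _ SG) as (b' & th' & K' & Hth' & Hb0' & HbK' & HbL').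
  exists (fun s => Cpow (s - 1) mG * HF s), (fun s => Cpow (s - 1) mF * HG s),
    (fun n => b n - b' n), (mF + mG)%nat.
  assert (E1 : forall s : C, s <> 1 -> Cpow (s - 1) mG * HF s = Cpow (s - 1) (mF + mG) * F s).
  { intros s Hs. rewrite (HFe s Hs), Cpow_add_r. ring. }
  assert (E2 : forall s : C, s <> 1 -> Cpow (s - 1) mF * HG s = Cpow (s - 1) (mF + mG) * G s).
  { intros s Hs. rewrite (HGe s Hs), Cpow_add_r. ring. }
  assert (hF : forall z, holo (fun s => Cpow (s - 1) mG * HF s) z).
  { intros z. apply holo_mult; [|apply ex_derive_holo, EF].
    apply holo_pow, holo_minus; [apply holo_id|apply holo_const]. }
  assert (hG : forall z, holo (fun s => Cpow (s - 1) mF * HG s) z).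
  { intros z. apply holo_mult; [|apply ex_derive_holo, EG].
    apply holo_pow, holo_minus; [apply holo_id|apply holo_const]. }
  assert (Hne1 : forall s : C, (3 <= Re s)%R -> s <> 1).
  { intros s Hs E. rewrite E in Hs. unfold Re in Hs; simpl in Hs. lra. }
  split; [|split; [exact E1|exact E2]].
  constructor.
  - exact hF.
  - exact hG.
  - exact Hc.
  - assert (Hne : forall s : C, (1 / 2 < Re s)%R -> s <> 1 ->
      (Cmod (Cpow (s - 1) mG * HF s) <= c * Cmod (Cpow (s - 1) mF * HG s))%R).
    { intros s Hs Hs1. rewrite E1, E2, !Cmod_mult by assumption.
      specialize (Hle s Hs Hs1). assert (H := Cmod_ge_0 (Cpow (s - 1) (mF + mG))). nra. }
    (* The hypothesis is silent at the possible pole; for the entire functions the inequality at 1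
       is a limit from the right. *)
    intros s Hs. destruct (classic (s = 1)) as [Es|Es]; [|now apply Hne].
    set (N := fun s => Cpow (s - 1) mG * HF s) in *. set (D := fun s => Cpow (s - 1) mF * HG s) in *.
    change (Cmod (N s) <= c * Cmod (D s))%R.
    assert (Hline : forall (f : C -> C), (forall z, holo f z) ->
      continuous (fun t : R => Cmod (f (s + RtoC t))) 0%R).
    { intros f Hf.
      apply (continuous_comp (U := R_UniformSpace) (V := C_UniformSpace) (fun t => f (s + RtoC t)) Cmod);
        [|apply continuous_Cmod].
      apply (contC_RtoC_comp (fun t => s + RtoC t) f); [|apply holo_cont, Hf].
      apply contC_plus; [apply contC_const|].
      apply continuous_pairC; [apply continuous_id|apply continuous_const]. }
    assert (H0 : (Cmod (N (s + RtoC 0)%C) + - c * Cmod (D (s + RtoC 0)%C) <= 0)%R).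
    { apply (Rle_limit_right (fun t => Cmod (N (s + RtoC t)%C) + - c * Cmod (D (s + RtoC t)%C))%R).
      - apply (continuous_plus (V := R_NormedModule)); [now apply Hline|].
        apply (continuous_scal_r (V := R_NormedModule)). now apply Hline.
      - intros t Ht. assert (H := Hne (s + RtoC t)).
        replace (Re (s + RtoC t)) with (Re s + t)%R in H by (destruct s; reflexivity).
        assert (Hs1 : s + RtoC t <> 1).
        { rewrite Es. intros E. apply (f_equal fst) in E. simpl in E. lra. }
        specialize (H ltac:(lra) Hs1).
        change (Cmod (N (s + RtoC t)%C) <= c * Cmod (D (s + RtoC t)%C))%R in H. lra. }
    rewrite Cplus_0_r in H0. lra.
  - intros s Hs. rewrite E2 by now apply Hne1.
    destruct (HbL' s ltac:(lra)) as [L [_ EL]]. rewrite <- EL.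
    apply Cmult_neq_0; [|apply Cexp_neq_0]. apply Cpow_nz. intros E.
    apply (Hne1 s Hs). rewrite <- (Cplus_0_l 1), <- E. ring.
  - intros s Hs. destruct (HbL s ltac:(lra)) as [L [HL EL]]. destruct (HbL' s ltac:(lra)) as [L' [HL' EL']].
    exists (L - L'). split.
    + unfold is_dirichlet in *.
      apply (is_series_ext (fun n => minus (G := C_NormedModule) (dirichlet_term b s n) (dirichlet_term b' s n))).
      * intros n. unfold dirichlet_term.
        change (b (S n) * Rcpow (INR (S n)) (- s) - b' (S n) * Rcpow (INR (S n)) (- s)
          = (b (S n) - b' (S n)) * Rcpow (INR (S n)) (- s)). ring.
      * exact (is_series_minus _ _ _ _ HL HL').
    + assert (Hs1 := Hne1 s Hs). rewrite E1, E2 by assumption. rewrite <- EL, <- EL', Cexp_minus.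
      assert (H := Cexp_neq_0 L'). field. exact H.
  - intros n Hn Hpp. rewrite Hb0, Hb0' by assumption. ring.
  - exists (Rabs K + Rabs K' + 1)%R, (Rmax th th').
    assert (A1 := Rabs_pos K). assert (A2 := Rabs_pos K').
    split; [lra|]. split; [now apply Rmax_lub_lt|].
    intros n Hn. specialize (HbK n Hn). specialize (HbK' n Hn).
    destruct n as [|n]; [lia|].
    assert (P1 := Rpower_INR_le n th (Rmax th th') (Rmax_l _ _)).
    assert (P2 := Rpower_INR_le n th' (Rmax th th') (Rmax_r _ _)).
    assert (Q1 := Rpower_pos (INR (S n)) th). assert (Q2 := Rpower_pos (INR (S n)) th').
    eapply Rle_trans; [apply Cmod_triangle|]. rewrite Cmod_opp.
    assert (B1 := Rle_abs K). assert (B2 := Rle_abs K').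
    set (P := Rpower (INR (S n)) (Rmax th th')) in *.
    assert (C1 : (K * Rpower (INR (S n)) th <= Rabs K * P)%R).
    { apply Rle_trans with (Rabs K * Rpower (INR (S n)) th)%R.
      - apply Rmult_le_compat_r; lra.
      - apply Rmult_le_compat_l; lra. }
    assert (C2 : (K' * Rpower (INR (S n)) th' <= Rabs K' * P)%R).
    { apply Rle_trans with (Rabs K' * Rpower (INR (S n)) th')%R.
      - apply Rmult_le_compat_r; lra.
      - apply Rmult_le_compat_l; lra. }
    nra.
Qed.

Theorem theorem3 (F G : C -> C)
  (hF : selberg_class F) (hG : selberg_class G)
  (hFG : exists c : R, (0 < c)%R /\
     forall s : C, (1 / 2 < Re s)%R -> s <> RtoC 1%R ->
       (Cmod (F s) <= c * Cmod (G s))%R) :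
  forall s : C, s <> RtoC 1%R -> F s = G s.
Proof.
  destruct hF as [a SF], hG as [a' SG], hFG as [c [Hc Hle]].
  destruct (log_ratio_of_selberg F G a a' c SF SG Hc Hle) as (HF & HG & beta & m & HR & E1 & E2).
  destruct (critical_line_relation F (selberg_functional_equation _ _ SF)) as (gF & oF & FF & HoF & RF).
  destruct (critical_line_relation G (selberg_functional_equation _ _ SG)) as (gG & oG & FG & HoG & RG).
  assert (Hhalf : forall t : R, (((1 / 2)%R, t) : C) <> RtoC 1).
  { intros t E. apply (f_equal fst) in E. simpl in E. lra. }
  assert (Hbeta : forall n, (1 <= n)%nat -> beta n = 0).
  { apply (log_coefficients_vanish HF HG beta c (fun t => F ((1 / 2)%R, t)) (fun t => G ((1 / 2)%R, t))
      gF gG oF oG m); auto. }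
  assert (Heq : forall s, HF s = HG s).
  { intros s. enough (E : HF s - HG s = 0) by (rewrite <- (Cplus_0_r (HG s)), <- E; ring).
    apply (holo_eq_0_of_right (fun s => HF s - HG s)).
    - intros z. apply holo_minus; [apply (lr_holo_F _ _ _ _ HR)|apply (lr_holo_G _ _ _ _ HR)].
    - intros w Hw. destruct (log_ratio_tail _ _ _ _ HR) as (K & HK & _ & Ht).
      (* With [beta = 0] the partial sums vanish, so for every [X] some logarithm of the quotient
         has modulus at most [K / X]. *)
      assert (Hlim : forall X, (1 <= X)%nat -> exists L, (Cmod L <= K * / INR X)%R /\ HF w = Cexp L * HG w).
      { intros X HX. destruct (Ht X w HX Hw) as [L [HL E]]. exists L. split; [|exact E].
        replace (dsum beta w X) with (RtoC 0) in HL.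
        - replace (L - 0) with L in HL by ring. exact HL.
        - unfold dsum. rewrite (Csum_ext _ (fun _ => 0)); [rewrite Csum_const; ring|].
          intros k _. unfold dirichlet_term. rewrite Hbeta by lia. ring. }
      apply Cmod_eq_0, Rle_antisym; [|apply Cmod_ge_0]. apply Rnot_lt_le. intros Hlt.
      assert (Hm := Cmod_ge_0 (HG w)).
      set (d := Cmod (HF w - HG w)) in *.
      (* The first summand makes [|L| <= 1/2], so that the linear bound on [Cexp L - 1] applies; the
         second makes [3 |L| |HG w|] smaller than [d]. *)
      destruct (INR_unbounded (2 * K + 3 * K * (Cmod (HG w) + 1) / d)%R) as [X0 HX0].
      assert (Hq : (0 < 3 * K * (Cmod (HG w) + 1) / d)%R)
        by (apply Rdiv_lt_0_compat; [nra|exact Hlt]).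
      assert (HX1 : (1 <= X0)%nat) by (destruct X0; [simpl in HX0; lra|lia]).
      destruct (Hlim X0 HX1) as [L [HL E]].
      assert (HX : (0 < INR X0)%R) by lra.
      assert (L1 : (K * / INR X0 <= 1 / 2)%R).
      { apply Rmult_le_reg_r with (INR X0); [exact HX|]. rewrite Rmult_assoc, Rinv_l by lra. lra. }
      assert (L2 : (3 * (K * / INR X0) * (Cmod (HG w) + 1) < d)%R).
      { apply Rmult_lt_reg_r with (INR X0 / d)%R; [now apply Rdiv_lt_0_compat|].
        replace (3 * (K * / INR X0) * (Cmod (HG w) + 1) * (INR X0 / d))%R with
          (3 * K * (Cmod (HG w) + 1) / d)%R by (field; lra).
        replace (d * (INR X0 / d))%R with (INR X0) by (field; lra). lra. }
      assert (L3 := Cexp_sub_1_le L ltac:(lra)).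
      assert (Hd : (d <= 3 * (K * / INR X0) * Cmod (HG w))%R).
      { unfold d. rewrite E. replace (Cexp L * HG w - HG w) with ((Cexp L - 1) * HG w) by ring.
        rewrite Cmod_mult. apply Rmult_le_compat_r; [exact Hm|]. lra. }
      assert (H0 := Cmod_ge_0 L). nra. }
  intros s Hs.
  assert (Hp : Cpow (s - 1) m <> 0).
  { apply Cpow_nz. intros E. apply Hs. rewrite <- (Cplus_0_l 1), <- E. ring. }
  assert (E := Heq s). rewrite E1, E2 in E by exact Hs.
  replace (F s) with (/ Cpow (s - 1) m * (Cpow (s - 1) m * F s)) by (field; exact Hp).
  rewrite E. field. exact Hp.
Qed.
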